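(* Let $n\ge 2$, $R>0$, $\Omega=B(0,R)\subset\mathbb{R}^n$ with outward unit normal $\vec{\mathbf n}$. Suppose the forcing term and the initial data are radial: by abuse of notation $c(x)=c(r)$ and $u_0(x)=u_0(r)$ for $|x|=r\in[0,R]$, where $c\in C^1([0,R],[0,\infty))$ and $u_0\in C^2([0,R])$ with $u_0'(R)=0$. Set $$\mathcal A:=\left\{r\in(0,R]: c(r)=\tfrac{n-1}{r}\right\},\quad \mathcal A_+:=\left\{r\in(0,R]: c(r)>\tfrac{n-1}{r}\right\},\quad \mathcal A_-:=\left\{r\in(0,R]: c(r)<\tfrac{n-1}{r}\right\},$$ and define $d:(0,R]\to(0,R]$ by $$d(r)=\begin{cases} r & \text{if } r\in\mathcal A,\\ \max(\mathcal A\cap(0,r)) & \text{if } r\in\mathcal A_+,\\ \min(\mathcal A\cap(r,R]) & \text{if } r\in\mathcal A_-\text{ and }\mathcal A\cap(r,R]\ne\emptyset,\\ R & \text{if } r\in\mathcal A_-\text{ and }\mathcal A\cap(r,R]=\emptyset.\end{cases}$$ Let $u$ be the unique viscosity solution of $$\begin{cases} u_t=|Du|\,\mathrm{div}\left(\frac{Du}{|Du|}\right)+c(x)|Du| & \text{in }\Omega\times(0,\infty),\\ \frac{\partial u}{\partial\vec{\mathbf n}}=0 & \text{on }\partial\Omega\times[0,\infty),\\ u(x,0)=u_0(x) & \text{on }\overline\Omega,\end{cases}$$ and write $u(x,t)=\phi(|x|,t)$. Then the limiting profile $\phi_\infty(r)=\lim_{t\to\infty}\phi(r,t)$ is given in terms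 of $u_0$ as follows: for each $r_0\in(0,R]$, $$\phi_\infty(r_0)=\max\{u_0(r): r\ge d(r_0)\},$$ where the maximum is over $r\in[d(r_0),R]$.
   Context: Viscosity solutions. Let $\mathcal S^n$ be the set of real symmetric $n\times n$ matrices and, for $x\in\overline\Omega$, $p\in\mathbb{R}^n\setminus\{0\}$, $X\in\mathcal S^n$, put $F(x,p,X)=\mathrm{trace}\left(\left(I-\frac{p\otimes p}{|p|^2}\right)X\right)+c(x)|p|$. For $(x,p,X)\in\overline\Omega\times\mathbb{R}^n\times\mathcal S^n$ let $F_*(x,p,X)=\liminf_{(y,q,Y)\to(x,p,X)}F(y,q,Y)$ and $F^*(x,p,X)=\limsup_{(y,q,Y)\to(x,p,X)}F(y,q,Y)$. An upper semicontinuous $u:\overline\Omega\times[0,\infty)\to\mathbb{R}$ is a viscosity subsolution if $u(\cdot,0)\le u_0$ on $\overline\Omega$ and, for any $\varphi\in C^2(\overline\Omega\times[0,\infty))$, whenever $(\hat x,\hat t)\in\overline\Omega\times(0,\infty)$ is a maximizer of $u-\varphi$: if $\hat x\in\Omega$ then $\varphi_t-F^*(\hat x,D\varphi,D^2\varphi)\le 0$ at $(\hat x,\hat t)$; if $\hat x\in\partial\Omega$ then $\min\{\varphi_t-F^*(\hat x,D\varphi,D^2\varphi),\ \frac{\partial\varphi}{\partial\vec{\mathbf n}}\}\le 0$ at $(\hat x,\hat t)$. A lower semicontinuous $u$ is a viscosity supersolution if $u(\cdot,0)\ge u_0$ on $\overline\Omega$ and, for any such $\varphi$, whenever $(\hat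 x,\hat t)\in\overline\Omega\times(0,\infty)$ is a minimizer of $u-\varphi$: if $\hat x\in\Omega$ then $\varphi_t-F_*(\hat x,D\varphi,D^2\varphi)\ge 0$; if $\hat x\in\partial\Omega$ then $\max\{\varphi_t-F_*(\hat x,D\varphi,D^2\varphi),\ \frac{\partial\varphi}{\partial\vec{\mathbf n}}\}\ge 0$. A continuous function is a viscosity solution if it is both a sub- and a supersolution. Existence, uniqueness and the comparison principle are well known in this setting; by radial symmetry the solution depends on $x$ only through $|x|$. *)

(* Defs.v *)
From HB Require Import structures.
From mathcomp Require Import all_boot all_order all_algebra.
From mathcomp Require Import all_classical all_reals all_analysis.

Set Implicit Arguments.
Unset Strict Implicit.
Unset Printing Implicit Defensive.

Import Order.TTheory GRing.Theory Num.Theory.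
Import numFieldNormedType.Exports.

Local Open Scope classical_set_scope.
Local Open Scope ring_scope.

Section Extrema.
Context {R : realType}.

Definition is_max (S : set R) (m : R) : Prop := S m /\ ubound S m.
Definition is_min (S : set R) (m : R) : Prop := S m /\ lbound S m.

(* Both return the junk value 0 when the extremum is not attained. *)
Definition set_max (S : set R) : R := xget 0 (is_max S).
Definition set_min (S : set R) : R := xget 0 (is_min S).

End Extrema.

Section SmoothOnSubset.
Context {R : realType}.

(* The derivative of f at x relative to D: one-sided at the end points when D
   is a closed interval, and independent of the values of f outside D. *)
Definition has_derivative_in (D : set R) (f : R -> R) (x l : R) : Prop :=
  (f y - f x) / (y - x) @[y --> within D x^'] --> l.

Definition C1_on (D : set R) (f : R -> R) : Prop :=
  exists f1 : R -> R,
    (forall x, D x -> has_derivative_in D f x (f1 x)) /\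
    {within D, continuous f1}.

Definition C2_on (D : set R) (f : R -> R) : Prop :=
  exists f1 : R -> R,
    (forall x, D x -> has_derivative_in D f x (f1 x)) /\ C1_on D f1.

(* C^2 on a neighbourhood of every point of the set D, through first and second
   directional derivatives in all directions; V is meant to be finite
   dimensional. When D is not open this is the usual reading of C^2(D):
   functions with a C^2 extension to an open set containing D. *)
Definition C2_near {V : normedModType R} (D : set V) (f : V -> R) : Prop :=
  exists U : set V, [/\ open U, D `<=` U &
    forall z, U z -> {for z, continuous f} /\
      forall v, [/\ derivable f z v, {for z, continuous ('D_v f)} &
        forall w, derivable ('D_v f) z w /\
                  {for z, continuous ('D_w ('D_v f))}]].

End SmoothOnSubset.

Section Geometry.
Context {R : realType} {n : nat}.
Implicit Types x : 'rV[R]_n.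

(* The norm `|x| of the library on 'rV_n is the sup norm. *)
Definition enorm x : R := Num.sqrt (\sum_(i < n) x 0 i ^+ 2).

Definition ball_in (rad : R) : set 'rV[R]_n := [set x | enorm x < rad].
Definition ball_cl (rad : R) : set 'rV[R]_n := [set x | enorm x <= rad].
Definition ball_bd (rad : R) : set 'rV[R]_n := [set x | enorm x = rad].

(* The outward unit normal of the ball centred at 0, at a boundary point x. *)
Definition normal x : 'rV[R]_n := (enorm x)^-1 *: x.

Definition cylinder (rad : R) : set ('rV[R]_n * R) :=
  [set z | ball_cl rad z.1 /\ 0 <= z.2].

End Geometry.

Section SpaceTimeDerivatives.
Context {R : realType} {n : nat}.
Implicit Types (f : 'rV[R]_n * R -> R) (z : 'rV[R]_n * R).

Definition dt f z : R := 'D_((0, 1) : 'rV[R]_n * R) f z.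

Definition dx (v : 'rV[R]_n) f z : R := 'D_((v, 0) : 'rV[R]_n * R) f z.

Definition grad f z : 'rV[R]_n := \row_i dx (delta_mx 0 i) f z.

Definition hess f z : 'M[R]_n :=
  \matrix_(i, j) dx (delta_mx 0 j) (dx (delta_mx 0 i) f) z.

End SpaceTimeDerivatives.

Section Operator.
Context {R : realType} {n : nat}.
Variables (rad : R) (c : 'rV[R]_n -> R).

Definition Fop (a : 'rV[R]_n * 'rV[R]_n * 'M[R]_n) : R :=
  let: (x, p, X) := a in
  \tr ((1%:M - (enorm p ^+ 2)^-1 *: (p^T *m p)) *m X) + c x * enorm p.

Definition Fdom : set ('rV[R]_n * 'rV[R]_n * 'M[R]_n) :=
  [set a | [/\ ball_cl rad a.1.1, a.1.2 != 0 & a.2^T = a.2]].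

Definition Flower (x p : 'rV[R]_n) (X : 'M[R]_n) : \bar R :=
  limf_einf (EFin \o Fop) (within Fdom (nbhs (x, p, X))).

Definition Fupper (x p : 'rV[R]_n) (X : 'M[R]_n) : \bar R :=
  limf_esup (EFin \o Fop) (within Fdom (nbhs (x, p, X))).

End Operator.

Section ViscositySolutions.
Context {R : realType} {n : nat}.
Variables (rad : R) (c u0 : 'rV[R]_n -> R).
Implicit Types (u phi : 'rV[R]_n * R -> R) (z : 'rV[R]_n * R).

(* Semicontinuity relative to D, through the subspace topology. *)
Definition lsc_on (D : set ('rV[R]_n * R)) u : Prop :=
  lower_semicontinuous (fun z : subspace D => (u z)%:E).

Definition usc_on (D : set ('rV[R]_n * R)) u : Prop :=
  lsc_on D (fun z => - u z).

Definition maximizer (D : set ('rV[R]_n * R)) u z : Prop :=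
  D z /\ forall z', D z' -> u z' <= u z.

Definition minimizer (D : set ('rV[R]_n * R)) u z : Prop :=
  D z /\ forall z', D z' -> u z <= u z'.

Definition upper_residual phi z : \bar R :=
  ((dt phi z)%:E - Fupper rad c z.1 (grad phi z) (hess phi z))%E.

Definition lower_residual phi z : \bar R :=
  ((dt phi z)%:E - Flower rad c z.1 (grad phi z) (hess phi z))%E.

Definition normal_derivative phi z : R := dx (normal z.1) phi z.

Definition viscosity_subsolution u : Prop :=
  [/\ usc_on (cylinder rad) u,
      forall x, ball_cl rad x -> u (x, 0) <= u0 x &
      forall phi, C2_near (cylinder rad) phi ->
      forall z, 0 < z.2 ->
        maximizer (cylinder rad) (fun z' => u z' - phi z') z ->
        (ball_in rad z.1 -> (upper_residual phi z <= 0)%E) /\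
        (ball_bd rad z.1 ->
          (mine (upper_residual phi z) (normal_derivative phi z)%:E <= 0)%E)].

Definition viscosity_supersolution u : Prop :=
  [/\ lsc_on (cylinder rad) u,
      forall x, ball_cl rad x -> u0 x <= u (x, 0) &
      forall phi, C2_near (cylinder rad) phi ->
      forall z, 0 < z.2 ->
        minimizer (cylinder rad) (fun z' => u z' - phi z') z ->
        (ball_in rad z.1 -> (0 <= lower_residual phi z)%E) /\
        (ball_bd rad z.1 ->
          (0 <= maxe (lower_residual phi z) (normal_derivative phi z)%:E)%E)].

Definition viscosity_solution u : Prop :=
  [/\ {within cylinder rad, continuous u},
      viscosity_subsolution u & viscosity_supersolution u].

End ViscositySolutions.

Section CriticalRadii.
Context {R : realType}.
Variables (n : nat) (rad : R) (c : R -> R).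

Definition Acrit : set R :=
  [set r | 0 < r <= rad /\ c r = (n%:R - 1) / r].
Definition Aplus : set R :=
  [set r | 0 < r <= rad /\ c r > (n%:R - 1) / r].
Definition Aminus : set R :=
  [set r | 0 < r <= rad /\ c r < (n%:R - 1) / r].

(* Only meaningful on ]0, rad], the disjoint union of the three sets above. *)
Definition dfun (r : R) : R :=
  if r \in Acrit then r
  else if r \in Aplus then set_max (Acrit `&` `]0, r[)
  else if `[< Acrit `&` `]r, rad] !=set0 >]
       then set_min (Acrit `&` `]r, rad])
  else rad.

End CriticalRadii.

(* Main.v *)
Require Import Defs.
From HB Require Import structures.
From mathcomp Require Import all_boot all_order all_algebra.
From mathcomp Require Import all_classical all_reals all_analysis.
From mathcomp Require Import ring lra.

Set Implicit Arguments.
Unset Strict Implicit.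
Unset Printing Implicit Defensive.

Import Order.TTheory GRing.Theory Num.Theory.
Import numFieldNormedType.Exports.

Local Open Scope classical_set_scope.
Local Open Scope ring_scope.

(** In the variable [h = |x|^2] the radial equation is first order,
    [w_t = 2 (n - 1) w_h + 2 r c(r) |w_h|] with [h = r^2], without singularity
    at the origin, and [u(x, t)] is the maximum of the initial datum over the
    interval swept from [|x|^2] in time [t] by the characteristics
    [h' = 2 (n - 1) + 2 a r c(r)], [-1 <= a <= 1], stopped at the boundary.
    Neither the comparison principle nor the exact characteristics are needed:
    with [pos3 s] the cube of the positive part of [s], the functions
      [N0 + eps t + K exp (L t) (pos3 (q1(t) - h) + pos3 (h - q2(t)))]
    are strict supersolutions when [q1], [q2] follow the extreme characteristics
    backwards, up to an error that [eps t] absorbs. They are smooth, hence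
    admissible test functions, once [q1] and [q2] are replaced by Euler polygons
    and the barrier is restarted at every node. Lower bounds are the same bounds
    for [- u] and [- c]. Letting the mesh tend to [0] gives radial symmetry; for
    large times the slowest characteristic converges to [d(r0)^2] and the fastest
    one reaches the boundary, uniformly in the mesh. *)

(** * Test functions *)

(** The operator is singular at zero gradient. A function of [h = |x|^2] has gradient [al x] and
    Hessian [al I + be x x^T]; the cube makes [al] and [be] vanish together on the barriers, so
    wherever the gradient is zero the Hessian is a multiple of the identity, and the curvature term
    no longer depends on the direction of approach.

    The coefficient [2 r c(r)] need not be Lipschitz in [h] at [0]. The fronts [q1], [q2] are
    therefore kept above a positive floor, which is possible because curvature dominates near the
    origin when [n >= 2]. At a point [h] ahead of a front [q] the speed error is [Lam |h - q|];
    multiplied by the squared distance in the derivative of the cube it is cubic, and [L = 3 Lam]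
    absorbs it.

    At the boundary the fronts are held at [rad^2 - dl], which makes the normal derivative of the
    barrier positive there. The upper front held at this cap breaks its speed condition only where
    the squared distance is of order [(dl + Vb D)^2]. Hence [K], [L], [eps] are fixed first, and the
    gap [dl] and the mesh [D] are taken small afterwards. *)

Section ChainRule.
Context {R : realType} {V : normedModType R}.

Lemma derive_along_line (f : V -> R) (z v : V) :
  'D_1 (fun h : R => f (h *: v + z)) 0 = 'D_v f z.
Proof.
rewrite /derive; set g1 := fun h => h^-1 *: _; set g2 := fun h => h^-1 *: _.
suff -> : g1 = g2 by [].
by rewrite funeqE /g1 /g2 => h /=; rewrite addr0 scale0r add0r [_%:A]mulr1.
Qed.

(** Only a derivative of [f] along [v] is given, so the one-variable chain rule is applied to the
    restriction of [f] to the line through [z], where derivable means differentiable. *)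
Lemma is_derive_comp_real (g : R -> R) (f : V -> R) (z v : V) (df dg : R) :
  is_derive z v f df -> is_derive (f z) 1 g dg ->
  is_derive z v (g \o f) (dg * df).
Proof.
move=> [f_drv <-] [g_drv <-].
pose l := fun h : R => f (h *: v + z).
have l_drv : derivable l 0 1 by exact: (proj1 (derivable1P f z v)).
have l0 : l 0 = f z by rewrite /l scale0r add0r.
have g_drv' : derivable g (l 0) 1 by rewrite l0.
have dgl : derivable (g \o l) 0 1.
  by apply/derivable1_diffP; apply: differentiable_comp; apply/derivable1_diffP.
apply: DeriveDef; first exact: (proj2 (derivable1P (g \o f) z v)).
rewrite -(derive_along_line (g \o f)).
have := derive1_comp l_drv g_drv'.
by rewrite !derive1E l0 (derive_along_line f).
Qed.

End ChainRule.

(** * Second-order calculus with explicit directional derivatives *)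

Section TwiceDifferentiable.
Context {R : realType} {V : normedModType R}.
Implicit Types v w z : V.

(** [f1 v] is the derivative of [f] along [v], and [f2 v w] that of [f1 v] along [w]. Carrying them
    as data, through sums, products and compositions, yields gradients and Hessians of test
    functions in closed form. *)
Definition C2data (f : V -> R) (f1 : V -> V -> R) (f2 : V -> V -> V -> R) : Prop :=
  [/\ continuous f,
      forall v z, is_derive z v f (f1 v z),
      forall v, continuous (f1 v),
      forall v w z, is_derive z w (f1 v) (f2 v w z) &
      forall v w, continuous (f2 v w)].

Definition C2real (g g1 g2 : R -> R) : Prop :=
  [/\ forall s : R, is_derive s 1 g (g1 s),
      forall s : R, is_derive s 1 g1 (g2 s) & continuous g2].

Lemma C2real_continuous (g g1 g2 : R -> R) : C2real g g1 g2 ->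
  continuous g /\ continuous g1.
Proof.
move=> [d1 d2 _]; split=> s; apply: differentiable_continuous.
  by apply/derivable1_diffP; case: (d1 s).
by apply/derivable1_diffP; case: (d2 s).
Qed.

Lemma C2data_near f f1 f2 (D : set V) : C2data f f1 f2 -> C2_near D f.
Proof.
move=> [cf d1 c1 d2 c2]; exists setT; split=> //; first exact: openT.
move=> z _; split; first exact: cf.
have E1 v : 'D_v f = f1 v by apply/funext => y; case: (d1 v y).
have E2 v w : 'D_w (f1 v) = f2 v w by apply/funext => y; case: (d2 v w y).
move=> v; rewrite E1; split; [by case: (d1 v z)|exact: c1|].
by move=> w; rewrite E2; split; [case: (d2 v w z)|exact: c2].
Qed.

Lemma C2data_cst (k : R) : C2data (fun=> k) (fun _ _ => 0) (fun _ _ _ => 0).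
Proof. by split=> *; try exact: cst_continuous; exact: is_derive_cst. Qed.

Lemma C2data_add f f1 f2 g g1 g2 : C2data f f1 f2 -> C2data g g1 g2 ->
  C2data (fun z => f z + g z) (fun v z => f1 v z + g1 v z)
    (fun v w z => f2 v w z + g2 v w z).
Proof.
move=> [cf d1 c1 d2 c2] [cg e1 k1 e2 k2]; split.
- by move=> z; apply: cvgD; [exact: cf|exact: cg].
- by move=> v z; exact: (is_deriveD (d1 v z) (e1 v z)).
- by move=> v z; apply: cvgD; [exact: c1|exact: k1].
- by move=> v w z; exact: (is_deriveD (d2 v w z) (e2 v w z)).
- by move=> v w z; apply: cvgD; [exact: c2|exact: k2].
Qed.

Lemma is_derive_mul (f g : V -> R) z v (df dg : R) : is_derive z v f df -> is_derive z v g dg ->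
  is_derive z v (fun z => f z * g z) (df * g z + f z * dg).
Proof.
move=> hf hg; have h := @is_deriveM _ _ f g z v _ _ hf hg.
apply: (is_derive_eq h).
by rewrite /GRing.scale /= addrC [g z * _]mulrC.
Qed.

Lemma C2data_mul f f1 f2 g g1 g2 : C2data f f1 f2 -> C2data g g1 g2 ->
  C2data (fun z => f z * g z) (fun v z => f1 v z * g z + f z * g1 v z)
    (fun v w z => (f2 v w z * g z + f1 v z * g1 w z)
                + (f1 w z * g1 v z + f z * g2 v w z)).
Proof.
move=> [cf d1 c1 d2 c2] [cg e1 k1 e2 k2]; split.
- by move=> z; apply: cvgM; [exact: cf|exact: cg].
- by move=> v z; exact: is_derive_mul.
- move=> v z; apply: cvgD; apply: cvgM;
  by [exact: c1|exact: cg|exact: cf|exact: k1].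
- by move=> v w z; apply: is_deriveD; exact: is_derive_mul.
- move=> v w z; apply: cvgD; apply: cvgD; apply: cvgM;
  by [exact: c1|exact: cg|exact: cf|exact: k1|exact: c2|exact: k2].
Qed.

Lemma C2data_comp (g g1 g2 : R -> R) f f1 f2 :
  C2real g g1 g2 -> C2data f f1 f2 ->
  C2data (fun z => g (f z)) (fun v z => g1 (f z) * f1 v z)
    (fun v w z => g2 (f z) * f1 w z * f1 v z + g1 (f z) * f2 v w z).
Proof.
move=> hg [cf d1 c1 d2 c2].
have [cg cg1] := C2real_continuous hg; have [dg dg1 cg2] := hg.
have K (k : R -> R) : continuous k -> continuous (fun z => k (f z)).
  by move=> ck z; apply: continuous_comp; [exact: cf|exact: ck].
split.
- exact: K.
- by move=> v z; exact: (is_derive_comp_real (d1 v z) (dg (f z))).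
- by move=> v z; apply: cvgM; [exact: K|exact: c1].
- move=> v w z; apply: is_derive_mul => //.
  exact: (is_derive_comp_real (d1 w z) (dg1 (f z))).
- move=> v w z; apply: cvgD; apply: cvgM.
  + by apply: cvgM; [exact: K|exact: c1].
  + exact: c1.
  + exact: K.
  + exact: c2.
Qed.

Lemma C2data_opp f f1 f2 : C2data f f1 f2 ->
  C2data (fun z => - f z) (fun v z => - f1 v z) (fun v w z => - f2 v w z).
Proof.
move=> [cf d1 c1 d2 c2]; split.
- by move=> z; apply: cvgN; exact: cf.
- by move=> v z; exact: is_deriveN.
- by move=> v z; apply: cvgN; exact: c1.
- by move=> v w z; exact: is_deriveN.
- by move=> v w z; apply: cvgN; exact: c2.
Qed.

Lemma C2data_linear (l : V -> R) : continuous l ->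
  (forall (k : R) v w, l (k *: v + w) = k * l v + l w) ->
  C2data l (fun v _ => l v) (fun _ _ _ => 0).
Proof.
move=> cl ll; split=> //; try by move=> *; exact: cst_continuous.
  move=> v z; have l0 : l 0 = 0.
    by have := ll 1 0 0; rewrite scale1r addr0 mul1r; lra.
  have E : (fun h : R => h^-1 *: ((l \o shift z) (h *: v) - l z)) @ 0^' --> l v.
    apply: cvg_near_cst; near=> h.
    have h0 : h != 0 by near: h; exact: nbhs_dnbhs_neq.
    by rewrite /= ll addrK /GRing.scale /= mulKf.
  apply: DeriveDef; last exact: cvg_lim E.
  by apply/cvg_ex; exists (l v).
by move=> v w z; exact: is_derive_cst.
Unshelve. all: by end_near. Qed.

End TwiceDifferentiable.

(** * The cube of the positive part *)

Section PositiveCube.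
Context {R : realType}.
Implicit Types s : R.

Definition pos s : R := Num.max 0 s.
Definition pos3 s : R := pos s ^+ 3.

Lemma pos_ge0 s : 0 <= pos s. Proof. by rewrite /pos le_max lexx. Qed.

Lemma pos3_ge0 s : 0 <= pos3 s.
Proof. by rewrite exprn_ge0 // pos_ge0. Qed.

Lemma pos_pos s : 0 <= s -> pos s = s.
Proof. by rewrite /pos; case: ltgtP. Qed.

Lemma pos_neg s : s <= 0 -> pos s = 0.
Proof. by rewrite /pos; case: ltgtP. Qed.

Lemma pos_continuous : continuous pos.
Proof.
move=> s; rewrite /pos; apply: continuous_max; first exact: cst_continuous.
exact: cvg_id.
Qed.

(** Off [0] the function is locally zero or a power; at [0] the difference quotient is at most
    [|h|^(k + 1)]. Two uses of the lemma exhaust the cube, the least power that is twice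
    continuously differentiable. *)
Lemma is_derive_pos_exp (k : nat) s :
  is_derive s 1 (fun x => pos x ^+ k.+2) (k.+2%:R * pos s ^+ k.+1).
Proof.
have E : (fun h : R => h^-1 *: (((fun x => pos x ^+ k.+2) \o shift s) (h *: 1)
   - pos s ^+ k.+2)) @ 0^' --> k.+2%:R * pos s ^+ k.+1.
  have poly : (fun h : R => h^-1 *: (((fun x : R => x ^+ k.+2) \o shift s) (h *: 1)
   - s ^+ k.+2)) @ 0^' --> k.+2%:R * s ^+ k.+1.
    have := @exprn_derivable R k.+2 s 1.
    by rewrite /derivable => /cvgP; rewrite -/(derive _ _ _) exp_derive /=
      /GRing.scale /= mulr1.
  have [s0|s0|s0] := ltgtP s 0.
  - rewrite pos_neg ?ltW // !expr0n /= mulr0.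
    apply: cvg_near_cst; near=> h.
    rewrite /= pos_neg ?expr0n ?subr0 ?scaler0 //= ltW //.
    rewrite [_%:A]mulr1 -ltrBrDr sub0r (le_lt_trans (ler_norm _)) //.
    near: h; apply: dnbhs0_lt; lra.
  - rewrite pos_pos ?ltW //; apply: cvg_trans poly.
    apply: near_eq_cvg; near=> h.
    rewrite /= pos_pos // [_%:A]mulr1.
    have : `|h| < s by near: h; exact: dnbhs0_lt.
    by move=> /ltr_normlP[]; lra.
  - rewrite s0 pos_neg // !expr0n /= mulr0.
    apply/cvgrPdist_lt => e e0; near=> h.
    have h0 : h != 0 by near: h; exact: nbhs_dnbhs_neq.
    rewrite /= addr0 [_%:A]mulr1 subr0 sub0r normrN /GRing.scale /= normrM normfV.
    have hn : 0 < `|h| by rewrite normr_gt0.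
    have h1 : `|h| < 1 by near: h; exact: dnbhs0_lt.
    have he : `|h| < e by near: h; exact: dnbhs0_lt.
    rewrite mulrC ltr_pdivrMr // (le_lt_trans (y := `|h| ^+ 2)) //; last first.
      by rewrite expr2 ltr_pM2r.
    rewrite normrX (le_trans (y := `|h| ^+ k.+2)) //.
      rewrite lerXn2r ?nnegrE // /pos; case: (ltP 0 h) => // _.
      by rewrite normr0.
    by rewrite -addn2 exprD ler_piMl ?exprn_ge0 // exprn_ile1 // ltW.
apply: DeriveDef; last exact: cvg_lim E.
by apply/cvg_ex; eexists; exact: E.
Unshelve. all: by end_near. Qed.

Lemma is_derive_pos_sq s : is_derive s 1 (fun x => 3 * pos x ^+ 2) (6 * pos s).
Proof.
have h := is_derive_mul (is_derive_cst (3 : R) s (1 : R)) (is_derive_pos_exp 0 s).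
apply: (is_derive_eq h).
by rewrite /cst mul0r add0r expr1 mulrA; congr (_ * _); rewrite -natrM.
Qed.

Lemma C2real_pos3 : C2real pos3 (fun s => 3 * pos s ^+ 2) (fun s => 6 * pos s).
Proof.
split; [exact: is_derive_pos_exp|exact: is_derive_pos_sq|].
move=> s; apply: cvgM; first exact: cvg_cst.
exact: pos_continuous.
Qed.

End PositiveCube.

(** * The geometric operator on radial test functions *)

Section EuclideanNorm.
Context {R : realType} {n : nat}.
Implicit Types x y : 'rV[R]_n.

Definition sqn x : R := \sum_(i < n) x 0 i ^+ 2.

Lemma sqn_ge0 x : 0 <= sqn x.
Proof. by apply: sumr_ge0 => i _; exact: sqr_ge0. Qed.

Lemma enorm_ge0 x : 0 <= enorm x. Proof. exact: sqrtr_ge0. Qed.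

Lemma enorm_sqr x : enorm x ^+ 2 = sqn x.
Proof. by rewrite /enorm sqr_sqrtr ?sqn_ge0. Qed.

Lemma sqrt_sqn x : Num.sqrt (sqn x) = enorm x.
Proof. by []. Qed.

Lemma coord_le_enorm x i : `|x 0 i| <= enorm x.
Proof.
rewrite -sqrtr_sqr ler_sqrt ?sqn_ge0 // (bigD1 i) //= lerDl.
by apply: sumr_ge0 => j _; exact: sqr_ge0.
Qed.

Lemma enorm_eq0 x : enorm x = 0 -> x = 0.
Proof.
move=> x0; apply/rowP => i; rewrite mxE; apply/eqP; rewrite -normr_le0 -x0.
exact: coord_le_enorm.
Qed.

Lemma enormZ (k : R) x : enorm (k *: x) = `|k| * enorm x.
Proof.
rewrite /enorm -sqrtr_sqr -sqrtrM ?sqr_ge0 // mulr_sumr.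
by congr Num.sqrt; apply: eq_bigr => i _; rewrite mxE exprMn.
Qed.

Lemma enorm0 : enorm (0 : 'rV[R]_n) = 0.
Proof. by rewrite -(scale0r 0) enormZ normr0 mul0r. Qed.

Lemma enorm_gt0 x : x != 0 -> 0 < enorm x.
Proof.
rewrite lt_def enorm_ge0 andbT; apply: contraNN => /eqP x0.
by apply/eqP; exact: enorm_eq0.
Qed.

Lemma enorm_delta (i : 'I_n) : enorm (delta_mx 0 i : 'rV[R]_n) = 1.
Proof.
rewrite /enorm (bigD1 i) //= big1 ?addr0 => [|j ji]; last first.
  by rewrite mxE (negbTE ji) andbF expr0n.
by rewrite mxE !eqxx expr1n sqrtr1.
Qed.

Lemma cvg_sumr {T : Type} {I : finType} (F : set_system T)
    (f : I -> T -> R) (a : I -> R) :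
  Filter F -> (forall i, f i @ F --> a i) -> \sum_i f i x @[x --> F] --> \sum_i a i.
Proof. by move=> FF fa; apply: cvg_big => //; exact: add_continuous. Qed.

Lemma sqn_continuous : continuous sqn.
Proof.
move=> x; rewrite /sqn.
apply: (@cvg_sumr _ _ (nbhs x) (fun i (y : 'rV[R]_n) => y 0 i ^+ 2)) => i.
by apply: cvgM; exact: coord_continuous.
Qed.

Lemma enorm_continuous : continuous (@enorm R n).
Proof.
move=> x; apply: (@continuous_comp _ _ _ sqn Num.sqrt); first exact: sqn_continuous.
exact: sqrt_continuous.
Qed.

End EuclideanNorm.

(** * Limit of the operator at radial gradients and Hessians *)

Section OperatorLimit.
Context {R : realType} {n : nat}.
Variables (rad : R) (cx : 'rV[R]_n -> R) (C : R -> R).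
Hypotheses (C_cont : continuous C)
  (cxC : forall x, ball_cl rad x -> cx x = C (enorm x)).

Let T := ('rV[R]_n * 'rV[R]_n * 'M[R]_n)%type.

(** The trace of [q^T q Y], that is, the quadratic form of [Y] at [q]. *)
Definition quad (q : 'rV[R]_n) (Y : 'M[R]_n) : R :=
  \sum_i \sum_j q 0 i * q 0 j * Y j i.

Lemma Fop_quad (y q : 'rV[R]_n) (Y : 'M[R]_n) :
  Fop cx (y, q, Y) = \sum_i Y i i - (sqn q)^-1 * quad q Y + cx y * enorm q.
Proof.
rewrite /Fop; congr (_ + _); rewrite mulmxBl mul1mx raddfB /=; congr (_ - _).
rewrite enorm_sqr -scalemxAl linearZ /=; congr (_ * _).
rewrite /mxtrace /quad; apply: eq_bigr => i _; rewrite mxE.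
by apply: eq_bigr => j _; rewrite mxE big_ord1 mxE.
Qed.

Lemma quad_cvg (a : T) : (quad b.1.2 b.2) @[b --> a] --> quad a.1.2 a.2.
Proof.
have fst12 (i : 'I_n) : ((b : T).1.2 0 i) @[b --> a] --> a.1.2 0 i.
  apply: (@continuous_comp _ _ _ (fun b : T => b.1.2) (fun q : 'rV[R]_n => q 0 i)).
    by apply: (@continuous_comp _ _ _ (@fst _ _) (@snd _ _)); [exact: cvg_fst|exact: cvg_snd].
  exact: coord_continuous.
rewrite /quad.
apply: (@cvg_sumr _ T _ (nbhs a) (fun (i : 'I_n) (b : T) => \sum_j b.1.2 0 i * b.1.2 0 j * b.2 j i)) => i.
apply: (@cvg_sumr _ T _ (nbhs a) (fun (j : 'I_n) (b : T) => b.1.2 0 i * b.1.2 0 j * b.2 j i)) => j.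
apply: cvgM; first by apply: cvgM; exact: fst12.
apply: (@continuous_comp _ _ _ (fun b : T => b.2) (fun Y : 'M[R]_n => Y j i)).
  exact: cvg_snd.
exact: coord_continuous.
Qed.

Lemma coef_cvg (i j : 'I_n) (a : T) : ((b : T).2 i j) @[b --> a] --> a.2 i j.
Proof.
apply: (@continuous_comp _ _ _ (fun b : T => b.2) (fun Y : 'M[R]_n => Y i j)).
  exact: cvg_snd.
exact: coord_continuous.
Qed.

Lemma momentum_cvg (a : T) : b.1.2 @[b --> a] --> a.1.2.
Proof.
by apply: (@continuous_comp _ _ _ (@fst _ _) (@snd _ _)); [exact: cvg_fst|exact: cvg_snd].
Qed.

Lemma point_cvg (a : T) : b.1.1 @[b --> a] --> a.1.1.
Proof.
by apply: (@continuous_comp _ _ _ (@fst _ _) (@fst _ _)); [exact: cvg_fst|exact: cvg_fst].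
Qed.

Lemma quad_rank1 (x : 'rV[R]_n) (al be : R) (X : 'M[R]_n) :
  (forall i j, X i j = al * (i == j)%:R + be * (x 0 i * x 0 j)) ->
  \sum_i X i i = n%:R * al + be * sqn x /\
  forall k, quad (k *: x) X = k ^+ 2 * (al * sqn x + be * sqn x ^+ 2).
Proof.
move=> XE; split.
  under eq_bigr do rewrite XE eqxx mulr1 -expr2.
  by rewrite big_split /= sumr_const card_ord -mulr_sumr mulr_natl.
move=> k.
have -> : k ^+ 2 * (al * sqn x + be * sqn x ^+ 2) =
    \sum_i (k ^+ 2 * al + k ^+ 2 * be * sqn x) * x 0 i ^+ 2.
  by rewrite -mulr_sumr -/(sqn x); ring.
rewrite /quad; apply: eq_bigr => i _.
under eq_bigr => j _ do rewrite XE !mxE.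
rewrite (eq_bigr (fun j => (k ^+ 2 * al * x 0 i * x 0 j * (j == i)%:R
   + k ^+ 2 * be * x 0 i ^+ 2 * x 0 j ^+ 2))); last by move=> j _; ring.
rewrite big_split /= -mulr_sumr -/(sqn x) (bigD1 i) //= eqxx big1.
  by rewrite !mulr1 addr0; ring.
by move=> j /negbTE ->; rewrite mulr0.
Qed.

Lemma quad_le (q : 'rV[R]_n) (Y : 'M[R]_n) :
  `|quad q Y| <= sqn q * \sum_i \sum_j `|Y j i|.
Proof.
rewrite /quad (le_trans (ler_norm_sum _ _ _)) // mulr_sumr ler_sum // => i _.
rewrite (le_trans (ler_norm_sum _ _ _)) // mulr_sumr ler_sum // => j _.
rewrite normrM ler_wpM2r // normrM -enorm_sqr expr2.
by apply: ler_pM => //; exact: coord_le_enorm.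
Qed.

(** If [p] is nonzero the operator is continuous there. If [p = 0], then [al = 0], hence [be = 0],
    or else [x = 0]; in both cases [X = al I], for which every direction [q] gives the same value
    [(n - 1) al]. *)
Lemma Fop_cvg (x p : 'rV[R]_n) (X : 'M[R]_n) (al be : R) :
  p = al *: x ->
  (forall i j, X i j = al * (i == j)%:R + be * (x 0 i * x 0 j)) ->
  (al = 0 -> be = 0) ->
  Fop cx a @[a --> within (Fdom rad) (nbhs (x, p, X))]
    --> (n%:R - 1) * al + C (enorm x) * (`|al| * enorm x).
Proof.
move=> pE XE albe.
pose G (a : T) := \sum_i a.2 i i - (sqn a.1.2)^-1 * quad a.1.2 a.2.
have : (G a + C (enorm a.1.1) * enorm a.1.2)
   @[a --> within (Fdom rad) (nbhs (x, p, X))]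
    --> (n%:R - 1) * al + C (enorm x) * (`|al| * enorm x).
  apply: cvgD; last first.
    apply: cvg_within_filter; rewrite -enormZ -pE; apply: cvgM.
      apply: (@cvg_comp _ _ _ (fun a : T => enorm a.1.1) C _ (nbhs (enorm x))).
        apply: (@cvg_comp _ _ _ (fun a : T => a.1.1) enorm _ (nbhs x)).
          exact: point_cvg.
        exact: enorm_continuous.
      exact: C_cont.
    apply: (@cvg_comp _ _ _ (fun a : T => a.1.2) enorm _ (nbhs p)).
      exact: momentum_cvg.
    exact: enorm_continuous.
  have [tX qX] := quad_rank1 XE.
  have [p0|p0] := eqVneq p 0; last first.
    have x0 : sqn x != 0.
      rewrite -enorm_sqr expf_eq0 /= gt_eqF // enorm_gt0 //.
      by apply: contraNN p0 => /eqP x0; rewrite pE x0 scaler0.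
    have al0 : al != 0 by apply: contraNN p0 => /eqP al0; rewrite pE al0 scale0r.
    apply: cvg_within_filter.
    have sp : sqn p = al ^+ 2 * sqn x.
      by rewrite -!enorm_sqr pE enormZ exprMn -normrX ger0_norm ?sqr_ge0.
    have -> : (n%:R - 1) * al = \sum_i X i i - (sqn p)^-1 * quad p X.
      by rewrite tX sp pE qX; field; rewrite al0 x0.
    apply: cvgB; first by apply: cvg_sumr => i; exact: coef_cvg.
    apply: cvgM; last exact: quad_cvg.
    apply: cvgV; first by rewrite sp mulf_neq0 // expf_neq0.
    apply: (@cvg_comp _ _ _ (fun a : T => a.1.2) sqn _ (nbhs p)).
      exact: momentum_cvg.
    exact: sqn_continuous.
  have bx i j : be * (x 0 i * x 0 j) = 0.
    have /eqP : al *: x = 0 by rewrite -pE.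
    rewrite scaler_eq0 => /orP[/eqP/albe ->|/eqP ->]; first by rewrite mul0r.
    by rewrite mxE mul0r mulr0.
  have XE' i j : X i j = al * (i == j)%:R by rewrite XE bx addr0.
  pose Z (a : T) := a.2 - al%:M.
  pose H (a : T) := \sum_i `|Z a i i| + \sum_i \sum_j `|Z a j i|.
  have Zcvg (i j : 'I_n) : Z a i j @[a --> (x, p, X)] --> (0 : R).
    have -> : 0 = X i j - al * (i == j)%:R by rewrite XE' subrr.
    rewrite (_ : (fun _ => _) = fun a : T => a.2 i j - al * (i == j)%:R).
      by apply: cvgB; [exact: coef_cvg|exact: cvg_cst].
    by apply/funext => a; rewrite /Z !mxE mulr_natr.
  have Hcvg : H a @[a --> (x, p, X)] --> (0 : R).
    have -> : (0 : R) = \sum_(i < n) `|0 : R| + \sum_(i < n) \sum_(j < n) `|0 : R|.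
      by rewrite normr0 !(sumr_const, big1_eq) ?mul0rn ?addr0.
    apply: cvgD; first by apply: cvg_sumr => i; exact: cvg_norm.
    by apply: cvg_sumr => i; apply: cvg_sumr => j; exact: cvg_norm.
  (* For [Y] near [al I] the direction-dependent part is the quadratic form of [Y - al I] divided by
     [|q|^2], bounded by the entries of [Y - al I] uniformly in [q]. *)
  have GH a : a.1.2 != 0 -> `|(n%:R - 1) * al - G a| <= H a.
    move=> q0; have sq0 : 0 < sqn a.1.2 by rewrite -enorm_sqr exprn_gt0 // enorm_gt0.
    have -> : (n%:R - 1) * al - G a =
        - \sum_i Z a i i + (sqn a.1.2)^-1 * quad a.1.2 (Z a).
      have -> : quad a.1.2 (Z a) = quad a.1.2 a.2 - al * sqn a.1.2.
        rewrite /quad /sqn mulr_sumr -sumrB; apply: eq_bigr => i _.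
        rewrite [X in _ - X](_ : _ =
          \sum_j al * a.1.2 0 i * a.1.2 0 j * (j == i)%:R); last first.
          rewrite (bigD1 i) //= eqxx big1 => [|j /negbTE ->]; last by rewrite mulr0.
          by rewrite addr0 mulr1; ring.
        rewrite -sumrB; apply: eq_bigr => j _.
        by rewrite /Z !mxE -mulr_natr; ring.
      have -> : \sum_i Z a i i = \sum_i a.2 i i - n%:R * al.
        rewrite -[n in n%:R]card_ord mulr_natl -sumr_const -sumrB.
        by apply: eq_bigr => i _; rewrite /Z !mxE eqxx mulr1n.
      by rewrite /G; field; rewrite gt_eqF.
    rewrite (le_trans (ler_normD _ _)) // normrN lerD ?ler_norm_sum //.
    rewrite normrM gtr0_norm ?invr_gt0 // mulrC ler_pdivrMr // mulrC.
    exact: quad_le.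
  apply/cvgrPdist_lt => e e0.
  move/cvgrPdist_lt: Hcvg => /(_ _ e0) He.
  apply: (filterS _ He) => a Ha [_ q0 _].
  rewrite (le_lt_trans (GH _ q0)) // (le_lt_trans (ler_norm _)) //.
  by rewrite -normrN -sub0r.
move=> GF; apply: cvg_trans GF; apply: near_eq_cvg.
apply: (filterS _ (filterT : nbhs (x, p, X) setT)) => -[[y q] Y] _ [a1 _ _].
by rewrite Fop_quad cxC.
Qed.

End OperatorLimit.

Section ExtendedLimits.
Context {R : realType} {T : choiceType} {X : filteredType T}.

Lemma limf_esup_le (f : X -> R) (F : set_system X) {FF : Filter F} (l : R) :
  f @ F --> l -> (limf_esup (EFin \o f) F <= l%:E)%E.
Proof.
move=> fl; apply/lee_addgt0Pr => e e0.
rewrite limf_esupE; apply: ge_ereal_inf; exists (ereal_sup ((EFin \o f) @` [set a | f a < l + e])); last first.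
  apply: ge_ereal_sup => _ [a /= fa <-]; rewrite -EFinD lee_fin; exact: ltW.
exists [set a | f a < l + e] => //.
move/cvgrPdist_lt: fl => /(_ _ e0); apply: filterS => a /ltr_normlP[] h1 h2 /=.
by lra.
Qed.

Lemma limf_einf_ge (f : X -> R) (F : set_system X) {FF : Filter F} (l : R) :
  f @ F --> l -> (l%:E <= limf_einf (EFin \o f) F)%E.
Proof.
move=> fl; rewrite /limf_einf leeNr.
exact: (limf_esup_le (cvgN fl)).
Qed.

End ExtendedLimits.

(** * From viscosity inequalities to tests by functions of [|x|^2] *)

Section RadialTests.
Context {R : realType} {n : nat}.
Variable rad : R.
Local Notation V := ('rV[R]_n * R)%type.
Local Notation e_ i := (delta_mx 0 i : 'rV[R]_n).

(* The part of the definition of a subsolution that is used: it only concerns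
   test functions whose gradient and Hessian at the point of contact are those
   of a function of [|x|^2], and which are flat enough ([al = 0 -> be = 0]) for
   the operator to have a limit there. Since [- u] satisfies it with [- C] when
   [u] is a supersolution, lower bounds are instances of upper bounds. *)
Definition sub_test (C : R -> R) (U : V -> R) : Prop :=
  forall f f1 f2, C2data f f1 f2 ->
  forall z : V, 0 < z.2 ->
    maximizer (cylinder rad) (fun z' => U z' - f z') z ->
  forall al be : R,
    (forall i, f1 (e_ i, 0) z = al * z.1 0 i) ->
    (forall i j, f2 (e_ i, 0) (e_ j, 0) z =
       al * (i == j)%:R + be * (z.1 0 i * z.1 0 j)) ->
    (al = 0 -> be = 0) ->
    (ball_bd rad z.1 -> 0 < f1 (normal z.1, 0) z) ->
  f1 (0, 1) z <= (n%:R - 1) * al + C (enorm z.1) * (`|al| * enorm z.1).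

Variables (cx u0 : 'rV[R]_n -> R) (C : R -> R).
Hypotheses (C_cont : continuous C)
  (cxC : forall x, ball_cl rad x -> cx x = C (enorm x)).

Lemma C2data_derivatives (f : V -> R) f1 f2 (z : V) (al be : R) : C2data f f1 f2 ->
  (forall i, f1 (e_ i, 0) z = al * z.1 0 i) ->
  (forall i j, f2 (e_ i, 0) (e_ j, 0) z =
     al * (i == j)%:R + be * (z.1 0 i * z.1 0 j)) ->
  [/\ dt f z = f1 (0, 1) z, grad f z = al *: z.1,
      normal_derivative f z = f1 (normal z.1, 0) z &
      forall i j, hess f z i j = al * (i == j)%:R + be * (z.1 0 i * z.1 0 j)].
Proof.
move=> [_ d1 _ d2 _] H1 H2; split.
- by rewrite /dt; case: (d1 (0, 1) z).
- by apply/rowP => i; rewrite !mxE /dx -H1; case: (d1 (e_ i, 0) z).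
- by rewrite /normal_derivative /dx; case: (d1 (normal z.1, 0) z).
- move=> i j; rewrite mxE -H2 /dx.
  rewrite (_ : (fun z0 => _) = f1 (e_ i, 0)); first by case: (d2 (e_ i, 0) (e_ j, 0) z).
  by apply/funext => y; case: (d1 (e_ i, 0) y).
Qed.

Lemma ball_cl_cases (x : 'rV[R]_n) : ball_cl rad x -> ball_in rad x \/ ball_bd rad x.
Proof.
rewrite /ball_cl /ball_in /ball_bd /=; rewrite le_eqVlt => /orP[/eqP|]; by [right|left].
Qed.

(** At a boundary point the positive normal derivative forces the residual to be the nonpositive
    entry of the minimum, so interior and boundary points give the same inequality. *)
Lemma sub_test_subsolution u : viscosity_subsolution rad cx u0 u -> sub_test C u.
Proof.
move=> [_ _ usub] f f1 f2 hf z z0 zmax al be H1 H2 albe Hn.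
have [dtE gE nE hE] := C2data_derivatives hf H1 H2.
have [Hin Hbd] := usub f (C2data_near _ hf) z z0 zmax.
have lim := Fop_cvg C_cont cxC gE hE albe.
have Fle : (Fupper rad cx z.1 (grad f z) (hess f z) <=
    ((n%:R - 1) * al + C (enorm z.1) * (`|al| * enorm z.1))%:E)%E.
  exact: (limf_esup_le lim).
have res : (upper_residual rad cx f z <= 0)%E.
  have [zcl _] : cylinder rad z by case: zmax.
  case: (ball_cl_cases zcl) => [/Hin //|bd].
  move: (Hbd bd); rewrite minEle; case: ifP => // _.
  by rewrite nE lee_fin leNgt (Hn bd).
move: res; rewrite /upper_residual dtE.
(* The value [+oo] is excluded by [Fle], the value [-oo] by the sign of the residual. *)
case: (Fupper _ _ _ _ _) Fle => [r| |] //=.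
rewrite lee_fin => h; rewrite -EFinB lee_fin subr_le0 => h'.
exact: le_trans h.
Qed.

(** The curvature term is odd in [(p, X)] and the forcing term is even, so replacing [u] by [- u]
    only reverses the sign of the forcing. *)
Lemma sub_test_supersolution u : viscosity_supersolution rad cx u0 u ->
  sub_test (fun r => - C r) (fun z => - u z).
Proof.
move=> [_ _ usup] f f1 f2 hf z z0 zmax al be H1 H2 albe Hn.
pose g (z' : V) : R := - f z'.
have hg : C2data g _ _ := C2data_opp hf.
have H1' i : - f1 (e_ i, 0) z = (- al) * z.1 0 i by rewrite H1 mulNr.
have H2' i j : - f2 (e_ i, 0) (e_ j, 0) z =
    (- al) * (i == j)%:R + (- be) * (z.1 0 i * z.1 0 j) by rewrite H2; ring.
have [dtE gE nE hE] := C2data_derivatives hg H1' H2'.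
have zmin : minimizer (cylinder rad) (fun z' => u z' - (- f z')) z.
  by case: zmax => zc zm; split=> // z' /zm; lra.
have [Hin Hbd] := usup _ (C2data_near _ hg) z z0 zmin.
have albe' : - al = 0 -> - be = 0.
  by move=> /eqP; rewrite oppr_eq0 => /eqP/albe ->; rewrite oppr0.
have lim := Fop_cvg C_cont cxC gE hE albe'.
have Fge : (((n%:R - 1) * (- al) + C (enorm z.1) * (`|- al| * enorm z.1))%:E <=
    Flower rad cx z.1 (grad g z) (hess g z))%E.
  exact: (limf_einf_ge lim).
have res : (0 <= lower_residual rad cx g z)%E.
  have [zcl _] : cylinder rad z by case: zmax.
  case: (ball_cl_cases zcl) => [/Hin //|bd].
  move: (Hbd bd); rewrite maxEle; case: ifP => // _.
  by rewrite nE lee_fin oppr_ge0 leNgt (Hn bd).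
move: res; rewrite /lower_residual dtE.
case: (Flower _ _ _ _ _) Fge => [r| |] //=.
rewrite lee_fin normrN => h; rewrite -EFinB lee_fin subr_ge0 => h'.
by move: (le_trans h h'); lra.
Qed.

End RadialTests.

(** * Comparison with barriers *)

Section TimePenalty.
Context {R : realType}.

Lemma truncn_itv_bound (t : R) : `|t| < (Num.truncn `|t|).+1%:R.
Proof. by have /andP[] := truncn_itv (normr_ge0 t). Qed.

(* [p k] is meant to vanish on [t <= k], so that the sum is locally finite. *)
Definition locsum (p : nat -> R -> R) (t : R) : R :=
  \sum_(k < (Num.truncn `|t|).+1) p k t.

(** Terms of index at least [|t|] vanish at [t], so all truncations above [|t|] agree. Near a given
    point the sum is thus one fixed finite sum, and smoothness is inherited termwise. *)
Lemma locsumE p (N : nat) (t : R) :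
  (forall k t, t <= k%:R -> p k t = 0) -> `|t| < N%:R ->
  locsum p t = \sum_(k < N) p k t.
Proof.
move=> p0 tN; rewrite /locsum.
have key M : `|t| < M%:R -> (M <= N)%N -> \sum_(k < M) p k t = \sum_(k < N) p k t.
  move=> tM MN; rewrite -(big_mkord xpredT (fun k => p k t)).
  rewrite -[RHS](big_mkord xpredT (fun k => p k t)).
  rewrite [RHS](@big_cat_nat _ _ _ M) //= [X in _ + X]big_nat_cond.
  rewrite [X in _ + X]big1 ?addr0 // => k /andP[/andP[Mk _] _].
  by apply: p0; rewrite (le_trans (ler_norm _)) // (le_trans (ltW tM)) // ler_nat.
apply: key; first exact: truncn_itv_bound.
have /andP[h _] := truncn_itv (normr_ge0 t).
by rewrite -(ltr_nat R); exact: le_lt_trans tN.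
Qed.

Lemma locsum_near p (t : R) : (forall k t, t <= k%:R -> p k t = 0) ->
  \forall s \near t, \sum_(k < (Num.truncn `|t|).+1) p k s = locsum p s.
Proof.
move=> p0; near=> s; rewrite (@locsumE p (Num.truncn `|t|).+1) //.
near: s; apply: (cvgr_lt `|t|); last exact: truncn_itv_bound.
exact: norm_continuous.
Unshelve. all: by end_near. Qed.

Lemma is_derive_sum_ord (N : nat) (p p1 : nat -> R -> R) (s : R) :
  (forall k, is_derive s 1 (p k) (p1 k s)) ->
  is_derive s 1 (fun s => \sum_(k < N) p k s) (\sum_(k < N) p1 k s).
Proof.
move=> dp; elim: N => [|N IH].
  rewrite big_ord0 (_ : (fun _ => _) = cst 0); first exact: is_derive_cst.
  by apply/funext => ?; rewrite big_ord0.
rewrite big_ord_recr /=.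
rewrite (_ : (fun _ => _) = (fun s => \sum_(k < N) p k s) + p N).
  exact: is_deriveD.
by apply/funext => ?; rewrite big_ord_recr.
Qed.

Lemma is_derive_locsum (p p1 : nat -> R -> R) (s : R) :
  (forall k t, t <= k%:R -> p k t = 0) ->
  (forall k (t : R), is_derive t 1 (p k) (p1 k t)) ->
  is_derive s 1 (locsum p) (locsum p1 s).
Proof.
move=> p0 dp; apply: (near_eq_is_derive (locsum_near s p0)).
by apply: is_derive_sum_ord => k; exact: dp.
Qed.

Lemma locsum_continuous (p : nat -> R -> R) : (forall k t, t <= k%:R -> p k t = 0) ->
  (forall k, continuous (p k)) -> continuous (locsum p).
Proof.
move=> p0 cp t; rewrite /continuous_at.
have -> : locsum p t = \sum_(k < (Num.truncn `|t|).+1) p k t by [].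
apply: (cvg_trans (near_eq_cvg (locsum_near t p0))).
apply: (@cvg_sumr R R _ (nbhs t)
  (fun (k : 'I_(Num.truncn `|t|).+1) s => p k s)) => k.
exact: cp.
Qed.

Lemma C2real_scale (g g1 g2 : R -> R) (k a b : R) : C2real g g1 g2 ->
  C2real (fun t => k * g (a * t + b)) (fun t => k * (a * g1 (a * t + b)))
    (fun t => k * (a * (a * g2 (a * t + b)))).
Proof.
move=> [d1 d2 c2].
have aff (t : R) : is_derive t 1 (fun t : R => a * t + b) a.
  have h1 := is_derive_mul (is_derive_cst a t (1 : R)) (is_derive_id t (1 : R)).
  apply: (is_derive_eq (is_deriveD h1 (is_derive_cst b t (1 : R)))).
  by rewrite /cst; ring.
have K (h h1 : R -> R) (l t : R) : (forall s : R, is_derive s 1 h (h1 s)) ->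
    is_derive t 1 (fun t => l * h (a * t + b)) (l * (a * h1 (a * t + b))).
  move=> dh; have h2 := is_derive_comp_real (aff t) (dh (a * t + b)).
  apply: (is_derive_eq (is_derive_mul (is_derive_cst l t (1 : R)) h2)).
  by rewrite /cst; ring.
split; [by move=> s; exact: K| |].
  move=> s; rewrite (_ : (fun _ => _) = fun t => (k * a) * g1 (a * t + b)).
    by apply: (is_derive_eq (K _ _ _ _ d2)); ring.
  by apply/funext => t; ring.
move=> s; apply: cvgM; first exact: cvg_cst.
apply: cvgM; first exact: cvg_cst.
apply: cvgM; first exact: cvg_cst.
apply: (@cvg_comp _ _ _ (fun t => a * t + b) g2 _ (nbhs (a * s + b))).
  by apply: cvgD; [apply: cvgM; [exact: cvg_cst|exact: cvg_id]|exact: cvg_cst].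
exact: c2.
Qed.

(* A test function must control [u] for all times, although nothing is known
   about the growth of [u]. *)
Lemma time_penalty (m : nat -> R) (t2 dl : R) : 0 < dl ->
  exists rho rho1 rho2 : R -> R,
  [/\ C2real rho rho1 rho2, forall t, 0 <= rho1 t, forall t, 0 <= rho t,
      forall t, t <= t2 -> rho t = 0 &
      forall (k : nat) t, t2 + dl * k.+1%:R <= t -> m k <= rho t].
Proof.
move=> dl0; have di0 : 0 < dl^-1 by rewrite invr_gt0.
(* In units of [dl] after [t2], the [k]-th term vanishes up to time [k] and is at least [M k] from
   time [k + 1] on. The maximum with [0] keeps every term nonnegative and nondecreasing. *)
pose M k := Num.max 0 (m k).
have M0 k : 0 <= M k by rewrite /M le_max lexx.
pose p (k : nat) t := M k * pos3 (1 * t + - k%:R).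
pose p1 (k : nat) t := M k * (1 * (3 * pos (1 * t + - k%:R) ^+ 2)).
pose p2 (k : nat) t := M k * (1 * (1 * (6 * pos (1 * t + - k%:R)))).
have hp k : C2real (p k) (p1 k) (p2 k) by exact: C2real_scale C2real_pos3.
have z k t : t <= k%:R -> pos (1 * t + - k%:R) = 0 :> R.
  by move=> tk; rewrite pos_neg // mul1r subr_le0.
have pz k t : t <= k%:R -> p k t = 0.
  by move=> tk; rewrite /p /pos3 z // expr0n mulr0.
have p1z k t : t <= k%:R -> p1 k t = 0.
  by move=> tk; rewrite /p1 z // expr0n !mulr0.
have p2z k t : t <= k%:R -> p2 k t = 0 by move=> tk; rewrite /p2 z // !mulr0.
have hS : C2real (locsum p) (locsum p1) (locsum p2).
  have dp k (t : R) : is_derive t 1 (p k) (p1 k t) by case: (hp k).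
  have dp1 k (t : R) : is_derive t 1 (p1 k) (p2 k t) by case: (hp k).
  split.
  - by move=> s; exact: (is_derive_locsum s pz dp).
  - by move=> s; exact: (is_derive_locsum s p1z dp1).
  - by apply: locsum_continuous => // k; case: (hp k).
have := C2real_scale 1 dl^-1 (- (dl^-1 * t2)) hS.
set rho := fun t => _; set rho1 := fun t => _; set rho2 := fun t => _ => hrho.
exists rho, rho1, rho2; split => //.
- move=> t; rewrite /rho1 mul1r mulr_ge0 //; first exact: ltW.
  apply: sumr_ge0 => k _; by rewrite /p1 mul1r mulr_ge0 // mulr_ge0 // sqr_ge0.
- move=> t; rewrite /rho mul1r; apply: sumr_ge0 => k _.
  by rewrite /p mulr_ge0 // exprn_ge0 // pos_ge0.
- move=> t tt2; rewrite /rho mul1r /locsum big1 // => k _; apply: pz.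
  by rewrite (le_trans _ (ler0n _ _)) // -mulrBr pmulr_rle0 // subr_le0.
- move=> k t tk; rewrite /rho mul1r.
  set s := _ + _.
  have sk : k.+1%:R <= s.
    by rewrite /s -mulrBr ler_pdivlMl // lerBrDl.
  have Ns : (k < (Num.truncn `|s|).+1)%N.
    rewrite -(ltr_nat R) (le_lt_trans _ (truncn_itv_bound s)) //.
    by rewrite (le_trans _ (ler_norm _)) // (le_trans _ sk) // ler_nat.
  rewrite /locsum (bigD1 (Ordinal Ns)) //=.
  rewrite (le_trans (y := p k s)) //; last first.
    rewrite lerDl; apply: sumr_ge0 => j _.
    by rewrite /p mulr_ge0 // exprn_ge0 // pos_ge0.
  rewrite /p /pos3 mul1r pos_pos; last first.
    by rewrite subr_ge0 (le_trans _ sk) // ler_nat.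
  rewrite (le_trans (y := M k)) //; first by rewrite /M le_max lexx orbT.
  rewrite ler_peMr // exprn_ege1 // lerBrDl (le_trans _ sk) //.
  by rewrite -[k.+1]addn1 natrD.
Qed.

End TimePenalty.

(** * Comparison over one time step *)

Section StepComparison.
Context {R : realType} {n : nat}.
Variable rad : R.
Hypothesis rad_gt0 : 0 < rad.
Local Notation V := ('rV[R]_n * R)%type.
Local Notation e_ i := (delta_mx 0 i : 'rV[R]_n).

Lemma norm_le_enorm (x : 'rV[R]_n) : `|x| <= enorm x.
Proof.
rewrite /Num.norm /= mx_normrE; elim/big_ind: _ => [|a b ha hb|i _].
- exact: enorm_ge0.
- by rewrite ge_max ha hb.
- by rewrite (ord1 i.1); exact: coord_le_enorm.
Qed.

Lemma ball_cl_compact : compact (ball_cl rad : set 'rV[R]_n).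
Proof.
apply: bounded_closed_compact.
  exists rad; split; first exact: num_real.
  move=> M radM x /= xr; rewrite (le_trans (norm_le_enorm _)) //.
  exact: le_trans xr (ltW radM).
have -> : (ball_cl rad : set 'rV[R]_n) = (@enorm R n) @^-1` [set y | y <= rad] by [].
apply: preimage_closed; last exact: closed_le.
by move=> x _; exact: enorm_continuous.
Qed.

Definition cyl_until (T : R) : set V := [set z | cylinder rad z /\ z.2 <= T].

Lemma cyl_until_compact (T : R) : compact (cyl_until T).
Proof.
have -> : cyl_until T = ball_cl rad `*` `[0, T]%classic.
  apply/seteqP; split => -[x t] /=.
    by move=> [[/= a b] c]; split=> //; rewrite in_itv /= b c.
  by move=> [/= a]; rewrite in_itv /= => /andP[].
by apply: compact_setX; [exact: ball_cl_compact|exact: segment_compact].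
Qed.

Lemma cyl_until_max (T : R) (g : V -> R) : 0 <= T ->
  {within cylinder rad, continuous g} ->
  exists2 c, cyl_until T c & forall z, cyl_until T z -> g z <= g c.
Proof.
move=> T0 cg.
have cg' : {within cyl_until T, continuous g}.
  by apply: continuous_subspaceW cg => z [].
have ne : cyl_until T !=set0.
  exists (0, 0); split=> //; split=> //=.
  by rewrite /ball_cl /= enorm0 ltW.
have [c /set_mem cK cmax] := compact_EVT_max ne (@cyl_until_compact T) cg'.
by exists c => // z zK; apply: cmax; exact: mem_set.
Qed.

Lemma within_add (D : set V) (f g : V -> R) :
  {within D, continuous f} -> {within D, continuous g} ->
  {within D, continuous (fun z => f z + g z)}.
Proof. by move=> cf cg z; apply: cvgD; [exact: cf|exact: cg]. Qed.

Lemma within_opp (D : set V) (f : V -> R) :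
  {within D, continuous f} -> {within D, continuous (fun z => - f z)}.
Proof. by move=> cf z; apply: cvgN; exact: cf. Qed.

Lemma within_max (D : set V) (f g : V -> R) :
  {within D, continuous f} -> {within D, continuous g} ->
  {within D, continuous (fun z => Num.max (f z) (g z))}.
Proof.
move=> cf cg z.
exact: (@continuous_max _ _ (f : subspace D -> R) (g : subspace D -> R) z
  (cf z) (cg z)).
Qed.

Lemma time_continuous (D : set V) (h : R -> R) : continuous h ->
  {within D, continuous (fun z : V => h z.2)}.
Proof.
move=> ch; apply: continuous_subspaceT => z.
by apply: continuous_comp; [exact: cvg_snd|exact: ch].
Qed.

(** Let [mu] be the minimum, over the compact set of times up to [t1], of the larger of [E / 2 - g]
    and [t1 - t]. It is positive: at [t1] the first is, before [t1] the second. So [g > E / 2]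
    happens only at least [mu] before [t1], where a penalty with [B mu^3] above the maximum of [g]
    suffices. *)
Lemma past_penalty (g : V -> R) (t1 E : R) : 0 <= t1 -> 0 < E ->
  {within cylinder rad, continuous g} ->
  (forall x, ball_cl rad x -> g (x, t1) <= 0) ->
  exists2 B : R, 0 <= B &
    forall z, cyl_until t1 z -> g z - B * pos3 (t1 - z.2) <= E / 2.
Proof.
move=> t10 E0 cg g0.
pose h (z : V) := - Num.max (E / 2 - g z) (t1 - z.2).
have ch : {within cylinder rad, continuous h}.
  apply: within_opp; apply: within_max.
    apply: (@within_add _ (fun=> E / 2) (fun z => - g z)); last exact: within_opp.
    by apply: continuous_subspaceT => ?; exact: cst_continuous.
  apply: (@time_continuous _ (fun t => t1 - t)) => t.
  by apply: cvgB; [exact: cvg_cst|exact: cvg_id].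
have [zm [[zc1 zc2] zc3] zmax] := cyl_until_max t10 ch.
have [zM zMK zMmax] := cyl_until_max t10 cg.
pose mu := - h zm.
have mu0 : 0 < mu.
  rewrite /mu /h opprK lt_max; move: zc3; rewrite le_eqVlt => /orP[/eqP e|e].
    apply/orP; left; have := g0 zm.1 zc1; rewrite -e -surjective_pairing; lra.
  by apply/orP; right; rewrite subr_gt0.
pose B := Num.max 0 (g zM) / mu ^+ 3.
have B0 : 0 <= B by rewrite /B divr_ge0 ?le_max ?lexx // exprn_ge0 // ltW.
exists B => // z zK.
have P0 : 0 <= pos3 (t1 - z.2) by rewrite exprn_ge0 // pos_ge0.
have [gE|gE] := leP (g z) (E / 2).
  by have := mulr_ge0 B0 P0; lra.
have muz : mu <= t1 - z.2.
  have : mu <= Num.max (E / 2 - g z) (t1 - z.2).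
    by rewrite -[leRHS]opprK lerN2; exact: zmax.
  by rewrite le_max => /orP[hh|//]; exfalso; move: mu0 gE hh; lra.
have : mu ^+ 3 <= pos3 (t1 - z.2).
  rewrite /pos3 pos_pos; last by apply: le_trans muz; exact: ltW.
  by rewrite lerXn2r // nnegrE ?(ltW mu0) // (le_trans (ltW mu0)).
move=> /(ler_wpM2l B0); rewrite /B divfK ?expf_neq0 ?gt_eqF // -/B.
have := zMmax z zK; have : g zM <= Num.max 0 (g zM) by rewrite le_max lexx orbT.
lra.
Qed.

(** [m k] bounds [g] up to [t2 + dl (k + 2)], while [time_penalty] reaches [m k] from
    [t2 + dl (k + 1)] on: the two match on each interval of length [dl] past [t2 + dl]. *)
Lemma future_bound (g : V -> R) (t2 dl : R) : 0 <= t2 -> 0 < dl ->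
  {within cylinder rad, continuous g} ->
  exists m : nat -> R, forall k z, cylinder rad z ->
    z.2 <= t2 + dl * k.+2%:R -> g z <= m k.
Proof.
move=> t20 dl0 cg.
have : forall k : nat, exists m : R, forall z, cylinder rad z ->
    z.2 <= t2 + dl * k.+2%:R -> g z <= m.
  move=> k; have T0 : 0 <= t2 + dl * k.+2%:R.
    by rewrite addr_ge0 // mulr_ge0 // ltW.
  have [c _ cmax] := cyl_until_max T0 cg.
  by exists (g c) => z zc zT; apply: cmax.
by move=> /choice[m mP]; exists m => k z zc zT; exact: mP.
Qed.

Variables (C : R -> R) (U : V -> R).
Hypotheses (U_cont : {within cylinder rad, continuous U})
  (U_test : sub_test rad C U).

(** The hypotheses of [sub_test] on the derivatives, together with the strict reverse of its
    conclusion: contact at [z] is impossible. *)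
Definition strict_barrier (w : V -> R) (w1 : V -> V -> R)
    (w2 : V -> V -> V -> R) (z : V) : Prop :=
  exists al be : R,
  [/\ forall i, w1 (e_ i, 0) z = al * z.1 0 i,
      forall i j, w2 (e_ i, 0) (e_ j, 0) z =
        al * (i == j)%:R + be * (z.1 0 i * z.1 0 j),
      al = 0 -> be = 0,
      ball_bd rad z.1 -> 0 < w1 (normal z.1, 0) z &
      (n%:R - 1) * al + C (enorm z.1) * (`|al| * enorm z.1) < w1 (0, 1) z].

(* The penalties of [past_penalty] and [time_penalty] force the contact point into
   the time interval where [w] is strict; the second one is nondecreasing in time,
   so it preserves strictness. *)
Lemma step_comparison w w1 w2 (t1 t2 dl : R) : 0 <= t1 -> t1 <= t2 -> 0 < dl ->
  C2data w w1 w2 ->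
  (forall z, cylinder rad z -> t1 < z.2 -> z.2 <= t2 + dl ->
     strict_barrier w w1 w2 z) ->
  (forall x, ball_cl rad x -> U (x, t1) <= w (x, t1)) ->
  forall x, ball_cl rad x -> U (x, t2) <= w (x, t2).
Proof.
move=> t10 t12 dl0 hw wbar init x xb; rewrite leNgt; apply/negP => Uw.
have t20 : 0 <= t2 := le_trans t10 t12.
pose E := U (x, t2) - w (x, t2); have E0 : 0 < E by rewrite /E subr_gt0.
pose g (z : V) := U z + - w z.
have cg : {within cylinder rad, continuous g}.
  apply: within_add => //; apply: within_opp; apply: continuous_subspaceT.
  by case: hw.
have g0 y : ball_cl rad y -> g (y, t1) <= 0 by move=> /init; rewrite /g; lra.
have [B B0 past] := past_penalty t10 E0 cg g0.
have [m mP] := future_bound t20 dl0 cg.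
have [rho [rho1 [rho2 [hrho rho1_ge0 rho_ge0 rho0 rhom]]]] := time_penalty m t2 dl0.
have hsnd : C2data (fun z : V => z.2) (fun v _ => v.2) (fun _ _ _ => 0).
  by apply: C2data_linear => // z; exact: cvg_snd.
have hB := C2real_scale B (-1) t1 (C2real_pos3 (R := R)).
have hf := C2data_add hw (C2data_add (C2data_comp hB hsnd) (C2data_comp hrho hsnd)).
set f := (fun z : V => _) in hf.
have fE z : U z - f z = g z - (B * pos3 (t1 - z.2) + rho z.2).
  by rewrite /f /g mulN1r [- z.2 + t1]addrC; ring.
have t2dl0 : 0 <= t2 + dl by rewrite addr_ge0 // ltW.
have cF : {within cylinder rad, continuous (fun z => U z + - f z)}.
  apply: within_add => //; apply: within_opp; apply: continuous_subspaceT.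
  by case: hf.
have [zh [zcyl zT] zmax] := cyl_until_max t2dl0 cF.
have FE : E <= U zh - f zh.
  (* At time [t2] both penalties vanish, so the supposed excess [E] is a lower bound for the
     maximum. *)
  have : U (x, t2) - f (x, t2) <= U zh - f zh.
    by apply: zmax; split=> //=; rewrite lerDl; exact: ltW.
  rewrite [leLHS]fE /= rho0 // /pos3 pos_neg ?subr_le0 // expr0n /= mulr0.
  by rewrite addr0 subr0.
have glob : maximizer (cylinder rad) (fun z => U z - f z) zh.
  split=> // z zc; have [zt|zt] := leP z.2 (t2 + dl); first exact: zmax.
  rewrite (le_trans _ FE) // (le_trans _ (ltW E0)) // fE.
  have s1 : 1 <= (z.2 - t2) / dl by rewrite ler_pdivlMr // mul1r; lra.
  have s0 := le_trans ler01 s1.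
  (* [k >= 1] whole steps [dl] separate [z] from [t2]; the penalty with index [k - 1] dominates [g]
     there. *)
  have /andP[] := truncn_itv s0; set k := Num.truncn _ => k1 k2.
  have k0 : (0 < k)%N by rewrite -ltnS -(ltr_nat R); exact: le_lt_trans k2.
  have kE : k = k.-1.+1 by rewrite prednK.
  have a1 : t2 + dl * k.-1.+1%:R <= z.2.
    by move: k1; rewrite -kE ler_pdivlMr //; lra.
  have a2 : z.2 <= t2 + dl * k.-1.+2%:R.
    by move: k2; rewrite -kE ltr_pdivrMr //; lra.
  have := mP _ _ zc a2; have := rhom _ _ a1.
  have : 0 <= B * pos3 (t1 - z.2).
    by rewrite mulr_ge0 // exprn_ge0 // pos_ge0.
  lra.
have zt1 : t1 < zh.2.
  rewrite ltNge; apply/negP => zt.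
  have := past zh (conj zcyl zt); have := rho_ge0 zh.2.
  by move: FE; rewrite fE; lra.
have zh0 : 0 < zh.2 := le_lt_trans t10 zt1.
have [al [be [H1 H2 albe Hn]]] := wbar zh zcyl zt1 zT.
apply/negP; rewrite -leNgt.
have p0 : pos (-1 * zh.2 + t1) = 0 by rewrite pos_neg // mulN1r addrC; lra.
have := U_test hf zh0 glob (al := al) (be := be).
rewrite /= !mulr0 !addr0 mulr1 => T.
rewrite (le_trans _ (T _ _ _ _)) //.
- by rewrite !mulr1 p0 expr0n /= !(mulr0, add0r) lerDl.
- by move=> i; rewrite addr0.
- by move=> i j; rewrite addr0.
Qed.

End StepComparison.

(** * The barriers and their strictness *)

Section Barrier.
Context {R : realType} {n : nat}.
Variable rad : R.
Hypothesis rad_gt0 : 0 < rad.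
Local Notation V := ('rV[R]_n * R)%type.
Local Notation e_ i := (delta_mx 0 i : 'rV[R]_n).

Lemma C2data_ext (f f' : V -> R) f1 f1' f2 f2' : C2data f f1 f2 ->
  f =1 f' -> (forall v, f1 v =1 f1' v) -> (forall v w, f2 v w =1 f2' v w) ->
  C2data f' f1' f2'.
Proof.
move=> hf /funext <- e1 e2.
have -> : f1' = f1 by apply/funext => v; apply/esym/funext => z; exact: e1.
suff -> : f2' = f2 by [].
by apply/funext => v; apply/funext => w; apply/esym/funext => z; exact: e2.
Qed.

Lemma C2data_sum (I : Type) (r : seq I) (f : I -> V -> R) f1 f2 :
  (forall i, C2data (f i) (f1 i) (f2 i)) ->
  C2data (fun z => \sum_(i <- r) f i z) (fun v z => \sum_(i <- r) f1 i v z)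
    (fun v w z => \sum_(i <- r) f2 i v w z).
Proof.
move=> hf; elim: r => [|i r IH].
  by apply: (C2data_ext (C2data_cst (0 : R))) => [z|v z|v w z]; rewrite big_nil.
by apply: (C2data_ext (C2data_add (hf i) IH)) => [z|v z|v w z]; rewrite big_cons.
Qed.

Definition dot (x y : 'rV[R]_n) : R := \sum_i x 0 i * y 0 i.

Lemma C2data_sqn : C2data (fun z : V => sqn z.1) (fun v z => 2 * dot z.1 v.1)
  (fun v w _ => 2 * dot v.1 w.1).
Proof.
have hc (i : 'I_n) : C2data (fun z : V => z.1 0 i) (fun v _ => v.1 0 i)
    (fun _ _ _ => 0).
  apply: C2data_linear => [z|k v w]; last by rewrite /= !mxE.
  apply: (@continuous_comp _ _ _ (fun b : V => b.1) (fun q : 'rV[R]_n => q 0 i)).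
    exact: cvg_fst.
  exact: coord_continuous.
apply: (C2data_ext (C2data_sum (index_enum 'I_n) (fun i => C2data_mul (hc i) (hc i)))).
- by move=> z; apply: eq_bigr => i _; rewrite expr2.
- by move=> v z; rewrite /dot mulr_sumr; apply: eq_bigr => i _; ring.
- by move=> v w z; rewrite /dot mulr_sumr; apply: eq_bigr => i _; ring.
Qed.

Lemma dot_delta (x : 'rV[R]_n) i : dot x (e_ i) = x 0 i.
Proof.
rewrite /dot (bigD1 i) //= big1 ?addr0 => [|j ji].
  by rewrite mxE !eqxx mulr1.
by rewrite mxE (negbTE ji) andbF mulr0.
Qed.

Lemma dot0 (x : 'rV[R]_n) : dot x 0 = 0.
Proof. by rewrite /dot big1 // => i _; rewrite mxE mulr0. Qed.

Lemma dot_normal (x : 'rV[R]_n) : ball_bd rad x -> dot x (normal x) = rad.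
Proof.
rewrite /ball_bd /= => xr.
have -> : dot x (normal x) = rad^-1 * sqn x.
  by rewrite /dot /normal /sqn mulr_sumr xr; apply: eq_bigr => i _; rewrite mxE; ring.
by rewrite -enorm_sqr xr; field; rewrite gt_eqF.
Qed.

Lemma C2data_time (a b : R) : C2data (fun z : V => a * z.2 + b) (fun v _ => a * v.2)
  (fun _ _ _ => 0).
Proof.
have hs : C2data (fun z : V => z.2) (fun v _ => v.2) (fun _ _ _ => 0).
  by apply: C2data_linear => // z; exact: cvg_snd.
by apply: (C2data_ext (C2data_add (C2data_mul (C2data_cst a) hs) (C2data_cst b)))
  => [z|v z|v w z] /=; ring.
Qed.

Lemma C2real_expR (K L : R) : C2real (fun t => K * expR (L * t + 0))
  (fun t => K * (L * expR (L * t + 0))) (fun t => K * (L * (L * expR (L * t + 0)))).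
Proof.
by apply: C2real_scale; split=> [s|s|]; [exact: is_derive_expR|exact: is_derive_expR|exact: continuous_expR].
Qed.

Variables (K L eps N0 s z1 v1 z2 v2 : R).

Let q1 (t : R) := z1 + v1 * (t - s).
Let q2 (t : R) := z2 + v2 * (t - s).
Let E (t : R) := K * expR (L * t).

Definition barrier (z : V) : R :=
  N0 + eps * z.2 +
  E z.2 * (pos3 (q1 z.2 - sqn z.1) + pos3 (sqn z.1 - q2 z.2)).

(** [slope] and [bend] are the first and second derivatives of the barrier with respect to
    [h = |x|^2]. *)
Let slope (z : V) := E z.2 * (3 * pos (sqn z.1 - q2 z.2) ^+ 2
                              - 3 * pos (q1 z.2 - sqn z.1) ^+ 2).
Let bend (z : V) := E z.2 * (6 * pos (sqn z.1 - q2 z.2)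
                             + 6 * pos (q1 z.2 - sqn z.1)).

Lemma barrier_C2data : exists w1 w2, C2data barrier w1 w2 /\ forall z,
  [/\ forall v, w1 (v, 0) z = slope z * (2 * dot z.1 v),
      forall v w, w2 (v, 0) (w, 0) z =
        slope z * (2 * dot v w) + bend z * (4 * (dot z.1 v * dot z.1 w)) &
      w1 (0, 1) z = eps
        + L * E z.2 * (pos3 (q1 z.2 - sqn z.1) + pos3 (sqn z.1 - q2 z.2))
        + 3 * E z.2 * (pos (q1 z.2 - sqn z.1) ^+ 2 * v1
                       - pos (sqn z.1 - q2 z.2) ^+ 2 * v2)].
Proof.
have h1 := C2data_add (C2data_time v1 (z1 - v1 * s)) (C2data_opp C2data_sqn).
have h2 := C2data_add (C2data_time (- v2) (v2 * s - z2)) C2data_sqn.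
have hE := C2data_comp (C2real_expR K L) (C2data_time 1 0).
have hP := C2data_add (C2data_comp (C2real_pos3 (R := R)) h1)
  (C2data_comp (C2real_pos3 (R := R)) h2).
have hw := C2data_add (C2data_time eps N0) (C2data_mul hE hP).
have r1 z : v1 * z.2 + (z1 - v1 * s) - sqn z.1 = q1 z.2 - sqn z.1.
  by rewrite /q1; ring.
have r2 z : - v2 * z.2 + (v2 * s - z2) + sqn z.1 = sqn z.1 - q2 z.2.
  by rewrite /q2; ring.
have rE t : K * expR (L * (1 * t + 0) + 0) = E t by rewrite !addr0 mul1r.
have rE' t : K * (L * expR (L * (1 * t + 0) + 0)) = L * E t.
  by rewrite !addr0 mul1r /E; ring.
eexists; eexists; split.
  apply: (C2data_ext hw); [|by move=> v z|by move=> v w z].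
  by move=> z; rewrite r1 r2 rE /barrier; ring.
move=> z; split.
- by move=> v /=; rewrite r1 r2 rE /slope; ring.
- move=> v w /=; rewrite r1 r2 rE /slope /bend; ring.
- by rewrite /= r1 r2 rE rE' !dot0; ring.
Qed.

Variables (C G : R -> R).
Hypotheses (K_gt0 : 0 < K) (eps_gt0 : 0 < eps)
  (GC : forall h, 0 <= h -> G h = 2 * Num.sqrt h * C (Num.sqrt h)).

(** Since [q1 <= q2], at most one cube is active, so [slope = 0] forces [bend = 0]. The two
    hypotheses with [D] are the strict supersolution inequality written in [h], one for each cube.
    The bound [q2 < rad^2] makes the outer cube active, hence increasing, at the boundary. *)
Lemma barrier_strict (z : V) w1 w2 :
  [/\ forall v, w1 (v, 0) z = slope z * (2 * dot z.1 v),
      forall v w, w2 (v, 0) (w, 0) z =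
        slope z * (2 * dot v w) + bend z * (4 * (dot z.1 v * dot z.1 w)) &
      w1 (0, 1) z = eps
        + L * E z.2 * (pos3 (q1 z.2 - sqn z.1) + pos3 (sqn z.1 - q2 z.2))
        + 3 * E z.2 * (pos (q1 z.2 - sqn z.1) ^+ 2 * v1
                       - pos (sqn z.1 - q2 z.2) ^+ 2 * v2)] ->
  q1 z.2 <= q2 z.2 -> q2 z.2 < rad ^+ 2 ->
  (forall D, D = q1 z.2 - sqn z.1 -> 0 < D ->
    - eps < E z.2 * D ^+ 2 * (L * D + 3 * (v1 + 2 * (n%:R - 1) - G (sqn z.1)))) ->
  (forall D, D = sqn z.1 - q2 z.2 -> 0 < D ->
    - eps < E z.2 * D ^+ 2 * (L * D - 3 * (v2 + 2 * (n%:R - 1) + G (sqn z.1)))) ->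
  strict_barrier rad C barrier w1 w2 z.
Proof.
move=> [W1 W2 Wt] q12 q2r S1 S2.
have E0 : 0 < E z.2 by rewrite /E mulr_gt0 // expR_gt0.
have GCz : G (sqn z.1) = 2 * enorm z.1 * C (enorm z.1).
  by rewrite GC ?sqn_ge0 // sqrt_sqn.
exists (2 * slope z), (4 * bend z); split.
- by move=> i; rewrite W1 dot_delta; ring.
- by move=> i j; rewrite W2 !dot_delta mxE eqxx eq_sym; ring.
- move=> /eqP; rewrite mulf_eq0 pnatr_eq0 /= /slope mulf_eq0 gt_eqF //=.
  have [D1|D1] := leP (q1 z.2 - sqn z.1) 0.
    rewrite (pos_neg D1) expr0n /= mulr0 subr0 mulf_eq0 pnatr_eq0 /= expf_eq0 /=.
    by move=> /eqP p0; rewrite /bend p0 (pos_neg D1) !mulr0 addr0 !mulr0.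
  rewrite [pos (sqn z.1 - _)]pos_neg; last by lra.
  rewrite expr0n /= mulr0 sub0r oppr_eq0 mulf_eq0 pnatr_eq0 /= expf_eq0 /=.
  by rewrite pos_pos ?ltW // gt_eqF.
- move=> bd; rewrite W1 dot_normal //.
  have hr : sqn z.1 = rad ^+ 2 by rewrite -enorm_sqr bd.
  rewrite /slope hr [pos (q1 _ - _)]pos_neg; last by lra.
  rewrite [pos _]pos_pos; last by lra.
  have qr : 0 < rad ^+ 2 - q2 z.2 by rewrite subr_gt0.
  rewrite expr0n /= mulr0 subr0; apply: mulr_gt0; last by rewrite mulr_gt0.
  by apply: mulr_gt0 => //; apply: mulr_gt0 => //; exact: exprn_gt0.
rewrite Wt normrM [`|2|]gtr0_norm // /slope.
have [D1|D1] := leP (q1 z.2 - sqn z.1) 0.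
  rewrite /pos3 (pos_neg D1) !expr0n /= !(mulr0, mul0r, subr0, add0r, sub0r).
  have [D2|D2] := leP (sqn z.1 - q2 z.2) 0.
    rewrite (pos_neg D2) !expr0n /= !(mulr0, mul0r, normr0, oppr0, addr0) //.
  rewrite pos_pos ?ltW //.
  have := S2 _ erefl D2; set D := sqn z.1 - q2 z.2.
  rewrite GCz ger0_norm; last by rewrite !mulr_ge0 ?sqr_ge0 // ltW.
  by rewrite exprSr; lra.
rewrite /pos3 [pos (sqn z.1 - _)]pos_neg; last by lra.
rewrite !expr0n /= !(mulr0, mul0r, subr0, add0r, addr0, sub0r).
rewrite pos_pos ?ltW //.
have := S1 _ erefl D1; set D := q1 z.2 - sqn z.1.
rewrite GCz mulrN normrN ger0_norm; last by rewrite !mulr_ge0 ?sqr_ge0 // ltW.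
by rewrite exprSr; lra.
Qed.

End Barrier.

(** * Chaining the time steps *)

Section Propagation.
Context {R : realType} {n : nat}.
Variable rad : R.
Hypothesis rad_gt0 : 0 < rad.
Local Notation V := ('rV[R]_n * R)%type.

Variables (C : R -> R) (U : V -> R).
Hypotheses (U_cont : {within cylinder rad, continuous U})
  (U_test : sub_test rad C U).

Lemma time_cvg (g : V -> R) (x : 'rV[R]_n) (t : R) : 0 < t -> ball_cl rad x ->
  {within cylinder rad, continuous g} -> g (x, s) @[s --> t^'-] --> g (x, t).
Proof.
move=> t0 xb /subspace_continuousP /(_ (x, t)) cg.
have xt : cylinder rad (x, t) by split=> //; exact: ltW.
apply: (@cvg_comp _ _ _ (fun s : R => (x, s)) g _ (within (cylinder rad) (nbhs (x, t)))).
  move=> P; rewrite /within /= => PP.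
  have : \forall s \near t, cylinder rad (x, s) -> P (x, s).
    have cst_x : x @[s --> t] --> x by exact: cvg_cst.
    exact: (@cvg_pair R 'rV[R]_n R (nbhs t) (nbhs x) (nbhs t) _ _ _
      (fun=> x) id cst_x cvg_id) _ PP.
  move=> PP'; have PPl : \forall s \near t^'-, cylinder rad (x, s) -> P (x, s).
    exact: cvg_within PP'.
  have pos_s : \forall s \near t^'-, 0 < s by exact: nbhs_left_gt.
  apply: filterS2 PPl pos_s => s Ps s0; apply: Ps.
  by split=> //=; exact: ltW.
exact: cg.
Qed.

(** [step_comparison] wants strictness slightly beyond its final time. A violation at [t2] persists
    by continuity at some earlier [s], and [(t2 - s) / 2] then provides the margin. *)
Lemma step_comparison_open w w1 w2 (t1 t2 : R) : 0 <= t1 -> t1 < t2 ->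
  C2data w w1 w2 ->
  (forall z, cylinder rad z -> t1 < z.2 -> z.2 < t2 ->
     strict_barrier rad C w w1 w2 z) ->
  (forall x, ball_cl rad x -> U (x, t1) <= w (x, t1)) ->
  forall x, ball_cl rad x -> U (x, t2) <= w (x, t2).
Proof.
move=> t10 t12 hw wbar init x xb; rewrite leNgt; apply/negP => Uw.
have t20 : 0 < t2 := le_lt_trans t10 t12.
have cg : {within cylinder rad, continuous (fun z => U z + - w z)}.
  apply: within_add => //; apply: within_opp; apply: continuous_subspaceT.
  by case: hw.
have gt2 : 0 < U (x, t2) - w (x, t2) by rewrite subr_gt0.
have h1 : \forall s \near t2^'-, 0 < U (x, s) - w (x, s).
  exact: (cvgr_gt _ (time_cvg t20 xb cg)).
have h2 : \forall s \near t2^'-, t1 < s by exact: nbhs_left_gt.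
have h3 : \forall s \near t2^'-, s < t2 by exact: nbhs_left_lt.
have [s [[s1 s2] s3]] := @filter_ex _ (t2^'-) _ _ (filterI (filterI h1 h2) h3).
have dl0 : 0 < (t2 - s) / 2 by rewrite divr_gt0 // subr_gt0.
suff : U (x, s) <= w (x, s) by rewrite leNgt -subr_gt0 s1.
apply: (step_comparison rad_gt0 U_cont U_test t10 (ltW s2) dl0 hw) => //.
by move=> z zc zt1 zt; apply: wbar => //; lra.
Qed.

Variables (G : R -> R) (Lam zeta Vb L eps K T N0 dl : R).
Hypotheses (K_gt0 : 0 < K) (eps_gt0 : 0 < eps) (Lam_ge0 : 0 <= Lam)
  (GC : forall h, 0 <= h -> G h = 2 * Num.sqrt h * C (Num.sqrt h))
  (G_lip : forall q h, zeta <= q <= rad ^+ 2 -> 0 <= h <= rad ^+ 2 ->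
     `|G h - G q| <= Lam * `|h - q|)
  (G_bound : forall h, 0 <= h <= rad ^+ 2 -> 2 * (n%:R - 1) + `|G h| <= Vb)
  (L_def : L = 3 * Lam) (zeta_gt0 : 0 < zeta) (dl_gt0 : 0 < dl).

Let cap := rad ^+ 2 - dl.
Let Emax := K * expR (L * T).

(** The barrier at time [t] with its fronts at [y1] and [y2]: the common value of consecutive
    barriers at the node where one is restarted as the next. *)
Definition level (t y1 y2 : R) (x : 'rV[R]_n) : R :=
  N0 + eps * t + K * expR (L * t) * (pos3 (y1 - sqn x) + pos3 (sqn x - y2)).

(** The fronts move linearly from [y1], [y2] to [z1], [z2], with speeds tested at the endpoints
    [z1], [z2] only. Three errors arise: the distance to the front, absorbed by [L]; the variation
    of [G] along the step, at most [Lam Vb D], absorbed by [eps] through [small1]; and, for an upper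
    front within [eta] of the boundary, a speed defect of at most [2 Vb], absorbed through
    [small2]. *)
Lemma propagate_step (t1 t2 eta y1 y2 z1 z2 : R) (D := t2 - t1) :
  0 <= t1 -> t1 < t2 -> t2 <= T ->
  zeta <= y1 <= cap -> zeta <= y2 <= cap -> zeta <= z1 <= cap ->
  zeta <= z2 <= cap -> y1 <= y2 -> z1 <= z2 ->
  `|z1 - y1| <= Vb * D -> `|z2 - y2| <= Vb * D ->
  3 * Emax * rad ^+ 4 * Lam * Vb * D < eps ->
  6 * Emax * eta ^+ 2 * Vb < eps ->
  D * (- (2 * (n%:R - 1)) + G z1) <= z1 - y1 ->
  (z2 - y2 <= D * (- (2 * (n%:R - 1)) - G z2)) \/
    (rad ^+ 2 - z2 <= eta /\ rad ^+ 2 - y2 <= eta) ->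
  (forall x, ball_cl rad x -> U (x, t1) <= level t1 y1 y2 x) ->
  forall x, ball_cl rad x -> U (x, t2) <= level t2 z1 z2 x.
Proof.
move=> t10 t12 t2T y1b y2b z1b z2b y12 z12 d1 d2 small1 small2 T1 T2 init x xb.
have D0 : 0 < D by rewrite /D subr_gt0.
pose v1 := (z1 - y1) / D; pose v2 := (z2 - y2) / D.
have v1D : v1 * D = z1 - y1 by rewrite /v1 divfK ?gt_eqF.
have v2D : v2 * D = z2 - y2 by rewrite /v2 divfK ?gt_eqF.
have [w1 [w2 [hw wf]]] := @barrier_C2data R n K L eps N0 t2 z1 v1 z2 v2.
have levE t (y : 'rV[R]_n) : @barrier R n K L eps N0 t2 z1 v1 z2 v2 (y, t) =
    level t (z1 + v1 * (t - t2)) (z2 + v2 * (t - t2)) y by [].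
have := step_comparison_open t10 t12 hw _ _ xb.
rewrite levE !subrr !mulr0 !addr0; apply; last first.
  move=> y yb; rewrite levE.
  have -> : z1 + v1 * (t1 - t2) = y1.
    by rewrite -[t1 - t2]opprB -/D mulrN v1D; ring.
  have -> : z2 + v2 * (t1 - t2) = y2.
    by rewrite -[t1 - t2]opprB -/D mulrN v2D; ring.
  exact: init.
move=> z [zb z0] zt1 zt2; pose q1 := z1 + v1 * (z.2 - t2).
pose q2 := z2 + v2 * (z.2 - t2).
(* The fraction of the step left after [z.2]; both fronts are convex combinations of their end
   positions with this weight. *)
pose th := (t2 - z.2) / D.
have th0 : 0 <= th by rewrite divr_ge0 ?subr_ge0 ?ltW.
have th1 : th <= 1 by rewrite /th ler_pdivrMr // mul1r /D; lra.
have q1E : q1 = (1 - th) * z1 + th * y1.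
  by rewrite /q1 /th /v1; field; rewrite gt_eqF.
have q2E : q2 = (1 - th) * z2 + th * y2.
  by rewrite /q2 /th /v2; field; rewrite gt_eqF.
have h_ge0 : 0 <= sqn z.1 <= rad ^+ 2.
  by rewrite sqn_ge0 -enorm_sqr lerXn2r ?nnegrE ?enorm_ge0 // ltW.
have hb := h_ge0; move: hb => /andP[h0 hr].
have dl0 := dl_gt0.
have conv a b c d : (a <= b <= c -> a <= d <= c ->
    a <= (1 - th) * b + th * d <= c)%R.
  move=> /andP[ab bc] /andP[ad dc].
  have o0 : 0 <= 1 - th by rewrite subr_ge0.
  have k1 e f : e <= f -> (1 - th) * e <= (1 - th) * f by exact: ler_wpM2l.
  have k2 e f : e <= f -> th * e <= th * f by exact: ler_wpM2l.
  have := k1 _ _ ab; have := k1 _ _ bc; have := k2 _ _ ad; have := k2 _ _ dc.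
  by move=> *; apply/andP; split; lra.
have q1b := conv _ _ _ _ z1b y1b; have q2b := conv _ _ _ _ z2b y2b.
rewrite -q1E in q1b; rewrite -q2E in q2b.
have q12 : q1 <= q2.
  have o0 : 0 <= 1 - th by rewrite subr_ge0.
  by rewrite q1E q2E lerD // ler_wpM2l.
have q2r : q2 < rad ^+ 2 by move: q2b => /andP[_]; rewrite /cap; lra.
have Ez0 : 0 < K * expR (L * z.2) by rewrite mulr_gt0 // expR_gt0.
have L0 : 0 <= L by rewrite L_def mulr_ge0.
have Ezm : K * expR (L * z.2) <= Emax.
  by rewrite /Emax ler_pM2l // ler_expR ler_wpM2l //; lra.
have Vb0 : 0 <= Vb.
  have := G_bound h_ge0; have := le_trans (normr_ge0 _) d1 => a _.
  by rewrite -(pmulr_lge0 _ D0).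
have widen a : zeta <= a <= cap -> zeta <= a <= rad ^+ 2.
  by rewrite /cap => /andP[-> ac]; rewrite /= (le_trans ac) // lerBlDr lerDl ltW.
have nonneg a : zeta <= a <= cap -> 0 <= a <= rad ^+ 2.
  by move=> /widen/andP[a1 a2]; rewrite a2 (le_trans (ltW zeta_gt0) a1).
have vel a b (v : R) : v * D = a - b -> `|a - b| <= Vb * D ->
    `|a + v * (z.2 - t2) - a| <= Vb * D.
  move=> vD ab; rewrite addrC addKr normrM.
  have -> : v = (a - b) / D by rewrite -vD mulfK // gt_eqF.
  rewrite normrM normfV (gtr0_norm D0) -mulrA -[leRHS]mulr1.
  apply: ler_pM => //; first by rewrite mulr_ge0 ?invr_ge0 // ltW.
  by rewrite mulrC ler_pdivrMr // mul1r ler0_norm ?subr_le0 ?ltW // /D; lra.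
have Gq a b (v : R) : zeta <= a <= cap -> v * D = a - b -> `|a - b| <= Vb * D ->
    zeta <= a + v * (z.2 - t2) <= cap ->
    `|G (a + v * (z.2 - t2)) - G a| <= Lam * (Vb * D).
  move=> ab vD abD qb; rewrite (le_trans (G_lip (widen _ ab) (nonneg _ qb))) //.
  by rewrite ler_wpM2l // (vel _ _ _ vD).
have r4 : rad ^+ 4 = (rad ^+ 2) ^+ 2 by rewrite -exprM.
have err1 Dh X : 0 < Dh -> Dh <= rad ^+ 2 -> - (Lam * (Vb * D)) <= X ->
    - eps < K * expR (L * z.2) * Dh ^+ 2 * (3 * X).
  move=> Dh0 Dhr XX.
  have e1 : K * expR (L * z.2) * Dh ^+ 2 <= Emax * rad ^+ 4.
    rewrite r4; apply: ler_pM => //; first exact: ltW.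
      exact: sqr_ge0.
    by rewrite lerXn2r ?nnegrE ?sqr_ge0 // ltW.
  have e0 : 0 <= K * expR (L * z.2) * Dh ^+ 2 by rewrite mulr_ge0 ?sqr_ge0 // ltW.
  have e2 : 0 <= Lam * (Vb * D) by rewrite !mulr_ge0 // ltW.
  have := ler_wpM2r e2 e1; have := ler_wpM2l e0 XX.
  by move: small1; lra.
apply: (@barrier_strict R n rad rad_gt0 K L eps N0 t2 z1 v1 z2 v2 C G
  K_gt0 eps_gt0 GC z w1 w2 (wf z)) => //.
- move=> Dh; rewrite -/q1 => DhE Dh0.
  have := G_lip (widen _ q1b) h_ge0.
  have := Gq _ _ _ z1b v1D d1 q1b; rewrite -/q1.
  move=> /ler_normlP[_ g1]; rewrite distrC [X in _ <= Lam * X]distrC -DhE.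
  rewrite (gtr0_norm Dh0) => /ler_normlP[g2 _].
  have g3 : - (2 * (n%:R - 1)) + G z1 <= v1 by rewrite /v1 ler_pdivlMr // mulrC.
  have Dhr : Dh <= rad ^+ 2.
    by rewrite DhE; move: q1b => /nonneg/andP[_]; lra.
  apply: (lt_le_trans (err1 Dh _ Dh0 Dhr (lexx _))).
  rewrite ler_wpM2l //; first by rewrite mulr_ge0 ?sqr_ge0 // ltW.
  by rewrite L_def; lra.
- move=> Dh; rewrite -/q2 => DhE Dh0.
  have Dhr : Dh <= rad ^+ 2.
    by rewrite DhE; move: q2b => /nonneg/andP[]; lra.
  have ed0 : 0 <= K * expR (L * z.2) * Dh ^+ 2 by rewrite mulr_ge0 ?sqr_ge0 // ltW.
  case: T2 => [T2|[T2 T2']].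
    have := G_lip (widen _ q2b) h_ge0.
    have := Gq _ _ _ z2b v2D d2 q2b; rewrite -/q2.
    move=> /ler_normlP[_ g1]; rewrite -DhE.
    rewrite (gtr0_norm Dh0) => /ler_normlP[_ g2].
    have g3 : v2 <= - (2 * (n%:R - 1)) - G z2 by rewrite /v2 ler_pdivrMr // mulrC.
    apply: (lt_le_trans (err1 Dh _ Dh0 Dhr (lexx _))).
    by rewrite ler_wpM2l // L_def; lra.
  (* Beyond the upper front only a strip of width [eta] is left, where the defect carries the small
     factor [Dh^2]. *)
  have Dhe : Dh <= eta.
    have k1 : (1 - th) * (rad ^+ 2 - z2) <= (1 - th) * eta.
      by rewrite ler_wpM2l // subr_ge0.
    have k2 : th * (rad ^+ 2 - y2) <= th * eta by rewrite ler_wpM2l.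
    by rewrite DhE q2E; lra.
  have v2V : v2 <= Vb.
    rewrite /v2 ler_pdivrMr //; exact: le_trans (ler_norm _) d2.
  have Gh : 2 * (n%:R - 1) + G (sqn z.1) <= Vb.
    by apply: le_trans (G_bound h_ge0); rewrite lerD2l ler_norm.
  have e1 : K * expR (L * z.2) * Dh ^+ 2 <= Emax * eta ^+ 2.
    apply: ler_pM => //; [exact: ltW|exact: sqr_ge0|].
    by rewrite lerXn2r ?nnegrE // ltW // (lt_le_trans Dh0).
  apply: (@lt_le_trans _ _ (K * expR (L * z.2) * Dh ^+ 2 * (- (6 * Vb)))).
    by have := ler_wpM2r Vb0 e1; move: small2; lra.
  rewrite ler_wpM2l //; have : 0 <= L * Dh by rewrite mulr_ge0 // ltW.
  lra.
Qed.

(** Indices run backwards in time: [0] is the final position and [N] the initial one, so the time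
    step ending at [(k + 1) D] uses the nodes [N - k] and [N - k - 1]. *)
Lemma propagate (N : nat) (D eta : R) (z1 z2 : nat -> R) : 0 < D ->
  N%:R * D <= T ->
  (forall j, zeta <= z1 j <= cap) -> (forall j, zeta <= z2 j <= cap) ->
  (forall j, z1 j <= z2 j) ->
  (forall j, `|z1 j - z1 j.+1| <= Vb * D) ->
  (forall j, `|z2 j - z2 j.+1| <= Vb * D) ->
  3 * Emax * rad ^+ 4 * Lam * Vb * D < eps ->
  6 * Emax * eta ^+ 2 * Vb < eps ->
  (forall j, D * (- (2 * (n%:R - 1)) + G (z1 j)) <= z1 j - z1 j.+1) ->
  (forall j, (z2 j - z2 j.+1 <= D * (- (2 * (n%:R - 1)) - G (z2 j))) \/
    (rad ^+ 2 - z2 j <= eta /\ rad ^+ 2 - z2 j.+1 <= eta)) ->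
  (forall x, ball_cl rad x -> U (x, 0) <= level 0 (z1 N) (z2 N) x) ->
  forall x, ball_cl rad x -> U (x, N%:R * D) <= level (N%:R * D) (z1 0) (z2 0) x.
Proof.
move=> D0 NT b1 b2 b12 d1 d2 small1 small2 T1 T2 init.
suff key k : (k <= N)%N -> forall x, ball_cl rad x ->
    U (x, k%:R * D) <= level (k%:R * D) (z1 (N - k)%N) (z2 (N - k)%N) x.
  by move=> x xb; have := key N (leqnn N) x xb; rewrite subnn.
elim: k => [_ x xb|k IH kN]; first by rewrite mul0r subn0; exact: init.
have eN : (N - k)%N = (N - k.+1).+1 by rewrite subnSK.
have eD : k.+1%:R * D - k%:R * D = D by rewrite -addn1 natrD; ring.
apply: (@propagate_step (k%:R * D) (k.+1%:R * D) eta (z1 (N - k)%N) (z2 (N - k)%N));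
  rewrite ?eD ?eN //.
- by rewrite mulr_ge0 // ltW.
- by rewrite ltr_pM2r // ltr_nat.
- by rewrite (le_trans _ NT) // ler_pM2r // ler_nat.
- by rewrite -eN; apply: IH; exact: ltnW.
Qed.

End Propagation.

(** * Euler polygons for the characteristics *)

Section LipschitzC1.
Context {R : realType}.

Lemma has_derivative_in_near (D : set R) (f : R -> R) (x l e : R) : 0 < e ->
  has_derivative_in D f x l ->
  \forall y \near x, D y -> `|f y - f x - l * (y - x)| <= e * `|y - x|.
Proof.
move=> e0 /cvgrPdist_le /(_ _ e0) H.
have : nbhs x (fun y => y != x -> D y -> `|l - (f y - f x) / (y - x)| <= e) by exact: H.
apply: filterS => y Hy Dy; have [->|yx] := eqVneq y x.
  by rewrite !subrr mulr0 subr0 normr0 mulr0.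
have yx0 : y - x != 0 by rewrite subr_eq0.
have -> : f y - f x - l * (y - x) = - ((l - (f y - f x) / (y - x)) * (y - x)).
  by field.
by rewrite normrN normrM ler_wpM2r //; exact: Hy.
Qed.

Lemma near_dist (x e : R) : 0 < e -> \forall y \near x, `|x - y| < e.
Proof. by move=> e0; exact: nbhsx_ballx. Qed.

Lemma has_derivative_in_continuous (D : set R) (f f1 : R -> R) :
  (forall x, D x -> has_derivative_in D f x (f1 x)) ->
  {within D, continuous f}.
Proof.
move=> df; apply/subspace_continuousP => x Dx.
have H := has_derivative_in_near ltr01 (df x Dx).
apply/cvgrPdist_lt => e e0.
have k0 : 0 < `|f1 x| + 1 by rewrite ltr_wpDl.
have B : \forall y \near x, `|y - x| < e / (`|f1 x| + 1).
  by apply: filterS (near_dist x (divr_gt0 e0 k0)) => y; rewrite distrC.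
have : nbhs x (fun y => D y -> `|f x - f y| < e).
  apply: filterS2 H B => y Hy By Dy; rewrite distrC.
  have -> : f y - f x = (f y - f x - f1 x * (y - x)) + f1 x * (y - x) by ring.
  rewrite (le_lt_trans (ler_normD _ _)) // normrM.
  by move: (Hy Dy) By; rewrite ltr_pdivlMr //; lra.
by [].
Qed.

Lemma has_derivative_in_interior (a b : R) (f : R -> R) (x l : R) :
  a < x < b -> has_derivative_in `[a, b] f x l -> is_derive x 1 f l.
Proof.
move=> /andP[ax xb] df.
have E : (fun h : R => h^-1 *: ((f \o shift x) (h *: 1) - f x)) @ 0^' --> l.
  apply/cvgrPdist_le => e e0.
  have H := has_derivative_in_near e0 df.
  have I : \forall y \near x, a < y < b.
    by near=> y; apply/andP; split; near: y; [exact: lt_nbhsr|exact: lt_nbhsl].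
  have sh : (fun h : R => h + x) @ (0 : R) --> x.
    rewrite -[X in _ --> X]add0r; apply: cvgD; [exact: cvg_id|exact: cvg_cst].
  pose A y := `[a, b]%classic y -> `|f y - f x - l * (y - x)| <= e * `|y - x|.
  have near0 : nbhs (0 : R) (fun h => A (h + x) /\ a < h + x < b).
    exact: (sh _ (@filterI _ _ (nbhs_filter x) A _ H I)).
  suff : nbhs (0 : R) (fun h => h != 0 ->
      `|l - h^-1 *: ((f \o shift x) (h *: 1) - f x)| <= e) by [].
  apply: filterS near0 => h [Hh /andP[h1 h2]] h0.
  have := Hh; rewrite /A /= in_itv /= (ltW h1) (ltW h2) addrK => /(_ isT) Hl.
  rewrite [_%:A]mulr1 /GRing.scale /=.
  have hn : 0 < `|h| by rewrite normr_gt0.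
  have -> : l - h^-1 * (f (h + x) - f x) = - (h^-1 * (f (h + x) - f x - l * h)).
    by field.
  by rewrite normrN normrM normfV ler_pdivrMl // [leRHS]mulrC.
apply: DeriveDef; last exact: cvg_lim E.
by apply/cvg_ex; exists l.
Unshelve. all: by end_near. Qed.

Lemma C1_lipschitz (a b : R) (f : R -> R) : a < b -> C1_on `[a, b] f ->
  exists2 k : R, 0 <= k & forall x y, x \in `[a, b] -> y \in `[a, b] ->
    `|f x - f y| <= k * `|x - y|.
Proof.
move=> ab [f1 [df cf1]].
have cn : {within `[a, b], continuous (fun x => `|f1 x|)}.
  by move=> x; apply: cvg_norm; exact: cf1.
have [m mab mmax] := EVT_max (ltW ab) cn.
exists `|f1 m| => // x y.
wlog xy : x y / x <= y.
  move=> H xI yI; have [/H|/ltW/H] := leP x y; first exact.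
  by rewrite distrC [`|x - y|]distrC; exact.
rewrite !in_itv /= => /andP[ax xb] /andP[ay yb].
have [||c cI fE] := @MVT_segment R f f1 x y xy.
- move=> z; rewrite in_itv /= => /andP[xz zy].
  apply: (@has_derivative_in_interior a b); first by apply/andP; split; lra.
  by apply: df; rewrite /= in_itv /=; apply/andP; split; lra.
- apply: (@continuous_subspaceW _ _ _ `[a, b]); last exact: has_derivative_in_continuous df.
  by move=> z /=; rewrite !in_itv /= => /andP[xz zy]; apply/andP; split; lra.
rewrite distrC fE normrM distrC ler_wpM2r // mmax //.
move: cI; rewrite !in_itv /= => /andP[xz zy]; apply/andP; split; lra.
Qed.

Lemma C2_on_C1_on (D : set R) (f : R -> R) : C2_on D f -> C1_on D f.
Proof.
move=> [f1 [df [f2 [df1 _]]]]; exists f1; split=> //.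
exact: has_derivative_in_continuous df1.
Qed.

Lemma lipschitz_continuous (f : R -> R) (k : R) :
  (forall x y, `|f x - f y| <= k * `|x - y|) -> continuous f.
Proof.
move=> fk x; apply/cvgrPdist_lt => e e0.
have k0 : 0 < `|k| + 1 by rewrite ltr_wpDl.
apply: filterS (near_dist x (divr_gt0 e0 k0)) => y; rewrite ltr_pdivlMr // => h.
rewrite (le_lt_trans (fk x y)) // (le_lt_trans _ h) // mulrC ler_wpM2l //.
by rewrite (le_trans (ler_norm _)) // lerDl.
Qed.

(** The projection onto [[0, b]]. Composing with it extends a Lipschitz function on the interval to
    one on the whole line. *)
Definition clamp (b x : R) : R := Num.min b (Num.max 0 x).

Lemma clamp_in b x : 0 <= b -> clamp b x \in `[0, b].
Proof.
by move=> b0; rewrite in_itv /= /clamp le_min b0 le_max lexx ge_min lexx.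
Qed.

Lemma clamp_id b x : x \in `[0, b] -> clamp b x = x.
Proof.
rewrite in_itv /= /clamp => /andP[x0 xb].
by rewrite (max_idPr x0) (min_idPr xb).
Qed.

Lemma clamp_lip b x y : `|clamp b x - clamp b y| <= `|x - y|.
Proof.
have min_lip p q : `|Num.min b p - Num.min b q| <= `|p - q|.
  have h1 := ler_norm (p - q); have h2 := ler_norm (q - p); rewrite distrC in h2.
  by have [a|a] := leP b p; have [d|d] := leP b q;
    apply/ler_normlP; split; lra.
apply: le_trans (min_lip _ _) _.
have h1 := ler_norm (x - y); have h2 := ler_norm (y - x); rewrite distrC in h2.
by have [a|a] := leP 0 x; have [d|d] := leP 0 y; apply/ler_normlP; split; lra.
Qed.

(** Only [b] stays away from [0]: already [sqrt a + sqrt b >= sqrt z]. Accordingly the drift has a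
    Lipschitz bound as soon as one argument, the front, is above the floor. *)
Lemma sqrt_dist (a b z : R) : 0 < z -> z <= b -> 0 <= a ->
  `|Num.sqrt a - Num.sqrt b| <= `|a - b| / Num.sqrt z.
Proof.
move=> z0 zb a0; have b0 := lt_le_trans z0 zb.
have sz : 0 < Num.sqrt z by rewrite sqrtr_gt0.
rewrite ler_pdivlMr // -{2}(sqr_sqrtr a0) -{2}(sqr_sqrtr (ltW b0)) subr_sqr normrM.
rewrite ler_wpM2l // ger0_norm ?addr_ge0 ?sqrtr_ge0 //.
by rewrite ler_wpDl ?sqrtr_ge0 // ler_sqrt // ltW.
Qed.

Lemma sqrt_modulus (a b : R) : 0 <= a -> 0 <= b ->
  `|Num.sqrt a - Num.sqrt b| <= Num.sqrt `|a - b|.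
Proof.
move=> a0 b0; rewrite -[leLHS]normr_id -sqrtr_sqr ler_sqrt ?normr_ge0 //.
rewrite -normrX expr2.
rewrite -{3}(sqr_sqrtr a0) -{3}(sqr_sqrtr b0) subr_sqr !normrM ler_wpM2l //.
rewrite [leRHS]ger0_norm ?addr_ge0 ?sqrtr_ge0 //.
by rewrite (le_trans (ler_normB _ _)) // !ger0_norm ?sqrtr_ge0.
Qed.

End LipschitzC1.

(** * A monotone Euler scheme capped before the boundary *)

Section EulerPolygons.
Context {R : realType}.
Variables (m2 R2 cap zeta Lam Vb D z0 : R) (G0 : R -> R).
Hypotheses (G0_ge0 : forall h, 0 <= G0 h) (G0_cont : continuous G0)
  (zeta_gt0 : 0 < zeta) (zeta_cap : zeta <= cap) (cap_R2 : cap <= R2)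
  (G0_lip : forall q h, zeta <= q <= R2 -> 0 <= h <= R2 ->
     `|G0 h - G0 q| <= Lam * `|h - q|)
  (G0_bound : forall h, 0 <= h <= R2 -> m2 + G0 h <= Vb)
  (m2_ge0 : 0 <= m2) (G0_zeta : G0 zeta <= m2)
  (D_ge0 : 0 <= D) (D_small : D * Lam <= 1) (z0_in : zeta <= z0 <= cap).

Definition speed (a z : R) : R := m2 + a * G0 z.
Definition euler (a z : R) : R := Num.min cap (z + D * speed a z).
Definition traj (a : R) (j : nat) : R := iter j (euler a) z0.

(** [D * Lam <= 1] makes [z + D * speed a z] nondecreasing: the discrete form of the fact that
    trajectories do not cross. *)
Lemma euler_le (a z z' : R) : `|a| <= 1 -> zeta <= z -> z <= z' -> z' <= cap ->
  euler a z <= euler a z'.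
Proof.
move=> a1 zz zz' z'c; rewrite /euler le_min !ge_min lexx /=; apply/orP; right.
have := @G0_lip z z'; rewrite zz (le_trans zz') ?(le_trans z'c) //=.
rewrite (le_trans (ltW zeta_gt0)) ?(le_trans zz) //= => /(_ isT isT).
rewrite [`|z' - z|]ger0_norm ?subr_ge0 // => lip.
have la : `|a * (G0 z' - G0 z)| <= Lam * (z' - z).
  by rewrite normrM (le_trans _ lip) // ler_piMl.
have := ler_wpM2l D_ge0 la; have : D * `|a * (G0 z' - G0 z)| >= - (D * (a * (G0 z' - G0 z))).
  by rewrite -mulrN ler_wpM2l // -normrN ler_norm.
have : D * Lam * (z' - z) <= 1 * (z' - z) by rewrite ler_wpM2r // subr_ge0.
rewrite /speed; lra.
Qed.

Lemma speed_zeta (a : R) : `|a| <= 1 -> 0 <= speed a zeta.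
Proof.
move=> a1; rewrite /speed.
have : `|a * G0 zeta| <= m2 by rewrite normrM (ger0_norm (G0_ge0 _)) (le_trans _ G0_zeta) // ler_piMl.
by move=> /ler_normlP[]; lra.
Qed.

(** The speed is nonnegative at the floor [zeta], and monotonicity carries this barrier over to all
    positions above it. *)
Lemma euler_in (a z : R) : `|a| <= 1 -> zeta <= z <= cap ->
  zeta <= euler a z <= cap.
Proof.
move=> a1 /andP[zz zc]; apply/andP; split; last by rewrite /euler ge_min lexx.
apply: le_trans (euler_le a1 (lexx _) zz zc).
by rewrite /euler le_min zeta_cap lerDl mulr_ge0 // speed_zeta.
Qed.

Lemma traj_in (a : R) j : `|a| <= 1 -> zeta <= traj a j <= cap.
Proof. by move=> a1; elim: j => [//|j IH]; rewrite /traj iterS euler_in. Qed.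

Lemma traj_le (a b : R) j : `|a| <= 1 -> `|b| <= 1 -> a <= b ->
  traj a j <= traj b j.
Proof.
move=> a1 b1 ab; elim: j => [//|j IH].
rewrite /traj !iterS -!/(traj _ j).
have /andP[ta _] := traj_in j a1; have /andP[_ tb] := traj_in j b1.
apply: le_trans (euler_le a1 ta IH tb) _.
rewrite /euler le_min !ge_min lexx /=; apply/orP; right.
by rewrite lerD2l ler_wpM2l // /speed lerD2l ler_wpM2r.
Qed.

Lemma speed_bound (a z : R) : `|a| <= 1 -> zeta <= z <= cap -> `|speed a z| <= Vb.
Proof.
move=> a1 /andP[zz zc].
have zR : 0 <= z <= R2.
  by apply/andP; split; [exact: le_trans (ltW zeta_gt0) zz|exact: le_trans zc cap_R2].
rewrite (le_trans _ (G0_bound zR)) // /speed (le_trans (ler_normD _ _)) //.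
by rewrite (ger0_norm m2_ge0) lerD2l normrM (ger0_norm (G0_ge0 _)) ler_piMl.
Qed.

(** Capping only shortens a step, so the inequality wanted by the lower front always holds. The
    upper front needs the reverse one, which can fail only when the cap is hit, from a node already
    within [Vb * D] of it. *)
Lemma traj_step (a : R) j : `|a| <= 1 ->
  [/\ - (D * speed a (traj a j)) <= traj a j - traj a j.+1,
      traj a j - traj a j.+1 = - (D * speed a (traj a j)) \/
        (traj a j.+1 = cap /\ cap - traj a j <= Vb * D) &
      `|traj a j - traj a j.+1| <= Vb * D].
Proof.
move=> a1; have tin := traj_in j a1; have /andP[_ tc] := tin.
have /ler_normlP[sb1 sb2] := speed_bound a1 tin.
have b1 := ler_wpM2l D_ge0 sb1; have b2 := ler_wpM2l D_ge0 sb2.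
rewrite [traj a j.+1]iterS -/(traj a j) /euler.
case: (leP cap (traj a j + D * speed a (traj a j))) => h.
  split; [by lra|by right; split=> //; lra|].
  by rewrite ler0_norm; lra.
split; [by lra|by left; ring|].
by apply/ler_normlP; split; lra.
Qed.

Lemma traj_continuous j : continuous (fun a => traj a j).
Proof.
elim: j => [a|j IH a]; first exact: cvg_cst.
rewrite /traj; under eq_fun do rewrite iterS -/(traj _ j).
rewrite /euler.
apply: (@continuous_min _ _ (fun=> cap) (fun a => traj a j + D * speed a (traj a j))).
  exact: cvg_cst.
apply: cvgD; first exact: IH.
apply: cvgM; first exact: cvg_cst.
apply: cvgD; first exact: cvg_cst.
apply: cvgM; first exact: cvg_id.
by apply: (@continuous_comp _ _ _ (fun a => traj a j) G0); [exact: IH|exact: G0_cont].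
Qed.

(** The end point depends continuously on the constant control [a], so every point of the swept
    interval is reached by a single polygon; this is what lower bounds require. *)
Lemma traj_intermediate (N : nat) (s : R) : traj (-1) N <= s <= traj 1 N ->
  exists2 a, `|a| <= 1 & traj a N = s.
Proof.
move=> sb.
have N1 : `|-1 : R| <= 1 by rewrite normrN normr1.
have le11 : traj (-1) N <= traj 1 N by have /andP[] := sb; exact: le_trans.
have ct : {within `[-1, 1], continuous (fun a => traj a N)}.
  by apply: continuous_subspaceT; exact: traj_continuous.
have bd : Num.min (traj (-1) N) (traj 1 N) <= s <= Num.max (traj (-1) N) (traj 1 N).
  by rewrite (min_idPl le11) (max_idPr le11).
have [|a aI <-] := IVT _ ct bd; first by lra.
by exists a => //; move: aI; rewrite in_itv /= -ler_norml.
Qed.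

End EulerPolygons.

(** * The upper bound along a pair of polygons *)

Section EulerUpperBound.
Context {R : realType} {n : nat}.
Variable rad : R.
Hypothesis rad_gt0 : 0 < rad.
Local Notation V := ('rV[R]_n * R)%type.

Variables (C : R -> R) (U : V -> R) (G V0 : R -> R) (Lam zeta Vb M0 : R).
Hypotheses (U_cont : {within cylinder rad, continuous U})
  (U_test : sub_test rad C U) (Lam_ge0 : 0 <= Lam)
  (GC : forall h, 0 <= h -> G h = 2 * Num.sqrt h * C (Num.sqrt h))
  (G_lip : forall q h, zeta <= q <= rad ^+ 2 -> 0 <= h <= rad ^+ 2 ->
     `|G h - G q| <= Lam * `|h - q|)
  (G_bound : forall h, 0 <= h <= rad ^+ 2 -> 2 * (n%:R - 1) + `|G h| <= Vb)
  (zeta_gt0 : 0 < zeta) (Vb_ge0 : 0 <= Vb)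
  (V0_bound : forall h, 0 <= h <= rad ^+ 2 -> `|V0 h| <= M0)
  (V0_unif : forall e, 0 < e -> exists2 de, 0 < de &
     forall h h', 0 <= h <= rad ^+ 2 -> 0 <= h' <= rad ^+ 2 ->
       `|h - h'| <= de -> `|V0 h - V0 h'| <= e)
  (init : forall x, ball_cl rad x -> U (x, 0) <= V0 (sqn x)).

Lemma sqn_ball (x : 'rV[R]_n) : ball_cl rad x -> 0 <= sqn x <= rad ^+ 2.
Proof.
move=> xb; rewrite sqn_ge0 -enorm_sqr lerXn2r ?nnegrE ?enorm_ge0 //.
exact: ltW.
Qed.

(** Compare [h] with its projection [s] onto [[y1, y2]]: within [de] uniform continuity is enough,
    and farther away the cube exceeds the oscillation [2 * M0]. *)
Lemma euler_initial (e de N0 K y1 y2 h : R) : 0 < de -> 0 <= e ->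
  0 <= y1 -> y1 <= y2 -> y2 <= rad ^+ 2 -> 0 <= h <= rad ^+ 2 ->
  (forall h h', 0 <= h <= rad ^+ 2 -> 0 <= h' <= rad ^+ 2 ->
     `|h - h'| <= de -> `|V0 h - V0 h'| <= e) ->
  (forall s, y1 <= s <= y2 -> V0 s <= N0) -> K * de ^+ 3 = 2 * M0 -> 0 <= K ->
  V0 h <= N0 + e + K * (pos3 (y1 - h) + pos3 (h - y2)).
Proof.
move=> de0 e0 y10 y12 y2R hR unif N0P KE K0.
pose s := Num.min y2 (Num.max y1 h).
have sI : y1 <= s <= y2.
  by rewrite /s le_min y12 le_max lexx ge_min lexx.
have sR : 0 <= s <= rad ^+ 2.
  by move: sI => /andP[a b]; rewrite (le_trans y10 a) (le_trans b y2R).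
have V0s := N0P s sI.
have PK1 := mulr_ge0 K0 (pos3_ge0 (y1 - h)); have PK2 := mulr_ge0 K0 (pos3_ge0 (h - y2)).
have [near|far] := leP `|h - s| de.
  have := unif h s hR sR near => /ler_normlP[_]; lra.
have big : 2 * M0 <= K * (pos3 (y1 - h) + pos3 (h - y2)).
  have mono d : de <= d -> 2 * M0 <= K * pos3 d.
    move=> ded; rewrite -KE ler_wpM2l // /pos3 pos_pos; last by rewrite (le_trans _ ded) // ltW.
    by rewrite lerXn2r // nnegrE ?(ltW de0) // (le_trans _ ded) // ltW.
  rewrite mulrDr; move: far; rewrite /s.
  have [a|a] := leP y1 h.
    have [b|b] := leP y2 h; last by rewrite subrr normr0; lra.
    by rewrite ger0_norm ?subr_ge0 // => /ltW/mono; lra.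
  rewrite (min_idPr y12) ltr0_norm ?subr_lt0 // opprB => /ltW/mono; lra.
have /ler_normlP[_ b1] := V0_bound hR; have /ler_normlP[b2 _] := V0_bound sR.
lra.
Qed.

(** The threshold [kap] depends on [t] and [e] but not on the polygons. The final error has three
    parts of at most [e / 4]: the modulus of continuity of [V0], the drift [eps * t], and the cubes
    at time [t], where [|x|^2] is within [dl] of the common starting point. *)
Lemma euler_upper (t e : R) : 0 < t -> 0 < e ->
  exists2 kap : R, 0 < kap & forall (dl D : R) (N : nat) (z1 z2 : nat -> R),
    0 < dl <= kap -> 0 < D <= kap -> N%:R * D = t ->
    (forall j, zeta <= z1 j <= rad ^+ 2 - dl) ->
    (forall j, zeta <= z2 j <= rad ^+ 2 - dl) ->
    (forall j, z1 j <= z2 j) ->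
    (forall j, `|z1 j - z1 j.+1| <= Vb * D) ->
    (forall j, `|z2 j - z2 j.+1| <= Vb * D) ->
    (forall j, D * (- (2 * (n%:R - 1)) + G (z1 j)) <= z1 j - z1 j.+1) ->
    (forall j, (z2 j - z2 j.+1 <= D * (- (2 * (n%:R - 1)) - G (z2 j))) \/
      (rad ^+ 2 - z2 j <= dl + Vb * D /\ rad ^+ 2 - z2 j.+1 <= dl + Vb * D)) ->
    z1 0%N = z2 0%N ->
    forall N0, (forall s, z1 N <= s <= z2 N -> V0 s <= N0) ->
    forall x, ball_cl rad x -> `|sqn x - z1 0%N| <= dl -> U (x, t) <= N0 + e.
Proof.
move=> t0 e0; have e4 : 0 < e / 4 by rewrite divr_gt0.
have [de de0 unif] := V0_unif e4.
have M00 : 0 <= M0.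
  by apply: le_trans (normr_ge0 _) (V0_bound (h := 0) _); rewrite lexx sqr_ge0.
(* The quotient is what [euler_initial] needs; the added [1] makes [K] positive even if [M0 = 0]. *)
pose K := 2 * M0 / de ^+ 3 + 1.
have d3 : 0 < de ^+ 3 by rewrite exprn_gt0.
have K00 : 0 <= 2 * M0 / de ^+ 3 by rewrite divr_ge0 ?mulr_ge0 // ltW.
have K0 : 0 < K by rewrite /K ltr_wpDl.
pose eps := e / (4 * t); have eps0 : 0 < eps by rewrite divr_gt0 // mulr_gt0.
pose L := 3 * Lam; pose Em := K * expR (L * t).
have Em0 : 0 < Em by rewrite mulr_gt0 // expR_gt0.
pose W1 := 3 * Em * rad ^+ 4 * Lam * Vb.
pose W2 := 6 * Em * (1 + Vb) ^+ 2 * Vb.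
have W10 : 0 <= W1 by rewrite !mulr_ge0 ?exprn_ge0 // ltW.
have W20 : 0 <= W2 by rewrite !mulr_ge0 ?exprn_ge0 ?addr_ge0 // ltW.
pose W := W1 + W2 + Em.
have W0 : 0 < W by rewrite /W ltr_wpDl // addr_ge0.
(* Halving turns the bounds by [m] into the strict inequalities against [eps]. *)
pose m := Num.min eps (e / 4) / 2.
have m0 : 0 < m by rewrite divr_gt0 // lt_min eps0.
have m_eps : m < eps.
  have : Num.min eps (e / 4) <= eps by rewrite ge_min lexx.
  by rewrite /m; lra.
have m_e : m <= e / 4.
  have : Num.min eps (e / 4) <= e / 4 by rewrite ge_min lexx orbT.
  by rewrite /m; lra.
pose kap := Num.min 1 (m / W).
have kap1 : kap <= 1 by rewrite /kap ge_min lexx.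
have Wk : W * kap <= m.
  by rewrite mulrC -ler_pdivlMr // /kap ge_min lexx orbT.
have kap0 : 0 < kap by rewrite /kap lt_min ltr01 divr_gt0.
exists kap => // dl D N z1 z2 /andP[dl0 dlk] /andP[D0 Dk] ND b1 b2 b12 d1 d2 T1 T2 z00
  N0 N0P x xb xz.
have W1D : W1 * D <= m.
  rewrite (le_trans _ Wk) //; apply: ler_pM => //; first exact: ltW.
  by rewrite /W -addrA lerDl addr_ge0 // ltW.
have eta0 : 0 <= dl + Vb * D by rewrite addr_ge0 ?mulr_ge0 // ltW.
have eta1 : dl + Vb * D <= (1 + Vb) * kap.
  by rewrite mulrDl mul1r lerD // ler_wpM2l.
have eta2 : (dl + Vb * D) ^+ 2 <= (1 + Vb) ^+ 2 * kap.
  apply: (@le_trans _ _ (((1 + Vb) * kap) ^+ 2)).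
    by rewrite lerXn2r // nnegrE // mulr_ge0 ?addr_ge0 // ltW.
  rewrite exprMn ler_wpM2l ?sqr_ge0 // expr2 ler_piMl //; exact: ltW.
have W2e : 6 * Em * (dl + Vb * D) ^+ 2 * Vb <= m.
  apply: le_trans Wk; apply: (@le_trans _ _ (W2 * kap)).
    have p0 : 0 <= 6 * Em * Vb by rewrite !mulr_ge0 // ltW.
    by have := ler_wpM2l p0 eta2; rewrite /W2; lra.
  by apply: ler_wpM2r; [exact: ltW|rewrite /W; lra].
have Emd : Em * dl <= m.
  apply: le_trans Wk; apply: ler_pM => //; try exact: ltW.
  by rewrite /W lerDr addr_ge0.
have dl1 : dl <= 1 by exact: le_trans dlk kap1.
have dl3 : dl ^+ 3 <= dl.
  by rewrite exprS -[leRHS]mulr1 ler_wpM2l ?exprn_ile1 ?(ltW dl0).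
have initN y : ball_cl rad y ->
    U (y, 0) <= level L eps K (N0 + e / 4) 0 (z1 N) (z2 N) y.
  move=> yb; apply: (le_trans (init yb)).
  have /andP[q1 q2] := b1 N; have /andP[q3 q4] := b2 N.
  have y10 : 0 <= z1 N := le_trans (ltW zeta_gt0) q1.
  have y2R : z2 N <= rad ^+ 2 by rewrite (le_trans q4) // lerBlDr lerDl ltW.
  have KE : 2 * M0 / de ^+ 3 * de ^+ 3 = 2 * M0 by rewrite divfK ?gt_eqF.
  have := euler_initial de0 (ltW e4) y10 (b12 N) y2R (sqn_ball yb) unif N0P KE K00.
  have := addr_ge0 (pos3_ge0 (z1 N - sqn y)) (pos3_ge0 (sqn y - z2 N)).
  by rewrite /level /K mulr0 mulr0 expR0 mulr1; lra.
have NDt : N%:R * D <= t by rewrite ND.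
have s1 : 3 * (K * expR (L * t)) * rad ^+ 4 * Lam * Vb * D < eps.
  exact: le_lt_trans W1D m_eps.
have s2 : 6 * (K * expR (L * t)) * (dl + Vb * D) ^+ 2 * Vb < eps.
  exact: le_lt_trans W2e m_eps.
have := propagate rad_gt0 U_cont U_test K0 eps0 Lam_ge0 GC G_lip G_bound
  (erefl : L = 3 * Lam) zeta_gt0 dl0 D0 NDt b1 b2 b12 d1 d2 s1 s2 T1 T2 initN xb.
rewrite ND => /le_trans; apply; rewrite /level -z00.
have epst : eps * t = e / 4.
  by rewrite /eps; field; rewrite gt_eqF.
rewrite epst -/Em.
have P3 : pos3 (z1 0%N - sqn x) + pos3 (sqn x - z1 0%N) <= dl.
  apply: le_trans dl3; rewrite /pos3.
  have [h|h] := leP 0 (sqn x - z1 0%N).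
    rewrite [pos (z1 _ - _)]pos_neg; last by lra.
    rewrite pos_pos // expr0n add0r lerXn2r ?nnegrE ?(ltW dl0) //.
    by rewrite -(ger0_norm h).
  rewrite [pos (sqn x - _)]pos_neg ?(ltW h) // pos_pos; last by lra.
  rewrite expr0n addr0 lerXn2r ?nnegrE ?(ltW dl0) //; first by lra.
  by move: xz; rewrite (ltr0_norm h) opprB.
have := ler_wpM2l (ltW Em0) P3; lra.
Qed.

End EulerUpperBound.

(** * The speed of characteristics in the squared radius *)

Section Drift.
Context {R : realType}.
Variables (rad Lc M : R) (cb : R -> R).
Hypotheses (rad_gt0 : 0 < rad) (Lc_ge0 : 0 <= Lc) (M_ge0 : 0 <= M)
  (cb_ge0 : forall x, 0 <= cb x) (cb_le : forall x, cb x <= M)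
  (cb_lip : forall x y, `|cb x - cb y| <= Lc * `|x - y|).

(* Along characteristics [h = |x|^2] moves with speed [2 (n - 1) + a * drift h],
   [-1 <= a <= 1]. *)
Definition drift (h : R) : R := 2 * Num.sqrt h * cb (Num.sqrt h).

Lemma drift_ge0 h : 0 <= drift h.
Proof. by rewrite /drift !mulr_ge0 // sqrtr_ge0. Qed.

Lemma drift_continuous : continuous drift.
Proof.
move=> h; apply: cvgM.
  by apply: cvgM; [exact: cvg_cst|exact: sqrt_continuous].
apply: (@continuous_comp _ _ _ Num.sqrt cb); first exact: sqrt_continuous.
exact: (lipschitz_continuous cb_lip).
Qed.

Lemma sqrt_le_rad h : 0 <= h <= rad ^+ 2 -> Num.sqrt h <= rad.
Proof.
move=> /andP[h0 hr]; rewrite -(ger0_norm (ltW rad_gt0)) -sqrtr_sqr.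
by rewrite ler_sqrt // sqr_ge0.
Qed.

Lemma drift_bound h : 0 <= h <= rad ^+ 2 -> drift h <= 2 * rad * M.
Proof.
move=> hr; rewrite /drift; apply: ler_pM; [by rewrite mulr_ge0 ?sqrtr_ge0|exact: cb_ge0| |exact: cb_le].
by rewrite ler_pM2l // sqrt_le_rad.
Qed.

(** The difference splits so that [cb] varies against the factor [2 sqrt h <= 2 rad], and the square
    root against [cb <= M]; [sqrt_dist] then accounts for the factor [1 / sqrt zeta]. *)
Lemma drift_lip zeta q h : 0 < zeta -> zeta <= q <= rad ^+ 2 ->
  0 <= h <= rad ^+ 2 ->
  `|drift h - drift q| <= (2 * rad * Lc + 2 * M) / Num.sqrt zeta * `|h - q|.
Proof.
move=> z0 /andP[zq qr] hr; have /andP[h0 _] := hr.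
have sd := sqrt_dist z0 zq h0.
have -> : drift h - drift q = 2 * Num.sqrt h * (cb (Num.sqrt h) - cb (Num.sqrt q))
    + 2 * (Num.sqrt h - Num.sqrt q) * cb (Num.sqrt q) by rewrite /drift; ring.
have k0 : 0 <= 2 * rad * Lc + 2 * M by rewrite addr_ge0 ?mulr_ge0 // ltW.
have fin : (2 * rad * Lc + 2 * M) * `|Num.sqrt h - Num.sqrt q| <=
    (2 * rad * Lc + 2 * M) / Num.sqrt zeta * `|h - q|.
  by rewrite -[leRHS]mulrA [_^-1 * _]mulrC ler_wpM2l.
apply: le_trans fin; rewrite (le_trans (ler_normD _ _)) // [leRHS]mulrDl lerD //.
  rewrite normrM normrM [`|2|]gtr0_norm // (ger0_norm (sqrtr_ge0 _)) -[leRHS]mulrA.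
  apply: ler_pM; [by rewrite mulr_ge0 ?sqrtr_ge0|exact: normr_ge0| |exact: cb_lip].
  by rewrite ler_pM2l // sqrt_le_rad.
rewrite normrM normrM [`|2|]gtr0_norm // (ger0_norm (cb_ge0 _)).
by rewrite -mulrA [`|_| * cb _]mulrC mulrA ler_wpM2r // ler_pM2l.
Qed.

(** For such [z] the product [sqrt z * cb (sqrt z)] is at most [M / (M + 1) < 1]: near the origin
    curvature beats forcing, and even the slowest characteristic moves outwards. *)
Lemma drift_small z m2 : 2 <= m2 -> z <= (M + 1)^-1 ^+ 2 -> drift z < m2.
Proof.
move=> m22 zM; have M1 : 0 < M + 1 by rewrite ltr_wpDl.
have sz : Num.sqrt z <= (M + 1)^-1.
  have i0 : 0 <= (M + 1)^-1 by rewrite invr_ge0 ltW.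
  by rewrite -(ger0_norm i0) -sqrtr_sqr ler_sqrt // sqr_ge0.
have : Num.sqrt z * cb (Num.sqrt z) <= (M + 1)^-1 * M.
  by apply: ler_pM => //; exact: sqrtr_ge0.
have : (M + 1)^-1 * M < 1 by rewrite ltr_pdivrMl // mulr1 ltrDl.
by rewrite /drift -mulrA; lra.
Qed.

End Drift.

(** * Two-sided bounds for the solution *)

Section SolutionBounds.
Context {R : realType} {n : nat}.
Variables (rad Lc M M0 : R) (cb v0 : R -> R) (u : 'rV[R]_n * R -> R).
Hypotheses (hn : (2 <= n)%N) (rad_gt0 : 0 < rad)
  (Lc_ge0 : 0 <= Lc) (M_ge0 : 0 <= M)
  (cb_ge0 : forall x, 0 <= cb x) (cb_le : forall x, cb x <= M)
  (cb_lip : forall x y, `|cb x - cb y| <= Lc * `|x - y|)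
  (u_cont : {within cylinder rad, continuous u})
  (u_sub : sub_test rad cb u)
  (u_sup : sub_test rad (fun r => - cb r) (fun z => - u z))
  (u_init : forall x, ball_cl rad x -> u (x, 0) = v0 (sqn x))
  (v0_bound : forall h, 0 <= h <= rad ^+ 2 -> `|v0 h| <= M0)
  (v0_unif : forall e, 0 < e -> exists2 de, 0 < de &
     forall h h', 0 <= h <= rad ^+ 2 -> 0 <= h' <= rad ^+ 2 ->
       `|h - h'| <= de -> `|v0 h - v0 h'| <= e).

Let m2 : R := 2 * (n%:R - 1).
Let Vb : R := m2 + 2 * rad * M.
Local Notation G0 := (drift cb).

(** The three terms place the floor below the starting point, below every cap with
    [dl <= rad^2 / 2], and in the range of [drift_small]. *)
Definition floor_of (r2 : R) : R :=
  Num.min r2 (Num.min (rad ^+ 2 / 2) ((M + 1)^-1 ^+ 2)).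
Definition lip_of (r2 : R) : R :=
  (2 * rad * Lc + 2 * M) / Num.sqrt (floor_of r2).

Lemma m2_ge2 : 2 <= m2.
Proof.
by rewrite /m2; have : (2%:R : R) <= n%:R; [rewrite ler_nat|lra].
Qed.

Lemma floor_of_gt0 r2 : 0 < r2 -> 0 < floor_of r2.
Proof.
move=> r0; rewrite /floor_of !lt_min r0 divr_gt0 ?exprn_gt0 //= invr_gt0.
by rewrite ltr_wpDl.
Qed.

Lemma lip_ge0 r2 : 0 <= lip_of r2.
Proof.
by rewrite /lip_of divr_ge0 ?sqrtr_ge0 // addr_ge0 ?mulr_ge0 // ltW.
Qed.

Lemma drift_below_floor r2 z : z <= floor_of r2 -> G0 z < m2.
Proof.
move=> zf; apply: (drift_small (M := M)) => //; first exact: m2_ge2.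
by rewrite (le_trans zf) // /floor_of !ge_min lexx !orbT.
Qed.

Lemma drift_floor r2 : G0 (floor_of r2) <= m2.
Proof. exact: ltW (drift_below_floor (lexx _)).
Qed.

Lemma floor_start r2 dl : 0 < r2 -> 0 < dl -> dl <= rad ^+ 2 / 2 ->
  floor_of r2 <= Num.min r2 (rad ^+ 2 - dl) <= rad ^+ 2 - dl.
Proof.
move=> r0 dl0 dlr; apply/andP; split; last by rewrite ge_min lexx orbT.
rewrite le_min {1}/floor_of ge_min lexx /=.
apply: (@le_trans _ _ (rad ^+ 2 / 2)); last by lra.
by rewrite /floor_of !ge_min lexx orbT.
Qed.

Lemma floor_cap r2 dl : dl <= rad ^+ 2 / 2 -> floor_of r2 <= rad ^+ 2 - dl.
Proof.
move=> dlr; apply: (@le_trans _ _ (rad ^+ 2 / 2)); last by lra.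
by rewrite /floor_of !ge_min lexx orbT.
Qed.

(** A starting point beyond the cap, as for [|x| = rad], is moved down to it, by at most [dl] when
    [r2 <= rad^2]. *)
Definition char_traj (r2 dl D a : R) : nat -> R :=
  traj m2 (rad ^+ 2 - dl) D (Num.min r2 (rad ^+ 2 - dl)) G0 a.

Section Trajectories.
Variables (r2 dl D : R).
Hypotheses (r2_gt0 : 0 < r2) (dl_gt0 : 0 < dl) (dl_small : dl <= rad ^+ 2 / 2)
  (D_ge0 : 0 <= D) (D_small : D * lip_of r2 <= 1).

Let G0_lip q h : floor_of r2 <= q <= rad ^+ 2 -> 0 <= h <= rad ^+ 2 ->
  `|G0 h - G0 q| <= lip_of r2 * `|h - q|.
Proof. by move=> qr hr; apply: drift_lip => //; exact: floor_of_gt0. Qed.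

Let cap_le : rad ^+ 2 - dl <= rad ^+ 2.
Proof. by rewrite lerBlDr lerDl ltW. Qed.

Lemma char_traj_in a j : `|a| <= 1 ->
  floor_of r2 <= char_traj r2 dl D a j <= rad ^+ 2 - dl.
Proof.
move=> a1; apply: (traj_in (Lam := lip_of r2) (R2 := rad ^+ 2)) => //.
- by move=> h; exact: drift_ge0.
- exact: floor_of_gt0.
- exact: floor_cap.
- exact: drift_floor.
- exact: floor_start.
Qed.

Lemma char_traj_le a b j : `|a| <= 1 -> `|b| <= 1 -> a <= b ->
  char_traj r2 dl D a j <= char_traj r2 dl D b j.
Proof.
move=> a1 b1 ab.
apply: (traj_le (Lam := lip_of r2) (R2 := rad ^+ 2) (zeta := floor_of r2)) => //.
- by move=> h; exact: drift_ge0.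
- exact: floor_of_gt0.
- exact: floor_cap.
- exact: drift_floor.
- exact: floor_start.
Qed.

Lemma char_traj_step a j (z := char_traj r2 dl D a) : `|a| <= 1 ->
  [/\ - (D * speed m2 G0 a (z j)) <= z j - z j.+1,
      z j - z j.+1 = - (D * speed m2 G0 a (z j)) \/
        (z j.+1 = rad ^+ 2 - dl /\ rad ^+ 2 - dl - z j <= Vb * D) &
      `|z j - z j.+1| <= Vb * D].
Proof.
move=> a1.
apply: (traj_step (Lam := lip_of r2) (R2 := rad ^+ 2) (zeta := floor_of r2)) => //.
- by move=> h; exact: drift_ge0.
- exact: floor_of_gt0.
- exact: floor_cap.
- by move=> h hr; rewrite /Vb lerD2l; exact: drift_bound.
- exact: le_trans m2_ge2.
- exact: drift_floor.
- exact: floor_start.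
Qed.

Lemma euler_char_le z z' : floor_of r2 <= z -> z <= z' -> z' <= rad ^+ 2 - dl ->
  euler m2 (rad ^+ 2 - dl) D G0 (-1) z <= euler m2 (rad ^+ 2 - dl) D G0 (-1) z'.
Proof.
move=> zz zz' z'c.
apply: (euler_le m2 (Lam := lip_of r2) (R2 := rad ^+ 2) (zeta := floor_of r2)) => //.
- exact: floor_of_gt0.
- by rewrite normrN normr1.
Qed.

End Trajectories.

(** For the upper bound the fronts are the polygons with controls [-1] and [1]. For the lower bound
    at [s], applied to [- u] with reversed forcing, one polygon ending at [s] is both fronts: as
    [G = - G0] there, every control in [[-1, 1]] meets both speed conditions. *)
Lemma solution_bounds (r2 t e : R) : 0 < r2 <= rad ^+ 2 -> 0 < t -> 0 < e ->
  exists2 kap : R, 0 < kap & forall (dl D : R) (N : nat),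
    0 < dl <= kap -> 0 < D <= kap -> N%:R * D = t ->
    let zm := char_traj r2 dl D (-1) N in
    let zp := char_traj r2 dl D 1 N in
    [/\ 0 <= zm <= zp,
      forall m, (forall s, zm <= s <= zp -> v0 s <= m) ->
        forall x, ball_cl rad x -> sqn x = r2 -> u (x, t) <= m + e &
      forall s, zm <= s <= zp ->
        forall x, ball_cl rad x -> sqn x = r2 -> v0 s - e <= u (x, t)].
Proof.
move=> /andP[r0 rr] t0 e0.
have N1 : `|-1 : R| <= 1 by rewrite normrN normr1.
have P1 : `|1 : R| <= 1 by rewrite normr1.
have z0 := floor_of_gt0 r0; have L0 := lip_ge0 r2.
have Vb0 : 0 <= Vb.
  apply: addr_ge0; first exact: le_trans m2_ge2.
  by rewrite !mulr_ge0 // ltW.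
have Glip q h : floor_of r2 <= q <= rad ^+ 2 -> 0 <= h <= rad ^+ 2 ->
    `|G0 h - G0 q| <= lip_of r2 * `|h - q|.
  by move=> qr hr; exact: drift_lip.
have Glip' q h : floor_of r2 <= q <= rad ^+ 2 -> 0 <= h <= rad ^+ 2 ->
    `|- G0 h - - G0 q| <= lip_of r2 * `|h - q|.
  by move=> qr hr; rewrite -opprD normrN; exact: Glip.
have Gb h : 0 <= h <= rad ^+ 2 -> 2 * (n%:R - 1) + `|G0 h| <= Vb.
  by move=> hr; rewrite ger0_norm ?drift_ge0 // lerD2l; exact: drift_bound.
have Gb' h : 0 <= h <= rad ^+ 2 -> 2 * (n%:R - 1) + `|- G0 h| <= Vb.
  by move=> hr; rewrite normrN; exact: Gb.
have GC (h : R) : 0 <= h -> G0 h = 2 * Num.sqrt h * cb (Num.sqrt h) by [].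
have GC' (h : R) : 0 <= h -> - G0 h = 2 * Num.sqrt h * - cb (Num.sqrt h).
  by rewrite /drift mulrN.
have init x : ball_cl rad x -> u (x, 0) <= v0 (sqn x) by move=> /u_init ->.
have init' x : ball_cl rad x -> - u (x, 0) <= - v0 (sqn x) by move=> /u_init ->.
have v0b' h : 0 <= h <= rad ^+ 2 -> `|- v0 h| <= M0 by rewrite normrN; exact: v0_bound.
have v0u' ee : 0 < ee -> exists2 de, 0 < de &
     forall h h', 0 <= h <= rad ^+ 2 -> 0 <= h' <= rad ^+ 2 ->
       `|h - h'| <= de -> `|- v0 h - - v0 h'| <= ee.
  move=> /v0_unif[de de0 H]; exists de => // h h' hr hr' hh.
  by rewrite -opprD normrN; exact: H.
have u_cont' := within_opp u_cont.
have [k1 k10 K1] := euler_upper rad_gt0 u_cont u_sub L0 GC Glip Gb z0 Vb0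
  v0_bound v0_unif init t0 e0.
have [k2 k20 K2] := euler_upper rad_gt0 u_cont' u_sup L0 GC' Glip' Gb' z0 Vb0
  v0b' v0u' init' t0 e0.
have l1 : 0 < lip_of r2 + 1 by rewrite ltr_wpDl.
have R2h : 0 < rad ^+ 2 / 2 by rewrite divr_gt0 // exprn_gt0.
exists (Num.min (Num.min k1 k2) (Num.min (rad ^+ 2 / 2) (lip_of r2 + 1)^-1)).
  by rewrite !lt_min k10 k20 R2h invr_gt0.
move=> dl D N; rewrite !le_min => /andP[dl0 /andP[/andP[dk1 dk2] /andP[dr _]]].
move=> /andP[D0 /andP[/andP[Dk1 Dk2] /andP[_ Dl]]] ND zm zp.
have Dlip : D * lip_of r2 <= 1.
  apply: (@le_trans _ _ (D * (lip_of r2 + 1))); first by rewrite ler_wpM2l ?lerDl // ltW.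
  by move: Dl; rewrite -[_^-1]mul1r ler_pdivlMr.
have dist x : sqn x = r2 -> `|sqn x - Num.min r2 (rad ^+ 2 - dl)| <= dl.
  move=> ->; have [h|h] := leP r2 (rad ^+ 2 - dl).
    by rewrite subrr normr0 ltW.
  by rewrite ger0_norm; lra.
have dk1' : 0 < dl <= k1 by rewrite dl0.
have dk2' : 0 < dl <= k2 by rewrite dl0.
have Dk1' : 0 < D <= k1 by rewrite D0.
have Dk2' : 0 < D <= k2 by rewrite D0.
have tin a (a1 : `|a| <= 1) j := char_traj_in r0 dl0 dr (ltW D0) Dlip j a1.
have tst a (a1 : `|a| <= 1) j := char_traj_step r0 dl0 dr (ltW D0) Dlip j a1.
have tle j : char_traj r2 dl D (-1) j <= char_traj r2 dl D 1 j.
  by apply: (char_traj_le r0 dl0 dr (ltW D0) Dlip) => //; lra.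
split.
- rewrite tle andbT; have /andP[h _] := tin _ N1 N.
  exact: le_trans (ltW z0) h.
- move=> m Hm x xb xr.
  apply: (K1 dl D N (char_traj r2 dl D (-1)) (char_traj r2 dl D 1)) => //.
  + by move=> j; exact: tin.
  + by move=> j; exact: tin.
  + by move=> j; have [] := tst _ N1 j.
  + by move=> j; have [] := tst _ P1 j.
  + by move=> j; have [+ _ _] := tst _ N1 j; rewrite /speed /m2; lra.
  + move=> j; have [_ [E|[E1 E2]] _] := tst _ P1 j.
      by left; rewrite E /speed /m2; lra.
    by right; rewrite E1; move: E2; have := mulr_ge0 Vb0 (ltW D0); lra.
  + exact: dist.
- move=> s sI x xb xr.
  have [a a1 aE] := traj_intermediate (drift_continuous cb_lip) sI.
  suff : - u (x, t) <= - v0 s + e by lra.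
  apply: (K2 dl D N (char_traj r2 dl D a) (char_traj r2 dl D a)) => //.
  + by move=> j; exact: tin.
  + by move=> j; exact: tin.
  + by move=> j; have [] := tst _ a1 j.
  + by move=> j; have [] := tst _ a1 j.
  + move=> j; have [+ _ _] := tst _ a1 j; rewrite /speed.
    set z := char_traj _ _ _ _ _; have g0 := drift_ge0 cb_ge0 z.
    move/ler_normlP: a1 => [_ a2].
    have := ler_wpM2l (ltW D0) (ler_wpM2r g0 a2); rewrite /m2; lra.
  + move=> j; have [_ [E|[E1 E2]] _] := tst _ a1 j.
      left; rewrite E /speed.
      set z := char_traj _ _ _ _ _; have g0 := drift_ge0 cb_ge0 z.
      move/ler_normlP: a1 => [a2 _].
      have := ler_wpM2l (ltW D0) (ler_wpM2r g0 a2); rewrite /m2; lra.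
    by right; rewrite E1; move: E2; have := mulr_ge0 Vb0 (ltW D0); lra.
  + move=> s'; rewrite /char_traj aE => /andP[h1 h2].
    by have -> : s' = s by apply/eqP; rewrite eq_le h1 h2.
  + exact: dist.
Qed.

End SolutionBounds.

(** * Large time behaviour *)

Section LongTimeTrajectories.
Context {R : realType} {n : nat}.
Variables (rad Lc M : R) (cb : R -> R).
Hypotheses (hn : (2 <= n)%N) (rad_gt0 : 0 < rad)
  (Lc_ge0 : 0 <= Lc) (M_ge0 : 0 <= M)
  (cb_ge0 : forall x, 0 <= cb x) (cb_le : forall x, cb x <= M)
  (cb_lip : forall x y, `|cb x - cb y| <= Lc * `|x - y|).

Local Notation m2 := (2 * (n%:R - 1) : R).
Local Notation Lam := (lip_of rad Lc M).
Local Notation R2 := (rad ^+ 2).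

(** The speed for the control [-1]. In terms of [z = r^2] with [0 < r <= rad], it vanishes exactly
    at the critical radii. *)
Definition slow (z : R) : R := m2 - drift cb z.

Let speedE z : speed m2 (drift cb) (-1) z = slow z.
Proof. by rewrite /speed /slow mulN1r. Qed.

Let N1 : `|-1 : R| <= 1.
Proof. by rewrite normrN normr1. Qed.

Let R2_gt0 : 0 < R2.
Proof. by rewrite exprn_gt0. Qed.

Lemma slow_continuous : continuous slow.
Proof.
by move=> z; apply: cvgB; [exact: cvg_cst|exact: (drift_continuous cb_lip)].
Qed.

Section FixedStep.
Variables (r2 dl D : R).
Hypotheses (r2_gt0 : 0 < r2) (dl_gt0 : 0 < dl) (dl_small : dl <= R2 / 2)
  (D_ge0 : 0 <= D) (D_small : D * Lam r2 <= 1).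

Local Notation cap := (R2 - dl).
Local Notation zm := (@char_traj R n rad cb r2 dl D (-1)).

Let zm0 : zm 0%N = Num.min r2 cap.
Proof. by []. Qed.

Let zmS j : zm j.+1 = Num.min cap (zm j + D * slow (zm j)).
Proof. by rewrite -speedE. Qed.

Let zm_in j : floor_of rad M r2 <= zm j <= cap.
Proof. exact: (char_traj_in hn rad_gt0 Lc_ge0 M_ge0 cb_ge0 cb_le cb_lip). Qed.

Let euler_fix Dd : slow Dd = 0 -> Dd <= cap ->
  euler m2 cap D (drift cb) (-1) Dd = Dd.
Proof. by move=> s0 Dc; rewrite /euler speedE s0 mulr0 addr0 (min_idPr Dc). Qed.

Lemma floor_le_zero Dd : slow Dd = 0 -> floor_of rad M r2 <= Dd.
Proof.
move=> s0; rewrite leNgt; apply/negP => /ltW h.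
have := drift_below_floor hn M_ge0 cb_ge0 cb_le h.
by move: s0; rewrite /slow; lra.
Qed.

(** A zero of [slow] below the cap is a fixed point of the monotone Euler map, hence a barrier for
    the polygon. *)
Lemma slow_traj_le Dd j : slow Dd = 0 -> Dd <= cap -> zm 0%N <= Dd -> zm j <= Dd.
Proof.
move=> s0 Dc z0; elim: j => [//|j IH].
have /andP[zf _] := zm_in j.
have := @euler_char_le R n rad Lc M cb rad_gt0 Lc_ge0 M_ge0 cb_ge0 cb_le cb_lip
  r2 dl D r2_gt0 dl_gt0 D_ge0 D_small _ _ zf IH Dc.
by rewrite (euler_fix s0 Dc) /euler speedE -zmS.
Qed.

Lemma slow_traj_ge Dd j : slow Dd = 0 -> Dd <= cap -> Dd <= zm 0%N -> Dd <= zm j.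
Proof.
move=> s0 Dc z0; elim: j => [//|j IH].
have /andP[_ zc] := zm_in j.
have := @euler_char_le R n rad Lc M cb rad_gt0 Lc_ge0 M_ge0 cb_ge0 cb_le cb_lip
  r2 dl D r2_gt0 dl_gt0 D_ge0 D_small _ _ (floor_le_zero s0) IH zc.
by rewrite (euler_fix s0 Dc) /euler speedE -zmS.
Qed.

(** For a starting point that is already the limit but may have been moved down by the cap: as
    [slow r2 >= 0] and [slow] is Lipschitz, each step enlarges the gap by a factor of at most
    [1 + Lam r2 * D]. *)
Lemma slow_traj_gronwall j : r2 <= R2 -> 0 <= slow r2 ->
  (forall j, zm j <= r2) -> r2 - zm j <= dl * (1 + Lam r2 * D) ^+ j.
Proof.
move=> rR s0 zr; have L0 := lip_ge0 rad_gt0 Lc_ge0 M_ge0 r2.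
have q1 : 1 <= 1 + Lam r2 * D by rewrite lerDl mulr_ge0.
elim: j => [|j IH].
  by rewrite expr0 mulr1 zm0; have := dl_gt0; have [h|h] := leP r2 cap; lra.
have dq : dl <= dl * (1 + Lam r2 * D) ^+ j.+1.
  by rewrite ler_peMr ?exprn_ege1 // ltW.
rewrite zmS; have [h|h] := leP cap (zm j + D * slow (zm j)); first by lra.
have /andP[zf zc] := zm_in j.
have rf : floor_of rad M r2 <= r2 by rewrite /floor_of ge_min lexx.
have f0 := floor_of_gt0 rad_gt0 M_ge0 r2_gt0.
have := @drift_lip R rad Lc M cb rad_gt0 Lc_ge0 M_ge0 cb_ge0 cb_le cb_lip
  (floor_of rad M r2) r2 (zm j) f0.
rewrite rf rR (le_trans (ltW f0) zf) (le_trans zc) /=; last by rewrite lerBlDr lerDl ltW.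
move=> /(_ isT isT); rewrite -/(lip_of rad Lc M r2) [`|_ - r2|]ler0_norm ?subr_le0 //.
rewrite opprB => /ler_normlP[_ lip].
have sj : - slow (zm j) <= Lam r2 * (r2 - zm j).
  by move: s0; rewrite /slow; lra.
have k0 : 0 <= 1 + Lam r2 * D by rewrite (le_trans _ q1).
have := ler_wpM2r k0 IH; have := ler_wpM2l D_ge0 sj.
by rewrite exprSr; lra.
Qed.

(** The polygon is nondecreasing. If it ended below [Dd - de] it would have stayed there, gaining at
    least [D * k0] per step and more than [R2] in total. The alternative on [slow Dd] covers both an
    equilibrium and the boundary, which the cap keeps out of reach. *)
Lemma slow_traj_incr (Dd de k0 : R) (N : nat) : r2 <= cap -> 0 < k0 -> 0 < de ->
  dl <= de -> Dd <= R2 -> (forall z, r2 <= z < Dd -> 0 <= slow z) ->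
  (slow Dd = 0 \/ forall j, zm j < Dd) -> (forall j, zm j <= Dd) ->
  (forall z, r2 <= z <= Dd - de -> k0 <= slow z) ->
  R2 < N%:R * D * k0 -> Dd - de <= zm N.
Proof.
move=> rc k00 de0 dlde DR s0 sD zD sk NDk; rewrite leNgt; apply/negP => zN.
have low j : r2 <= zm j /\ zm j <= zm j.+1.
  have inc i : r2 <= zm i -> zm i <= zm i.+1.
    move=> ri; have /andP[_ zc] := zm_in i.
    rewrite zmS le_min zc lerDl mulr_ge0 //.
    have := zD i; rewrite le_eqVlt => /orP[/eqP e|l]; last by apply: s0; rewrite ri.
    by case: sD => [sD|/(_ i)]; [rewrite e sD|rewrite e ltxx].
  suff : r2 <= zm j by move=> h; split=> //; exact: inc.
  elim: j => [|j IH]; first by rewrite zm0 le_min lexx.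
  exact: le_trans IH (inc _ IH).
have mono i j : (i <= j)%N -> zm i <= zm j.
  move=> ij; rewrite -(subnKC ij); elim: (j - i)%N => [|k IH]; first by rewrite addn0.
  by rewrite addnS (le_trans IH) //; case: (low (i + k)%N).
have key j : (j <= N)%N -> r2 + j%:R * D * k0 <= zm j.
  elim: j => [_|j IH jN]; first by rewrite !mul0r addr0; case: (low 0%N).
  have zjN : zm j.+1 < Dd - de by exact: le_lt_trans (mono _ _ jN) zN.
  have skj : k0 <= slow (zm j).
    apply: sk; have [-> l2] := low j; exact: ltW (le_lt_trans l2 zjN).
  have := IH (ltnW jN); have := ler_wpM2l D_ge0 skj.
  move: zjN; rewrite zmS; have [h|h] := leP cap (zm j + D * slow (zm j)).
    by lra.
  by rewrite -[j.+1]addn1 natrD; lra.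
have := key N (leqnn N); have /andP[_ zc] := zm_in N; have := r2_gt0; have := dl_gt0.
lra.
Qed.

Lemma slow_traj_decr (Dd de k0 : R) (N : nat) : r2 <= R2 -> 0 < k0 -> 0 < de ->
  0 < Dd -> Dd <= cap -> Dd <= r2 -> slow Dd = 0 ->
  (forall z, Dd < z <= r2 -> slow z <= 0) ->
  (forall z, Dd + de <= z <= r2 -> slow z <= - k0) ->
  R2 < N%:R * D * k0 -> zm N <= Dd + de.
Proof.
move=> rR k00 de0 Dd0 Dc Dr sD s0 sk NDk; rewrite leNgt; apply/negP => zN.
have z0D : Dd <= zm 0%N by rewrite zm0 le_min Dr Dc.
have zD j : Dd <= zm j by exact: slow_traj_ge.
have dec i : zm i <= r2 -> zm i.+1 <= zm i.
  move=> ri; rewrite zmS ge_min; apply/orP; right.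
  rewrite gerDl mulr_ge0_le0 //.
  have := zD i; rewrite le_eqVlt => /orP[/eqP <-|l]; first by rewrite sD.
  by apply: s0; rewrite l.
have zr j : zm j <= r2.
  elim: j => [|j IH]; first by rewrite zm0 ge_min lexx.
  exact: le_trans (dec _ IH) IH.
have mono i j : (i <= j)%N -> zm j <= zm i.
  move=> ij; rewrite -(subnKC ij); elim: (j - i)%N => [|k IH]; first by rewrite addn0.
  by rewrite addnS; apply: le_trans IH; exact: dec.
have key j : (j <= N)%N -> zm j <= r2 - j%:R * D * k0.
  elim: j => [_|j IH jN]; first by rewrite !mul0r subr0.
  have zjN : Dd + de < zm j by exact: lt_le_trans zN (mono _ _ (ltnW jN)).
  have skj : slow (zm j) <= - k0 by apply: sk; rewrite (ltW zjN) zr.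
  have := IH (ltnW jN); have := ler_wpM2l D_ge0 skj.
  have : zm j.+1 <= zm j + D * slow (zm j) by rewrite zmS ge_min lexx orbT.
  by rewrite -[j.+1]addn1 natrD; lra.
have := key N (leqnn N); lra.
Qed.

(** The fastest speed is at least [m2 >= 2], so the cap is reached after time [R2 / 2]; the same
    positivity keeps the polygon there. *)
Lemma fast_traj_cap (N : nat) : R2 < N%:R * D * 2 ->
  @char_traj R n rad cb r2 dl D 1 N = cap.
Proof.
move=> ND2; set zp := @char_traj R n rad cb r2 dl D 1.
have zpS j : zp j.+1 = Num.min cap (zp j + D * speed m2 (drift cb) 1 (zp j)) by [].
have sp z : 2 <= speed m2 (drift cb) 1 z.
  have := @m2_ge2 R n hn; have := drift_ge0 cb_ge0 z.
  by rewrite /speed mul1r; lra.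
have P1 : `|1 : R| <= 1 by rewrite normr1.
have zp_in j : floor_of rad M r2 <= zp j <= cap.
  exact: (char_traj_in hn rad_gt0 Lc_ge0 M_ge0 cb_ge0 cb_le cb_lip).
have f0 := floor_of_gt0 rad_gt0 M_ge0 r2_gt0.
have key j : zp j = cap \/ j%:R * D * 2 <= zp j.
  elim: j => [|j IH].
    by right; rewrite !mul0r; have /andP[h _] := zp_in 0%N; exact: le_trans (ltW f0) h.
  have := ler_wpM2l D_ge0 (sp (zp j)); rewrite zpS => s.
  have [h|h] := leP cap (zp j + D * speed m2 (drift cb) 1 (zp j)).
    by left.
  right.
  case: IH => IH; last by rewrite -[j.+1]addn1 natrD; lra.
  exfalso; move: h s; rewrite IH; have := D_ge0; lra.
case: (key N) => // h; have /andP[_ zc] := zp_in N; have := dl_gt0; lra.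
Qed.

End FixedStep.

(** [T] is chosen before the mesh, whereas [kap] may depend on [t]: the limits of fine mesh and of
    large time are taken in this order. *)
Lemma slow_traj_limit (r2 Dd de : R) : 0 < r2 <= R2 -> 0 < Dd <= R2 -> 0 < de ->
  slow Dd = 0 \/ (Dd = R2 /\ 0 <= slow Dd) ->
  [\/ r2 = Dd,
      r2 < Dd /\ (forall z, r2 <= z < Dd -> 0 < slow z) |
      Dd < r2 /\ slow Dd = 0 /\ (forall z, Dd < z <= r2 -> slow z < 0)] ->
  exists T : R, forall t, T <= t -> 0 < t -> exists2 kap : R, 0 < kap &
    forall (dl D : R) (N : nat), 0 < dl <= kap -> 0 < D <= kap -> N%:R * D = t ->
      `|@char_traj R n rad cb r2 dl D (-1) N - Dd| <= de /\
      @char_traj R n rad cb r2 dl D 1 N = R2 - dl.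
Proof.
move=> /andP[r0 rR] /andP[D0 DR] de0 sDd cases.
have L0 := lip_ge0 rad_gt0 Lc_ge0 M_ge0 r2.
have L1 : 0 < Lam r2 + 1 by rewrite ltr_wpDl.
(* [gap] and [gapr] keep [Dd] and [r2] below the cap when they lie strictly inside; at the boundary
   [1] is a dummy value. *)
pose gap := if Dd < R2 then R2 - Dd else 1.
have gap0 : 0 < gap by rewrite /gap; case: ifP => // h; rewrite subr_gt0.
pose gapr := if r2 < R2 then R2 - r2 else 1.
have gapr0 : 0 < gapr by rewrite /gapr; case: ifP => // h; rewrite subr_gt0.
pose kap0 := Num.min (Num.min (Num.min (R2 / 2) (Lam r2 + 1)^-1) (Num.min gap gapr)) de.
have kap00 : 0 < kap0.
  by rewrite /kap0 !lt_min divr_gt0 // invr_gt0 L1 gap0 gapr0 de0.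
have kap0P dl D : 0 < dl <= kap0 -> 0 < D <= kap0 ->
    [/\ [/\ 0 < dl, dl <= R2 / 2 & 0 <= D], D * Lam r2 <= 1,
        Dd < R2 -> Dd <= R2 - dl, r2 < R2 -> r2 <= R2 - dl & dl <= de].
  move=> /andP[dl0]; rewrite /kap0 !le_min => /andP[/andP[/andP[d1 _] /andP[d2 d3]] d4].
  move=> /andP[Dp /andP[/andP[/andP[_ D1] _] _]]; split=> //.
  - by split=> //; exact: ltW.
  - apply: (@le_trans _ _ (D * (Lam r2 + 1))); first by rewrite ler_wpM2l ?lerDl // ltW.
    by move: D1; rewrite -[_^-1]mul1r ler_pdivlMr.
  - by move=> h; move: d2; rewrite /gap h; lra.
  - by move=> h; move: d3; rewrite /gapr h; lra.
have upper dl D : 0 < dl <= kap0 -> 0 < D <= kap0 -> r2 <= Dd ->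
    forall j, @char_traj R n rad cb r2 dl D (-1) j <= Dd /\
      (slow Dd = 0 \/ @char_traj R n rad cb r2 dl D (-1) j < Dd).
  move=> dlk Dk rD j.
  have [[dl0 dl2 Dp] Dl gD gr dde] := kap0P _ _ dlk Dk.
  have /andP[_ zc] := char_traj_in hn rad_gt0 Lc_ge0 M_ge0 cb_ge0 cb_le cb_lip
    r0 dl0 dl2 Dp Dl j N1.
  have [DdR|DdR] := ltP Dd R2.
    have sD0 : slow Dd = 0 by case: sDd => // -[e _]; move: DdR; rewrite e ltxx.
    split; last by left.
    apply: slow_traj_le => //; first exact: gD.
    by rewrite /char_traj /traj /= ge_min rD.
  have ltD : @char_traj R n rad cb r2 dl D (-1) j < Dd.
    by rewrite (le_lt_trans zc) // (lt_le_trans _ DdR) // gtrBl.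
  by split; [exact: ltW|right].
have fast dl D N t : 0 < dl <= kap0 -> 0 < D <= kap0 -> N%:R * D = t -> R2 / 2 < t ->
    @char_traj R n rad cb r2 dl D 1 N = R2 - dl.
  move=> dlk Dk NDt tR; have [[dl0 dl2 Dp] Dl _ _ _] := kap0P _ _ dlk Dk.
  by apply: fast_traj_cap => //; rewrite NDt; lra.
have R22 : 0 < R2 / 2 by rewrite divr_gt0.
case: cases => [rD|[rD spos]|[rD [sD0 sneg]]].
- exists R2 => t tR t0.
  (* The gap [dl] grows at most to [dl * expR (Lam r2 * t)], so its threshold has to depend on
     [t]. *)
  exists (Num.min kap0 (de / expR (Lam r2 * t))).
    by rewrite lt_min kap00 divr_gt0 // expR_gt0.
  move=> dl D N /andP[dl0']; rewrite le_min => /andP[dk dke].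
  move=> /andP[D0']; rewrite le_min => /andP[Dk _] NDt.
  have dlk : 0 < dl <= kap0 by rewrite dl0'.
  have Dk' : 0 < D <= kap0 by rewrite D0'.
  split; last by apply: (fast dl D N t) => //; have := R2_gt0; lra.
  have [[dl0 dl2 Dp] Dl _ _ _] := kap0P _ _ dlk Dk'.
  have rD' : r2 <= Dd by rewrite rD.
  have up := upper dl D dlk Dk' rD'.
  have s0 : 0 <= slow r2 by rewrite rD; case: sDd => [->|[]].
  have zr j : @char_traj R n rad cb r2 dl D (-1) j <= r2.
    by have := (up j).1; rewrite -rD.
  have := slow_traj_gronwall r0 dl0 dl2 Dp Dl N rR s0 zr.
  have e1 : (1 + Lam r2 * D) ^+ N <= expR (Lam r2 * t).
    apply: (@le_trans _ _ (expR (Lam r2 * D) ^+ N)).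
      have b0 : 0 <= 1 + Lam r2 * D by rewrite addr_ge0 // mulr_ge0.
      by rewrite lerXn2r ?nnegrE ?b0 ?expR_ge0 // expR_ge1Dx.
    by rewrite -expRM_natl -NDt mulrCA.
  have e2 := ler_wpM2l (ltW dl0) e1.
  move: dke; rewrite ler_pdivlMr ?expR_gt0 // => e3 e4.
  rewrite ler0_norm; first by rewrite -rD; lra.
  by rewrite subr_le0; case: (up N).
- have rlt : r2 < R2 := lt_le_trans rD DR.
  (* The minimum of [slow] over the compact interval [[r2, Dd - de]], on which it is positive; any
     constant will do if the interval is empty. *)
  have [k0 k00 sk] : exists2 k0, 0 < k0 & forall z, r2 <= z <= Dd - de -> k0 <= slow z.
    have [h|h] := leP r2 (Dd - de); last first.
      by exists 1 => // z /andP[a b]; exfalso; lra.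
    have [m mI mmin] := EVT_min h (continuous_subspaceT slow_continuous).
    exists (slow m); last by move=> z zI; apply: mmin; rewrite in_itv.
    by apply: spos; move: mI; rewrite in_itv /= => /andP[-> b] /=; lra.
  (* [R2 / k0] is the time to cross the whole range at speed [k0]; the first summand exceeds the
     time [R2 / 2] of the fastest polygon. *)
  exists (R2 + R2 / k0 + 1) => t tT t0; exists kap0 => // dl D N dlk Dk NDt.
  have Rk : 0 < R2 / k0 by rewrite divr_gt0.
  split; last by apply: (fast dl D N t) => //; have := R2_gt0; lra.
  have [[dl0 dl2 Dp] Dl _ gr dde] := kap0P _ _ dlk Dk.
  have up := upper dl D dlk Dk (ltW rD).
  have big : R2 < N%:R * D * k0.
    by rewrite NDt -ltr_pdivrMr //; have := R2_gt0; lra.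
  have alt : slow Dd = 0 \/ forall j, @char_traj R n rad cb r2 dl D (-1) j < Dd.
    case: sDd => [|[DE _]]; [by left|right=> j].
    have /andP[_ zc] := char_traj_in hn rad_gt0 Lc_ge0 M_ge0 cb_ge0 cb_le cb_lip
      r0 dl0 dl2 Dp Dl j N1.
    by rewrite DE (le_lt_trans zc) // gtrBl.
  have := slow_traj_incr r0 dl0 dl2 Dp Dl (gr rlt) k00 de0 dde DR
    (fun z zI => ltW (spos z zI)) alt (fun j => (up j).1) sk big.
  rewrite ler0_norm; first by lra.
  by rewrite subr_le0; case: (up N).
- have Dlt : Dd < R2 := lt_le_trans rD rR.
  have [k0 k00 sk] : exists2 k0, 0 < k0 & forall z, Dd + de <= z <= r2 -> slow z <= - k0.
    have [h|h] := leP (Dd + de) r2; last first.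
      by exists 1 => // z /andP[a b]; exfalso; lra.
    have [m mI mmax] := EVT_max h (continuous_subspaceT slow_continuous).
    exists (- slow m); last by move=> z zI; rewrite opprK; apply: mmax; rewrite in_itv.
    rewrite oppr_gt0.
    by apply: sneg; move: mI; rewrite in_itv /= => /andP[a ->]; rewrite andbT; lra.
  exists (R2 + R2 / k0 + 1) => t tT t0; exists kap0 => // dl D N dlk Dk NDt.
  have Rk : 0 < R2 / k0 by rewrite divr_gt0.
  split; last by apply: (fast dl D N t) => //; have := R2_gt0; lra.
  have [[dl0 dl2 Dp] Dl gD _ _] := kap0P _ _ dlk Dk.
  have big : R2 < N%:R * D * k0.
    by rewrite NDt -ltr_pdivrMr //; have := R2_gt0; lra.
  have h1 := slow_traj_decr r0 dl0 dl2 Dp Dl rR k00 de0 D0 (gD Dlt) (ltW rD) sD0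
    (fun z zI => ltW (sneg z zI)) sk big.
  have h2 : Dd <= @char_traj R n rad cb r2 dl D (-1) N.
    apply: slow_traj_ge => //; first exact: gD.
    by rewrite /char_traj /traj /= le_min (ltW rD) gD.
  by rewrite ger0_norm ?subr_ge0 //; lra.
Qed.

End LongTimeTrajectories.

(** * The limit radius and the sign of the slowest speed *)

Section LimitRadius.
Context {R : realType}.
Variables (n : nat) (rad : R) (c cb : R -> R).
Hypotheses (hn : (2 <= n)%N) (rad_gt0 : 0 < rad) (cb_cont : continuous cb)
  (cbE : forall r, r \in `[0, rad] -> cb r = c r).

(** For [0 < r <= rad] this is [r] times [(n - 1) / r - c r]. The factor [r] gives it the same sign
    and makes it continuous up to [0], where it equals [n - 1 > 0]. *)
Definition excess (r : R) : R := n%:R - 1 - r * cb r.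

Let excess_cont : continuous excess.
Proof.
move=> r; apply: cvgB; first exact: cvg_cst.
by apply: cvgM; [exact: cvg_id|exact: cb_cont].
Qed.

Let excessE r : 0 < r <= rad -> excess r = r * ((n%:R - 1) / r - c r).
Proof.
move=> /andP[r0 rr]; rewrite /excess cbE; last by rewrite in_itv /= ltW.
by field; rewrite gt_eqF.
Qed.

Lemma AcritE r : Acrit n rad c r <-> 0 < r <= rad /\ excess r = 0.
Proof.
split=> -[rI H]; split=> //; first by rewrite excessE // H subrr mulr0.
move: H; rewrite excessE // => /eqP; rewrite mulf_eq0 subr_eq0 => /orP[/eqP r0|/eqP ->//].
by move: rI; rewrite r0 ltxx.
Qed.

Lemma AplusE r : Aplus n rad c r <-> 0 < r <= rad /\ excess r < 0.
Proof.
split=> -[rI H]; split=> //; have /andP[r0 _] := rI.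
  by rewrite excessE // pmulr_rlt0 // subr_lt0.
by move: H; rewrite excessE // pmulr_rlt0 // subr_lt0.
Qed.

Let excess0 : 0 < excess 0.
Proof.
by rewrite /excess mul0r subr0 subr_gt0 (ltr_nat R 1).
Qed.

Let zeros_compact a b : compact (`[a, b]%classic `&` [set r | excess r = 0]).
Proof.
apply: compact_closedI; first exact: segment_compact.
have -> : [set r | excess r = 0] = excess @^-1` [set 0] by [].
by apply: preimage_closed; [move=> r _; exact: excess_cont|exact: closed_eq].
Qed.

Let excess_zero a b : a <= b -> Num.min (excess a) (excess b) <= 0 <=
  Num.max (excess a) (excess b) -> exists2 r, a <= r <= b & excess r = 0.
Proof.
move=> ab h; have [r rI r0] := IVT ab (continuous_subspaceT excess_cont) h.
by exists r => //; move: rI; rewrite in_itv.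
Qed.

(** The zeros of [excess] in a segment form a compact set, so the extremal zero exists as soon as
    one zero does; by the intermediate value theorem [excess] keeps its sign between [r0] and that
    zero. Below a point of [Aplus] a zero always exists because [excess 0 > 0]. *)
Lemma dfun_cases r0 (d := dfun n rad c r0) : 0 < r0 <= rad ->
  [/\ 0 < d <= rad, excess d = 0 \/ (d = rad /\ 0 <= excess d) &
   [\/ r0 = d,
       r0 < d /\ (forall r, r0 <= r < d -> 0 < excess r) |
       d < r0 /\ excess d = 0 /\ (forall r, d < r <= r0 -> excess r < 0)]].
Proof.
move=> rI; have /andP[r00 rr] := rI; rewrite /d /dfun.
case: ifPn => [/set_mem/AcritE[_ e0]|nA]; first by split=> //; [left|constructor 1].
case: ifPn => [/set_mem/AplusE[_ eneg]|nP].
  set S := _ `&` _; suff : is_max S (set_max S).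
    move=> [[/AcritE[dI d0] /=]]; rewrite in_itv /= => /andP[_ dr] ub.
    set m := set_max S in dI d0 dr ub *.
    split=> //; [by left|constructor 3; split=> //; split=> // r /andP[mr rr0]].
    rewrite ltNge; apply/negP => er.
    have [|s /andP[s1 s2] s0] := @excess_zero r r0 rr0.
      by rewrite ge_min le_max er (ltW eneg) orbT.
    have sr : s < r0 by rewrite lt_neqAle s2 andbT; apply: contraTneq eneg => <-; rewrite s0 ltxx.
    have /andP[m0 _] := dI.
    have : S s.
      split; last by rewrite /= in_itv /= sr (lt_le_trans _ s1) // (lt_trans m0).
      by apply/AcritE; rewrite s0 (le_trans s2 rr) (lt_le_trans _ s1) // (lt_trans m0).
    by move=> /ub; rewrite leNgt (lt_le_trans mr s1).
  (* [set_max] has a default value, so the maximum must be shown to exist. It is found in the closed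
     segment [[0, r0]], and the signs of [excess] at both ends exclude them. *)
  apply: xgetPex.
  have [|s /andP[s1 s2] s0] := @excess_zero 0 r0 (ltW r00).
    by rewrite ge_min le_max (ltW eneg) (ltW excess0) orbT.
  have ne : (`[0, r0]%classic `&` [set r | excess r = 0]) !=set0.
    by exists s; split=> //=; rewrite in_itv /= s1.
  have [m /set_mem[/= mI m0] mmax] := compact_EVT_max ne (zeros_compact (a:=0) (b:=r0))
    (continuous_subspaceT (fun x => cvg_id : id @ x --> x)).
  move: mI; rewrite in_itv /= => /andP[mge mle].
  exists m; split.
    have m_gt0 : 0 < m.
      rewrite lt_neqAle mge andbT; apply/eqP => E.
      by move: excess0; rewrite (congr1 excess E) m0 ltxx.
    have mr : m < r0 by rewrite lt_neqAle mle andbT; apply: contraTneq eneg => <-; rewrite m0 ltxx.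
    split; last by rewrite /= in_itv /= m_gt0.
    by apply/AcritE; rewrite m_gt0 (le_trans mle).
  move=> y [/AcritE[_ y0] /=]; rewrite in_itv /= => /andP[y1 y2].
  by apply: mmax; apply/mem_set; split=> //=; rewrite in_itv /= !ltW.
have epos : 0 < excess r0.
  rewrite ltNge le_eqVlt; apply/negP => /orP[/eqP h|h].
    by move/negP: nA; apply; apply/mem_set/AcritE.
  by move/negP: nP; apply; apply/mem_set/AplusE.
case: ifPn => [/asboolP[s0 [/AcritE[s0I s00] /=]]|/asboolPn noA].
  rewrite in_itv /= => /andP[rs0 s0r].
  set S := _ `&` _; suff : is_min S (set_min S).
    move=> [[/AcritE[dI d0] /=]]; rewrite in_itv /= => /andP[rd dr] lb.
    set m := set_min S in dI d0 rd dr lb *.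
    split=> //; [by left|constructor 2; split=> // r /andP[rr0 rm]].
    rewrite ltNge; apply/negP => er.
    have [|s /andP[s1 s2] s_0] := @excess_zero r0 r rr0.
      by rewrite ge_min le_max er (ltW epos) orbT.
    have sr : r0 < s by rewrite lt_neqAle s1 andbT; apply: contraTneq epos => ->; rewrite s_0 ltxx.
    have srad : s <= rad by rewrite (le_trans s2) // (le_trans (ltW rm)).
    have : S s.
      split; last by rewrite /= in_itv /= sr.
      by apply/AcritE; rewrite s_0 srad (lt_trans r00).
    by move=> /lb; rewrite leNgt (le_lt_trans s2 rm).
  apply: xgetPex.
  have ne : (`[r0, rad]%classic `&` [set r | excess r = 0]) !=set0.
    by exists s0; split=> //=; rewrite in_itv /= (ltW rs0).
  have [m /set_mem[/= mI m0] mmin] := compact_EVT_min ne (zeros_compact (a:=r0) (b:=rad))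
    (continuous_subspaceT (fun x => cvg_id : id @ x --> x)).
  move: mI; rewrite in_itv /= => /andP[mge mle].
  have mr : r0 < m by rewrite lt_neqAle mge andbT; apply: contraTneq epos => ->; rewrite m0 ltxx.
  exists m; split.
    split; last by rewrite /= in_itv /= mr.
    by apply/AcritE; rewrite mle (lt_trans r00).
  move=> y [/AcritE[_ y0] /=]; rewrite in_itv /= => /andP[y1 y2].
  by apply: mmin; apply/mem_set; split=> //=; rewrite in_itv /= (ltW y1).
(* No zero lies beyond [r0], so [excess] stays positive up to [rad], which is the value of [d]
   here. *)
have pos r : r0 <= r <= rad -> 0 < excess r.
  move=> /andP[rr0 rrad]; rewrite ltNge; apply/negP => er.
  have [|s /andP[s1 s2] s_0] := @excess_zero r0 r rr0.
    by rewrite ge_min le_max er (ltW epos) orbT.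
  have sr : r0 < s by rewrite lt_neqAle s1 andbT; apply: contraTneq epos => ->; rewrite s_0 ltxx.
  apply: noA; exists s; split; last by rewrite /= in_itv /= sr (le_trans s2).
  by apply/AcritE; rewrite s_0 (le_trans s2) // (lt_trans r00).
split; first by rewrite rad_gt0 lexx.
  by right; split=> //; apply/ltW/pos; rewrite rr lexx.
move: rr; rewrite le_eqVlt => /orP[/eqP|] h; [by constructor 1|constructor 2].
by split=> // r /andP[r1 r2]; apply: pos; rewrite r1 ltW.
Qed.

End LimitRadius.

Lemma clip_near (R : realType) (a b s de : R) : a <= b -> 0 <= de ->
  s <= b + de -> a <= s + de -> exists2 s', a <= s' <= b & `|s' - s| <= de.
Proof.
move=> ab de0 sb sa; exists (Num.min b (Num.max a s)).
  by rewrite le_min ab le_max lexx ge_min lexx.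
have [h|h] := leP a s; last by rewrite (min_idPr ab); apply/ler_normlP; split; lra.
have [h'|h'] := leP b s; last by rewrite subrr normr0.
by apply/ler_normlP; split; lra.
Qed.

Lemma mesh_exists (R : realType) (t kap : R) : 0 < t -> 0 < kap ->
  exists (D : R) (N : nat), 0 < D <= kap /\ N%:R * D = t.
Proof.
move=> t0 k0; pose N := (Num.truncn (t / kap)).+1.
have tk0 : 0 <= t / kap by rewrite divr_ge0 // ltW.
have /andP[_ tN] := truncn_itv tk0.
have N0 : 0 < N%:R :> R by rewrite ltr0n.
exists (t / N%:R), N; split; last by rewrite mulrC divfK // gt_eqF.
rewrite divr_gt0 //= ler_pdivrMr // mulrC -ler_pdivrMr //; exact: ltW.
Qed.

(** * Radial symmetry and convergence of the solution *)

Section RadialLimit.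
Context {R : realType} {n : nat}.
Variables (rad : R) (c u0 : R -> R) (u : 'rV[R]_n * R -> R).
Hypotheses (hn : (2 <= n)%N) (rad_gt0 : 0 < rad) (hc : C1_on `[0, rad] c)
  (hc0 : forall r, r \in `[0, rad] -> 0 <= c r) (hu0 : C2_on `[0, rad] u0)
  (hu : viscosity_solution rad (fun x => c (enorm x)) (fun x => u0 (enorm x)) u).

Let v0 (h : R) : R := u0 (Num.sqrt h).
Let cb (r : R) : R := c (clamp rad r).

Let cbE r : r \in `[0, rad] -> cb r = c r.
Proof. by move=> rI; rewrite /cb clamp_id. Qed.

Let cb_ge0 x : 0 <= cb x.
Proof. by apply: hc0; exact: clamp_in (ltW rad_gt0). Qed.

Let ball_enorm (x : 'rV[R]_n) : ball_cl rad x -> enorm x \in `[0, rad].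
Proof. by move=> xb; rewrite in_itv /= enorm_ge0. Qed.

Let u_init x : ball_cl rad x -> u (x, 0) = v0 (sqn x).
Proof.
move=> xb; rewrite /v0 sqrt_sqn; case: hu => _ [_ sub0 _] [_ sup0 _].
by apply/eqP; rewrite eq_le sub0 // sup0.
Qed.

Let sqrt_in h : 0 <= h <= rad ^+ 2 -> Num.sqrt h \in `[0, rad].
Proof. by move=> hI; rewrite in_itv /= sqrtr_ge0 sqrt_le_rad. Qed.

Let u0_lip : exists2 k : R, 0 <= k & forall x y, x \in `[0, rad] -> y \in `[0, rad] ->
  `|u0 x - u0 y| <= k * `|x - y|.
Proof. exact: C1_lipschitz rad_gt0 (C2_on_C1_on hu0). Qed.

Let zero_in : 0 \in `[0, rad].
Proof. by rewrite in_itv /= lexx ltW. Qed.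

Let v0_bounded : exists M0 : R, forall h, 0 <= h <= rad ^+ 2 -> `|v0 h| <= M0.
Proof.
have [k k0 lip] := u0_lip; exists (`|u0 0| + k * rad) => h hI.
have sI := sqrt_in hI; have := lip _ _ sI zero_in.
rewrite subr0 (ger0_norm (sqrtr_ge0 _)) => l.
have -> : v0 h = u0 0 + (v0 h - u0 0) by ring.
rewrite (le_trans (ler_normD _ _)) // lerD2l (le_trans l) // ler_wpM2l //.
exact: sqrt_le_rad.
Qed.

(** [v0 h = u0 (sqrt h)] need not be Lipschitz at [0]; the square root is Hölder of exponent [1/2],
    whence the square in the choice of [de]. *)
Let v0_unif e : 0 < e -> exists2 de, 0 < de &
  forall h h', 0 <= h <= rad ^+ 2 -> 0 <= h' <= rad ^+ 2 ->
    `|h - h'| <= de -> `|v0 h - v0 h'| <= e.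
Proof.
move=> e0; have [k k0 lip] := u0_lip.
have k1 : 0 < k + 1 by rewrite ltr_wpDl.
exists ((e / (k + 1)) ^+ 2); first by rewrite exprn_gt0 // divr_gt0.
move=> h h' hI h'I hh; rewrite (le_trans (lip _ _ (sqrt_in hI) (sqrt_in h'I))) //.
have /andP[h0 _] := hI; have /andP[h'0 _] := h'I.
have s1 : `|Num.sqrt h - Num.sqrt h'| <= e / (k + 1).
  apply: le_trans (sqrt_modulus h0 h'0) _.
  have q0 : 0 <= e / (k + 1) by rewrite divr_ge0 // ltW.
  by rewrite -[leRHS](ger0_norm q0) -[leRHS]sqrtr_sqr ler_sqrt // sqr_ge0.
apply: (@le_trans _ _ ((k + 1) * (e / (k + 1)))).
  by apply: ler_pM => //; rewrite lerDl.
by rewrite mulrC divfK // gt_eqF.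
Qed.

Let bounds : exists Lc M : R, [/\ 0 <= Lc, 0 <= M, forall x, cb x <= M,
  forall x y, `|cb x - cb y| <= Lc * `|x - y| &
  forall r2 t e : R, 0 < r2 <= rad ^+ 2 -> 0 < t -> 0 < e ->
  exists2 kap : R, 0 < kap & forall (dl D : R) (N : nat),
    0 < dl <= kap -> 0 < D <= kap -> N%:R * D = t ->
    let zm := @char_traj R n rad cb r2 dl D (-1) N in
    let zp := @char_traj R n rad cb r2 dl D 1 N in
    [/\ 0 <= zm <= zp,
      forall m, (forall s, zm <= s <= zp -> v0 s <= m) ->
        forall x, ball_cl rad x -> sqn x = r2 -> u (x, t) <= m + e &
      forall s, zm <= s <= zp ->
        forall x, ball_cl rad x -> sqn x = r2 -> v0 s - e <= u (x, t)]].
Proof.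
have [Lc Lc0 lip] := C1_lipschitz rad_gt0 hc.
have cI x := clamp_in x (ltW rad_gt0).
have cb_lip x y : `|cb x - cb y| <= Lc * `|x - y|.
  by rewrite (le_trans (lip _ _ (cI x) (cI y))) // ler_wpM2l // clamp_lip.
pose M := `|c 0| + Lc * rad.
have M0 : 0 <= M by rewrite addr_ge0 // mulr_ge0 // ltW.
have cb_le x : cb x <= M.
  have := lip _ _ (cI x) zero_in; rewrite -/(cb x) subr0.
  have := cI x; rewrite in_itv /= => /andP[c0 cr]; rewrite (ger0_norm c0).
  move=> /ler_normlP[_ h]; have := ler_wpM2l Lc0 cr; have := ler_norm (c 0).
  by rewrite /M; lra.
have cb_cont := lipschitz_continuous cb_lip.
have cxC (x : 'rV[R]_n) : ball_cl rad x -> c (enorm x) = cb (enorm x).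
  by move=> /ball_enorm/cbE.
have [u_cont usub usup] := hu.
have [M1 v0b] := v0_bounded.
have tsub := sub_test_subsolution cb_cont cxC usub.
have tsup := sub_test_supersolution cb_cont cxC usup.
exists Lc, M; split=> //.
exact: (solution_bounds hn rad_gt0 Lc0 M0 cb_ge0 cb_le cb_lip u_cont tsub tsup
  u_init v0b v0_unif).
Qed.

(** The bounds depend on [x] only through [|x|^2]: the lower bounds at [y], over all [s] in the
    swept interval, form the majorant that the upper bound at [x] asks for, with total error [e]. *)
Lemma solution_radial (x y : 'rV[R]_n) (t : R) : ball_cl rad x -> ball_cl rad y ->
  enorm x = enorm y -> 0 <= t -> u (x, t) = u (y, t).
Proof.
move=> xb yb xy; rewrite le_eqVlt => /orP[/eqP <-|t0].
  by rewrite !u_init // -!enorm_sqr xy.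
(* The bounds require a positive [r2]; at radius [0] the two points coincide. *)
have [x0|x0] := eqVneq x 0.
  by rewrite x0; congr (u (_, t)); apply/esym/enorm_eq0; rewrite -xy x0 enorm0.
have [Lc [M [_ _ _ _ B]]] := bounds.
wlog suff key : x y xb yb xy x0 / u (x, t) <= u (y, t).
  have y0 : y != 0.
    by apply: contraNneq x0 => y0; apply/eqP/enorm_eq0; rewrite xy y0 enorm0.
  by apply/eqP; rewrite eq_le key // key.
apply/ler_addgt0Pr => e e0; have e2 : 0 < e / 2 by rewrite divr_gt0.
have r2 : 0 < sqn x <= rad ^+ 2.
  by rewrite -enorm_sqr exprn_gt0 ?enorm_gt0 //= enorm_sqr; case/andP: (sqn_ball rad_gt0 xb).
have [kap kap0 H] := B _ _ _ r2 t0 e2.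
have [D [N [DI ND]]] := mesh_exists t0 kap0.
have [|_ up low] := H kap D N _ DI ND; first by rewrite kap0 lexx.
have yr : sqn y = sqn x by rewrite -!enorm_sqr xy.
have -> : u (y, t) + e = (u (y, t) + e / 2) + e / 2 by field.
apply: up => // s sI; have := low s sI y yb yr; lra.
Qed.

Lemma max_exists (d : R) : 0 < d <= rad -> exists m, is_max (u0 @` `[d, rad]) m.
Proof.
move=> /andP[d0 dr].
have cu : {within `[0, rad], continuous u0}.
  by have [f1 [df _]] := hu0; exact: has_derivative_in_continuous df.
have cu' : {within `[d, rad], continuous u0}.
  apply: continuous_subspaceW cu => z /=; rewrite !in_itv /= => /andP[dz ->].
  by rewrite (le_trans (ltW d0)).
have [m mI mmax] := EVT_max dr cu'.
by exists (u0 m); split; [exists m|move=> _ [z zI <-]; exact: mmax].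
Qed.

(** For large [t] and a fine mesh the swept interval [[zm, zp]] has its ends within [de] of those of
    [[d^2, rad^2]], so by uniform continuity the maxima of [v0] over the two differ by at most
    [e / 2]. *)
Lemma solution_limit (r0 : R) (x : 'rV[R]_n) (m : R) : 0 < r0 <= rad ->
  enorm x = r0 -> is_max (u0 @` `[dfun n rad c r0, rad]) m ->
  u (x, t) @[t --> +oo] --> m.
Proof.
move=> rI xr [[rs rsI rsm] mub].
have [Lc [M [Lc0 M0 cb_le cb_lip B]]] := bounds.
have cb_cont := lipschitz_continuous cb_lip.
have [dI dz dc] := dfun_cases hn rad_gt0 cb_cont cbE rI.
set d := dfun n rad c r0 in rsI mub dI dz dc.
have /andP[r00 rr] := rI; have /andP[d0 dr] := dI.
have slowE r : 0 <= r -> slow (n := n) cb (r ^+ 2) = 2 * excess n cb r.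
  by move=> r_ge0; rewrite /slow /drift /excess sqrtr_sqr ger0_norm //; ring.
have sq_le (a b : R) : 0 <= a -> 0 <= b -> (a ^+ 2 <= b ^+ 2) = (a <= b).
  by move=> a0 b0; rewrite ler_pXn2r ?nnegrE.
have sq_lt (a b : R) : 0 <= a -> 0 <= b -> (a ^+ 2 < b ^+ 2) = (a < b).
  by move=> a0 b0; rewrite ltr_pXn2r ?nnegrE.
have r2I : 0 < r0 ^+ 2 <= rad ^+ 2.
  by rewrite exprn_gt0 //= sq_le // ?(ltW r00) ?(ltW rad_gt0).
have d2I : 0 < d ^+ 2 <= rad ^+ 2.
  by rewrite exprn_gt0 //= sq_le // ?(ltW d0) ?(ltW rad_gt0).
have sD : slow (n := n) cb (d ^+ 2) = 0 \/
    (d ^+ 2 = rad ^+ 2 /\ 0 <= slow (n := n) cb (d ^+ 2)).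
  rewrite (slowE _ (ltW d0)); case: dz => [->|[dE e0]]; first by left; rewrite mulr0.
  by right; split; [rewrite dE|rewrite mulr_ge0].
have zE (z : R) : 0 <= z -> z = (Num.sqrt z) ^+ 2 by move=> z0; rewrite sqr_sqrtr.
have cases : [\/ r0 ^+ 2 = d ^+ 2,
      r0 ^+ 2 < d ^+ 2 /\ (forall z, r0 ^+ 2 <= z < d ^+ 2 -> 0 < slow (n := n) cb z) |
      d ^+ 2 < r0 ^+ 2 /\ slow (n := n) cb (d ^+ 2) = 0 /\
        (forall z, d ^+ 2 < z <= r0 ^+ 2 -> slow (n := n) cb z < 0)].
  case: dc => [->|[rd pos]|[dr0 [e0 neg]]]; first by constructor 1.
    constructor 2; split; first by rewrite sq_lt // ltW.
    move=> z /andP[z1 z2]; have z0 : 0 <= z by rewrite (le_trans _ z1) ?sqr_ge0.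
    rewrite (zE _ z0) slowE ?sqrtr_ge0 // mulr_gt0 // pos //.
    by rewrite -sq_le ?sqrtr_ge0 ?(ltW r00) // -sq_lt ?sqrtr_ge0 ?(ltW d0) // sqr_sqrtr // z1.
  constructor 3; split; first by rewrite sq_lt // ltW.
  split; first by rewrite (slowE _ (ltW d0)) e0 mulr0.
  move=> z /andP[z1 z2]; have z0 : 0 <= z by rewrite (le_trans _ (ltW z1)) ?sqr_ge0.
  rewrite (zE _ z0) slowE ?sqrtr_ge0 // pmulr_rlt0 // neg //.
  by rewrite -sq_lt ?sqrtr_ge0 ?(ltW d0) // -sq_le ?sqrtr_ge0 ?(ltW r00) // sqr_sqrtr // z1.
have xb : ball_cl rad x by rewrite /ball_cl /= xr.
have x2 : sqn x = r0 ^+ 2 by rewrite -enorm_sqr xr.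
apply/cvgrPdist_le => e e0; have e2 : 0 < e / 2 by rewrite divr_gt0.
have [de de0 unif] := v0_unif e2.
have [T HT] := slow_traj_limit hn rad_gt0 Lc0 M0 cb_ge0 cb_le cb_lip r2I d2I de0 sD cases.
near=> t.
have tT : T <= t by near: t; apply: nbhs_pinfty_ge; exact: num_real.
have t0 : 0 < t by near: t; apply: nbhs_pinfty_gt; exact: num_real.
have [k1 k10 H1] := HT t tT t0.
have [k2 k20 H2] := B _ _ _ r2I t0 e2.
pose kap := Num.min (Num.min k1 k2) de.
have kap0 : 0 < kap by rewrite /kap !lt_min k10 k20 de0.
have kk1 : kap <= k1 by rewrite /kap !ge_min lexx.
have kk2 : kap <= k2 by rewrite /kap !ge_min lexx !orbT.
have kde : kap <= de by rewrite /kap ge_min lexx orbT.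
have [D [N [/andP[D0 DI] ND]]] := mesh_exists t0 kap0.
have [||zmd zpc] := H1 kap D N _ _ ND; first by rewrite kap0.
  by rewrite D0 (le_trans DI).
have [||zmp up low] := H2 kap D N _ _ ND; first by rewrite kap0.
  by rewrite D0 (le_trans DI).
case/andP: zmp => zm_ge0 zmp; move: zmd zpc zm_ge0 zmp up low.
set zm := char_traj _ _ _ _ _ (-1) N; set zp := char_traj _ _ _ _ _ 1 N.
move=> /ler_normlP[zm1 zm2] zpE zm_ge0 zmp up low.
have /andP[d20 d2R] := d2I.
have zp_le : zp <= rad ^+ 2 by rewrite zpE; lra.
have in_v0 s : d ^+ 2 <= s <= rad ^+ 2 -> v0 s <= m.
  move=> /andP[s1 s2]; have s0 : 0 <= s by rewrite (le_trans (ltW d20)).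
  apply: mub; exists (Num.sqrt s) => //=; rewrite in_itv /=.
  by rewrite -sq_le ?sqrtr_ge0 ?(ltW d0) // sqr_sqrtr // s1 /= sqrt_le_rad ?s0.
rewrite ler_distl lerBlDr (splitr e) !addrA; apply/andP; split.
  apply: up => // s /andP[s1 s2].
  have sR : 0 <= s <= rad ^+ 2 by rewrite (le_trans zm_ge0 s1) (le_trans s2).
  (* A swept point may lie slightly below [d^2]; it is compared with its projection onto
     [[d^2, rad^2]]. *)
  have [||s' s'I sd] := clip_near (s := s) d2R (ltW de0).
  - by rewrite (le_trans (le_trans s2 zp_le)) // lerDl ltW.
  - move: zm1; rewrite opprB lerBlDr => h.
    by rewrite (le_trans h) // addrC lerD2r.
  have s'R : 0 <= s' <= rad ^+ 2.
    by have /andP[a b] := s'I; rewrite b (le_trans _ a) // ltW.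
  have := unif _ _ sR s'R; rewrite distrC => /(_ sd); rewrite ler_distl => /andP[_ h].
  by rewrite (le_trans h) // lerD2r in_v0.
move: rsI; rewrite /= in_itv /= => /andP[rs1 rs2].
have rs0 : 0 <= rs by rewrite (le_trans (ltW d0)).
have s_ge : d ^+ 2 <= rs ^+ 2 by rewrite sq_le ?(ltW d0).
have s_le : rs ^+ 2 <= rad ^+ 2 by rewrite sq_le ?(ltW rad_gt0).
(* Conversely the square of the maximizing radius may fall just outside the swept interval, and its
   projection is used for the lower bound. *)
have [||s sI sd] := clip_near (s := rs ^+ 2) zmp (ltW de0).
- by rewrite zpE -lerBlDr (le_trans (y := rad ^+ 2 - kap)) // lerB.
- move: zm2; rewrite lerBlDr => h.
  by rewrite (le_trans h) // addrC lerD2r.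
have sR : 0 <= s <= rad ^+ 2.
  by move: sI => /andP[a b]; rewrite (le_trans zm_ge0 a) (le_trans b).
have rsR : 0 <= rs ^+ 2 <= rad ^+ 2 by rewrite sqr_ge0.
have vrs : v0 (rs ^+ 2) = m by rewrite /v0 sqrtr_sqr ger0_norm.
have := unif _ _ sR rsR sd; rewrite vrs distrC ler_distl => /andP[_ h].
apply: (le_trans h); rewrite lerD2r -lerBlDr.
exact: (low s sI x xb x2).
Unshelve. all: by end_near. Qed.

End RadialLimit.

Theorem theorem1p4 (R : realType) (n : nat) (rad : R) (c u0 : R -> R)
    (hn : (2 <= n)%N) (hrad : 0 < rad)
    (hc : C1_on `[0, rad] c)
    (hc0 : forall r, r \in `[0, rad] -> 0 <= c r)
    (hu0 : C2_on `[0, rad] u0)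
    (hu0R : has_derivative_in `[0, rad] u0 rad 0)
    (u : 'rV[R]_n * R -> R)
    (hu : viscosity_solution rad (fun x => c (enorm x))
            (fun x => u0 (enorm x)) u) :
  exists phi : R -> R -> R,
    (forall (x : 'rV[R]_n) (t : R), ball_cl rad x -> 0 <= t ->
       u (x, t) = phi (enorm x) t) /\
    exists phi_oo : R -> R,
      forall r0, r0 \in `]0, rad] ->
        (phi r0 t @[t --> +oo] --> phi_oo r0) /\
        is_max (u0 @` `[dfun n rad c r0, rad]) (phi_oo r0).
Proof.
(* A unit vector: the profile is read off along the ray it spans. *)
pose e0 : 'rV[R]_n := delta_mx 0 (Ordinal (ltnW hn)).
have enorm_ray r : 0 <= r -> enorm (r *: e0) = r.
  by move=> r0; rewrite enormZ enorm_delta mulr1 ger0_norm.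
exists (fun r t => u (r *: e0, t)); split.
  move=> x t xb t0; apply: (solution_radial hn hrad hc hc0 hu0 hu) => //.
    by rewrite /ball_cl /= enorm_ray // enorm_ge0.
  by rewrite enorm_ray // enorm_ge0.
exists (fun r => set_max (u0 @` `[dfun n rad c r, rad])) => r0.
rewrite in_itv /= => rI; have /andP[r00 _] := rI.
have [k k0 lip] := C1_lipschitz hrad hc.
have cb_lip x y : `|c (clamp rad x) - c (clamp rad y)| <= k * `|x - y|.
  rewrite (le_trans (lip _ _ (clamp_in _ (ltW hrad)) (clamp_in _ (ltW hrad)))) //.
  by rewrite ler_wpM2l // clamp_lip.
have cbE r : r \in `[0, rad] -> c (clamp rad r) = c r by move=> /clamp_id ->.
have [dI _ _] := dfun_cases hn hrad (lipschitz_continuous cb_lip) cbE rI.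
have mP : is_max (u0 @` `[dfun n rad c r0, rad])
    (set_max (u0 @` `[dfun n rad c r0, rad])).
  by apply: xgetPex; exact: max_exists hu0 _ dI.
split=> //; apply: (solution_limit hn hrad hc hc0 hu0 hu rI _ mP).
by rewrite enorm_ray // ltW.
Qed.
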